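(* Let $G$ be an abelian group and let $\mathcal{R}$ be a $G$-graded real associative algebra that is graded-simple, satisfies the descending chain condition on graded left ideals, and whose identity component $\mathcal{R}_e$ is finite-dimensional. Let $\varphi$ be a degree-preserving involution on $\mathcal{R}$ such that $\mathcal{R}$ is central as a graded algebra with involution, i.e. $\{r\in Z(\mathcal{R})_e \mid \varphi(r)=r\}=\mathbb{R}$. Then there exist a real $G$-graded division algebra $\mathcal{D}$ with $\mathcal{D}_e$ isomorphic to $\mathbb{R}$, $\mathbb{C}$ or $\mathbb{H}$, a degree-preserving involution $\varphi_0$ on $\mathcal{D}$ restricting to the conjugation on $\mathcal{D}_e$, a sign $\delta\in\{\pm1\}$, an element $g_0\in G$, an admissible multiplicity function $\kappa$ (for $(\mathcal{D},\varphi_0,g_0,\delta)$) and a signature function $\sigma$ (for $(\mathcal{D},\varphi_0,g_0,\kappa,\delta)$) such that $(\mathcal{R},\varphi)$ is isomorphic, as a graded algebra with involution, to the graded algebra with involution $M(\mathcal{D},\varphi_0,g_0,\kappa,\sigma,\delta)$ (the matrix algebra $M_k(\mathcal{D})$, $k=|\kappa|$, with the explicit grading and the explicit involution $X\mapsto\Phi^{-1}\varphi_0(X^T)\Phi$ given in the context).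
   Context: $G$ is an abelian group, written multiplicatively, with identity $e$. A $G$-grading on a real algebra $\mathcal R$ is a decomposition $\mathcal R=\bigoplus_{g\in G}\mathcal R_g$ with $\mathcal R_g\mathcal R_h\subseteq\mathcal R_{gh}$; the support is $\{g\mid\mathcal R_g\ne0\}$. An involution on a graded associative algebra is an $\mathbb R$-linear anti-automorphism $\varphi$ with $\varphi^2=\mathrm{id}$ and $\varphi(\mathcal R_g)=\mathcal R_g$ for all $g$ (degree-preserving). Isomorphisms of graded algebras with involution preserve degrees and intertwine the involutions. Graded-simple: nonzero multiplication and no graded two-sided ideals other than $0$ and $\mathcal R$. A graded division algebra is a unital (nonzero) associative $G$-graded algebra in which every nonzero homogeneous element is invertible; its support is a subgroup of $G$. Data. $\mathcal D$ is a real $G$-graded division algebra with $\mathcal D_e\cong\mathbb R,\mathbb C$ or $\mathbb H$ and support $T$; $\varphi_0$ is a degree-preserving involution on $\mathcal D$ restricting to the conjugation on $\mathcal D_e$ (the identity if $\mathcal D_e=\mathbb R$); $\delta\in\{\pm1\}$, with $\delta=1$ if $\mathbb C\cong\mathcal D_e\subseteq Z(\mathcal D)$. Put $K=T$ if $\mathcal D_e=\mathbb R$ or $\mathcal D_e\cong\mathbb H$, and $K=\{t\in T\mid \mathcal D_t \text{ commutes elementwise with }\mathcal D_e\}$ if $\mathcal D_e\cong\mathbb C$. For each $t\in T$ fix $0\ne X_t\in\mathcal D_t$ such that: $X_t$ commutes with $\mathcal D_e$ if $\mathcal D_e\cong\mathbb H$; $\varphi_0(X_t)=\delta X_t$ if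 $\mathcal D_e\cong\mathbb C$ and $t\in K$ (such choices exist). Then $\varphi_0(X_t)=\eta(t)X_t$ with $\eta(t)\in\{\pm1\}$ for all $t\in T$. Fix a section $\xi:G/T\to G$ of the quotient map. For $g_0\in G$ let $(G/T)_{g_0}=\{gT\mid g_0g^2\in T\}$ and, for $x\in(G/T)_{g_0}$, $\tau(x)=g_0\xi(x)^2\in T$. Admissible multiplicity function: a map $\kappa:G/T\to\mathbb Z_{\ge0}$ with finite support such that $\kappa(g_0^{-1}x^{-1})=\kappa(x)$ for all $x$; if $\mathcal D_e=\mathbb R$, $\kappa(x)$ is even whenever $x\in(G/T)_{g_0}$ and $\eta(\tau(x))=-\delta$; if $\mathcal D_e\cong\mathbb C$, $\kappa(x)$ is even whenever $x\in(G/T)_{g_0}$, $\tau(x)\in T\setminus K$ and $\eta(\tau(x))=-\delta$. Write $|\kappa|=\sum_x\kappa(x)$. Signature function for $\kappa$: a map $\sigma:G/T\to\mathbb Z$ with $|\sigma(x)|\le\kappa(x)$ for all $x$, and such that: if $\mathcal D_e=\mathbb R$ or $\mathcal D_e\cong\mathbb H$, then $\sigma(x)\equiv\kappa(x)\pmod 2$ when $x\in(G/T)_{g_0}$ and $\eta(\tau(x))=\delta$, and $\sigma(x)=0$ otherwise; if $\mathcal D_e\cong\mathbb C$, then $\sigma(x)\equiv\kappa(x)\pmod2$ when $x\in(G/T)_{g_0}$ and $\tau(x)\in K$, and $\sigma(x)=0$ otherwise. The graded algebra with involution $M(\mathcal D,\varphi_0,g_0,\kappa,\sigma,\delta)$: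 let $x_1,\dots,x_s$ be the distinct elements of the support of $\kappa$, ordered so that $x_1,\dots,x_m\in(G/T)_{g_0}$ and the others come in pairs with $x_{m+2j-1}x_{m+2j}=g_0^{-1}T$, $j=1,\dots,r$, $m+2r=s$. Let $g_i=\xi(x_i)$, $k_i=\kappa(x_i)$, $k=|\kappa|$. The algebra is $M_k(\mathcal D)=M_k(\mathbb R)\otimes\mathcal D$, matrices partitioned into $s^2$ blocks according to $k=k_1+\dots+k_s$, with $\deg(E\otimes d)=g_itg_j^{-1}$ for a matrix unit $E$ in the $(i,j)$ block and $d\in\mathcal D_t$. The involution is $\varphi(X)=\Phi^{-1}\varphi_0(X^T)\Phi$ ($\varphi_0$ applied entrywise), where $\Phi=X_{t_1}S_1\oplus\dots\oplus X_{t_{m+r}}S_{m+r}$ is block diagonal with: for $1\le j\le r$, $t_{m+j}=g_0g_{m+2j-1}g_{m+2j}$ and $S_{m+j}=\begin{pmatrix}0&I_{k_{m+2j}}\\ \delta\eta(t_{m+j})I_{k_{m+2j}}&0\end{pmatrix}$; for $1\le i\le m$, $t_i=\tau(x_i)$ and - if $\mathcal D_e=\mathbb R$ or $\cong\mathbb H$ with $\eta(t_i)=\delta$, or $\mathcal D_e\cong\mathbb C$ with $t_i\in K$: $S_i=\mathrm{diag}(I_{p_i},-I_{q_i})$ with $p_i=\frac12(\kappa(x_i)+\sigma(x_i))$, $q_i=\frac12(\kappa(x_i)-\sigma(x_i))$; - if $\mathcal D_e=\mathbb R$ with $\eta(t_i)=-\delta$, or $\mathcal D_e\cong\mathbb C$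 with $t_i\in T\setminus K$, $\eta(t_i)=-\delta$: $S_i=\begin{pmatrix}0&I_{k_i/2}\\-I_{k_i/2}&0\end{pmatrix}$; - if $\mathcal D_e\cong\mathbb C$ with $t_i\in T\setminus K$, $\eta(t_i)=\delta$: $S_i=I_{k_i}$; - if $\mathcal D_e\cong\mathbb H$ with $\eta(t_i)=-\delta$: $S_i=\mathbf i I_{k_i}$, $\mathbf i$ a fixed imaginary unit in $\mathcal D_e$. *)

(* Defs.v *)
From HB Require Import structures.
From mathcomp Require Import all_boot all_order all_algebra ring.
From mathcomp Require Import boolp classical_sets functions cardinality reals.
From mathcomp Require Import complex.

Set Implicit Arguments.
Unset Strict Implicit.
Unset Printing Implicit Defensive.

Import Order.TTheory GRing.Theory Num.Theory.
Local Open Scope classical_set_scope.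
Local Open Scope ring_scope.

(* Quat a b c d is a + b i + c j + d k. *)
Record quaternion (R : Type) := Quat { q_re : R; q_i : R; q_j : R; q_k : R }.

Section Quaternion.
Variable R : realType.
Local Notation H := (quaternion R).

Definition quat_tuple (x : H) := (q_re x, q_i x, q_j x, q_k x).
Definition tuple_quat (x : R * R * R * R) : H :=
  let: (a, b, c, d) := x in Quat a b c d.
Fact quat_tupleK : cancel quat_tuple tuple_quat. Proof. by case. Qed.

HB.instance Definition _ := Choice.copy H (can_type quat_tupleK).

Definition addq (x y : H) : H :=
  Quat (q_re x + q_re y) (q_i x + q_i y) (q_j x + q_j y) (q_k x + q_k y).

Definition oppq (x : H) : H := Quat (- q_re x) (- q_i x) (- q_j x) (- q_k x).

Definition scaleq (r : R) (x : H) : H :=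
  Quat (r * q_re x) (r * q_i x) (r * q_j x) (r * q_k x).

Definition mulq (x y : H) : H :=
  let: Quat a b c d := x in let: Quat a' b' c' d' := y in
  Quat (a * a' - b * b' - c * c' - d * d')
       (a * b' + b * a' + c * d' - d * c')
       (a * c' - b * d' + c * a' + d * b')
       (a * d' + b * c' - c * b' + d * a').

Definition conjq (x : H) : H := Quat (q_re x) (- q_i x) (- q_j x) (- q_k x).

Ltac quat_ring :=
  repeat (let x := fresh "x" in move=> x; case: x => ? ? ? ? || move=> ?);
  rewrite /mulq /addq /oppq /scaleq /=; congr Quat; ring.

Fact addqA : associative addq. Proof. quat_ring. Qed.
Fact addqC : commutative addq. Proof. quat_ring. Qed.
Fact add0q : left_id (Quat 0 0 0 0) addq. Proof. quat_ring. Qed.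
Fact addNq : left_inverse (Quat 0 0 0 0) oppq addq. Proof. quat_ring. Qed.

HB.instance Definition _ := GRing.isZmodule.Build H addqA addqC add0q addNq.

Fact mulqA : associative mulq. Proof. quat_ring. Qed.
Fact mul1q : left_id (Quat 1 0 0 0) mulq. Proof. quat_ring. Qed.
Fact mulq1 : right_id (Quat 1 0 0 0) mulq. Proof. quat_ring. Qed.
Fact mulqDl : left_distributive mulq addq. Proof. quat_ring. Qed.
Fact mulqDr : right_distributive mulq addq. Proof. quat_ring. Qed.
Fact oneq_neq0 : Quat 1 0 0 0 != 0 :> H.
Proof. by apply/eqP => -[/eqP]; rewrite oner_eq0. Qed.

HB.instance Definition _ := GRing.Zmodule_isNzRing.Build H
  mulqA mul1q mulq1 mulqDl mulqDr oneq_neq0.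

Fact scaleqA a b (x : H) : scaleq a (scaleq b x) = scaleq (a * b) x.
Proof. move: x; quat_ring. Qed.
Fact scale1q : left_id 1 scaleq. Proof. quat_ring. Qed.
Fact scaleqDr : right_distributive scaleq addq. Proof. quat_ring. Qed.
Fact scaleqDl (x : H) a b :
  scaleq (a + b) x = addq (scaleq a x) (scaleq b x).
Proof. move: x; quat_ring. Qed.

HB.instance Definition _ := GRing.Zmodule_isLmodule.Build R H
  scaleqA scale1q scaleqDr scaleqDl.

Fact scaleqAl a (x y : H) : scaleq a (mulq x y) = mulq (scaleq a x) y.
Proof. move: x y; quat_ring. Qed.

HB.instance Definition _ := GRing.Lmodule_isLalgebra.Build R H scaleqAl.

End Quaternion.

Inductive divkind := KindR | KindC | KindH.

Definition kindC (c : divkind) : bool := if c is KindC then true else false.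
Definition kindH (c : divkind) : bool := if c is KindH then true else false.
Definition kindR (c : divkind) : bool := if c is KindR then true else false.

Definition kind_alg (R : realType) (c : divkind) : lalgType R :=
  match c with
  | KindR => R^o : lalgType R
  | KindC => Rcomplex R : lalgType R
  | KindH => quaternion R : lalgType R
  end.

Definition kind_conj (R : realType) (c : divkind) :
    kind_alg R c -> kind_alg R c :=
  match c return kind_alg R c -> kind_alg R c with
  | KindR => fun x => x
  | KindC => fun x => conjc x
  | KindH => fun x => conjq x
  end.

(* Real algebras are associative but not assumed unital: a real vector space A
   together with a multiplication [mul].  A unital one is an [algType R], whose
   multiplication is [*%R]. *)
Section GradedAlgebras.
Variables (R : realType) (G : groupType).

Section OneAlgebra.
Variables (A : lmodType R) (mul : A -> A -> A) (gr : G -> set A).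

Definition assoc_algebra : Prop :=
  [/\ associative mul, left_distributive mul +%R, right_distributive mul +%R,
      forall (a : R) x y, mul (a *: x) y = a *: mul x y
    & forall (a : R) x y, mul x (a *: y) = a *: mul x y].

Definition subspace (I : set A) : Prop :=
  [/\ I 0, forall x y, I x -> I y -> I (x + y)
    & forall (a : R) x, I x -> I (a *: x)].

Definition sum_of (V : G -> set A) (x : A) : Prop :=
  exists (s : seq G) (f : G -> A),
    [/\ uniq s, forall g, V g (f g) & x = \sum_(g <- s) f g].

Definition independent (V : G -> set A) : Prop :=
  forall (s : seq G) (f : G -> A), uniq s -> (forall g, V g (f g)) ->
    \sum_(g <- s) f g = 0 -> forall g, g \in s -> f g = 0.

Definition grading : Prop :=
  [/\ forall g, subspace (gr g), forall x, sum_of gr x, independent gr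
    & forall g h x y, gr g x -> gr h y -> gr (g * h)%g (mul x y)].

Definition support : set G := [set g | exists2 x, gr g x & x <> 0].

Definition graded_subspace (I : set A) : Prop :=
  subspace I /\ forall x, I x -> sum_of (fun g => gr g `&` I) x.

Definition graded_left_ideal (I : set A) : Prop :=
  graded_subspace I /\ forall r x, I x -> I (mul r x).

Definition graded_ideal (I : set A) : Prop :=
  graded_left_ideal I /\ forall r x, I x -> I (mul x r).

Definition graded_simple : Prop :=
  (exists x y, mul x y <> 0) /\
  forall I, graded_ideal I -> I = [set 0] \/ I = setT.

Definition dcc_graded_left_ideals : Prop :=
  forall I : nat -> set A, (forall n, graded_left_ideal (I n)) ->
    (forall n, I n.+1 `<=` I n) ->
    exists n, forall m, (n <= m)%N -> I m = I n.

Definition finite_dim (I : set A) : Prop :=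
  exists n (b : 'I_n -> A), (forall i, I (b i)) /\
    forall x, I x -> exists c : 'I_n -> R, x = \sum_i c i *: b i.

Definition graded_involution (phi : A -> A) : Prop :=
  [/\ linear phi, forall x y, phi (mul x y) = mul (phi y) (phi x),
      involutive phi & forall g, phi @` gr g = gr g].

Definition center : set A := [set r | forall x, mul r x = mul x r].

Definition identity_element (u : A) : Prop :=
  forall x, mul u x = x /\ mul x u = x.

(* The reals sit in the algebra as the multiples of its identity element,
   whose existence is not part of this condition: it is automatic for a
   graded-simple algebra with dcc on graded left ideals. *)
Definition central_with_involution (phi : A -> A) : Prop :=
  forall u, identity_element u ->
    [set r | [/\ center r, gr 1%g r & phi r = r]] = [set a *: u | a in setT].

End OneAlgebra.

Definition graded_inv_isomorphic
    (A : lmodType R) (mulA : A -> A -> A) (grA : G -> set A) (phiA : A -> A)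
    (B : lmodType R) (mulB : B -> B -> B) (grB : G -> set B) (phiB : B -> B) :
    Prop :=
  exists f : {linear A -> B},
    [/\ bijective f, forall x y, f (mulA x y) = mulB (f x) (f y),
        forall g, f @` grA g = grB g & forall x, f (phiA x) = phiB (f x)].

End GradedAlgebras.

(* G/T as the type of cosets gT. *)
Section Cosets.
Variables (G : groupType) (T : set G).

Definition lcoset_of (g : G) : set G := [set (g * t)%g | t in T].
Definition quot : Type := set_type (range lcoset_of).

Definition quot_pi (g : G) : quot :=
  exist _ (lcoset_of g) (mem_set (imageT lcoset_of g)).

HB.instance Definition _ := Choice.on quot.

End Cosets.

(* M_n(D) as a real algebra; on ['M[D]_n] itself the library only provides the
   scaling by elements of D. *)
Definition matalg (R : realType) (D : algType R) (n : nat) : Type := 'M[D]_n.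

Section MatrixAlgebra.
Variables (R : realType) (D : algType R) (n : nat).
Local Notation matalg := (matalg D n).

HB.instance Definition _ := GRing.Zmodule.copy matalg 'M[D]_n.

Definition matalg_mul (M N : matalg) : matalg := M *m N.

Definition matalg_scale (a : R) (M : matalg) : matalg :=
  map_mx (fun x : D => a *: x) M.

Fact matalg_scaleA a b M :
  matalg_scale a (matalg_scale b M) = matalg_scale (a * b) M.
Proof. by apply/matrixP => i j; rewrite !mxE scalerA. Qed.
Fact matalg_scale1 : left_id 1 matalg_scale.
Proof. by move=> M; apply/matrixP => i j; rewrite !mxE scale1r. Qed.
Fact matalg_scaleDr : right_distributive matalg_scale +%R.
Proof. by move=> a M N; apply/matrixP => i j; rewrite !mxE scalerDr. Qed.
Fact matalg_scaleDl M : {morph matalg_scale^~ M : a b / a + b}.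
Proof. by move=> a b; apply/matrixP => i j; rewrite !mxE scalerDl. Qed.

HB.instance Definition _ := GRing.Zmodule_isLmodule.Build R matalg
  matalg_scaleA matalg_scale1 matalg_scaleDr matalg_scaleDl.

End MatrixAlgebra.

(* (D, phi0, delta); [dv_iota] identifies R, C or H with D_e. *)
Record divdata (R : realType) (G : groupType) := DivData {
  dv_alg : algType R;
  dv_gr : G -> set dv_alg;
  dv_inv : dv_alg -> dv_alg;
  dv_kind : divkind;
  dv_iota : {lrmorphism kind_alg R dv_kind -> dv_alg};
  dv_delta : R;
  dv_grading : grading *%R dv_gr;
  dv_division : forall g x, dv_gr g x -> x <> 0 ->
    exists y, x * y = 1 /\ y * x = 1;
  dv_iota_inj : injective dv_iota;
  dv_iota_range : range dv_iota = dv_gr 1%g;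
  dv_involution : graded_involution *%R dv_gr dv_inv;
  dv_conj : forall a, dv_inv (dv_iota a) = dv_iota (kind_conj a);
  dv_sign : dv_delta = 1 \/ dv_delta = -1;
  dv_sign_central : kindC dv_kind -> dv_gr 1%g `<=` center *%R ->
    dv_delta = 1
}.

Definition dv_supp (R : realType) (G : groupType) (d : divdata R G) : set G :=
  support (@dv_gr R G d).

Section Choices.
Variables (R : realType) (G : groupType) (d : divdata R G).

Local Notation D := (dv_alg d).
Local Notation T := (dv_supp d).
Local Notation kind := (dv_kind d).

Definition setK : set G :=
  if kindC kind then
    [set t | T t /\ forall x c : D, dv_gr t x -> dv_gr 1%g c -> x * c = c * x]
  else T.

(* The elements X_t (the values of [ch_X] outside T are irrelevant), the
   section xi, and an imaginary unit of D_e (irrelevant unless D_e = H). *)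
Record choices := Choices {
  ch_X : G -> D;
  ch_xi : quot T -> G;
  ch_i : D;
  ch_X_gr : forall t, T t -> dv_gr t (ch_X t) /\ ch_X t <> 0;
  ch_X_H : kindH kind -> forall t c, T t -> dv_gr 1%g c ->
    ch_X t * c = c * ch_X t;
  ch_X_C : kindC kind -> forall t, setK t ->
    dv_inv (ch_X t) = dv_delta d *: ch_X t;
  ch_xiK : forall x, quot_pi T (ch_xi x) = x;
  ch_i_H : kindH kind -> dv_gr 1%g ch_i /\ ch_i * ch_i = -1
}.

Variable c : choices.
Local Notation X := (ch_X c).
Local Notation xi := (ch_xi c).
Local Notation delta := (dv_delta d).

(* For t in T, phi0(X_t) is X_t or - X_t, so this is the sign defined by
   phi0(X_t) = eta(t) X_t. *)
Definition eta (t : G) : R := if `[< dv_inv (X t) = X t >] then 1 else -1.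

Variable g0 : G.

Definition fixed_cosets : set (quot T) :=
  [set quot_pi T g | g in [set g | T (g0 * (g * g))%g]].

Definition tau (x : quot T) : G := (g0 * (xi x * xi x))%g.

Definition multiplicity_function (kappa : quot T -> nat) : Prop :=
  [/\ finite_set [set x | kappa x <> 0%N],
      forall g, kappa (quot_pi T (g0^-1 * g^-1)%g) = kappa (quot_pi T g),
      kindR kind -> forall x, fixed_cosets x -> eta (tau x) = - delta ->
        ~~ odd (kappa x)
    & kindC kind -> forall x, fixed_cosets x -> ~ setK (tau x) ->
        eta (tau x) = - delta -> ~~ odd (kappa x)].

Definition has_signature (x : quot T) : Prop :=
  fixed_cosets x /\
  if kindC kind then setK (tau x) else eta (tau x) = delta.

Variable kappa : quot T -> nat.

Definition signature_function (sigma : quot T -> int) : Prop :=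
  forall x, [/\ (`|sigma x| <= kappa x)%N,
    has_signature x -> (sigma x = (kappa x)%:Z %[mod 2])%Z
    & ~ has_signature x -> sigma x = 0].

(* x_1, ..., x_s is [xs]; with indices starting at 0, the pairs are at
   positions m + 2j, m + 2j + 1 for j < r. *)
Definition support_ordering (xs : seq (quot T)) (m : nat) : Prop :=
  [/\ uniq xs, forall x, (x \in xs) = (kappa x != 0%N),
      forall i, (i < m)%N -> fixed_cosets (nth (quot_pi T 1%g) xs i)
    & exists2 r, size xs = (m + r.*2)%N &
      forall j, (j < r)%N ->
        quot_pi T (xi (nth (quot_pi T 1%g) xs (m + j.*2)) *
                   xi (nth (quot_pi T 1%g) xs (m + j.*2).+1))%g
        = quot_pi T (g0^-1)%g].

Variables (sigma : quot T -> int) (xs : seq (quot T)) (m : nat).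

Definition blk_x (i : nat) : quot T := nth (quot_pi T 1%g) xs i.
Definition blk_g (i : nat) : G := xi (blk_x i).
Definition blk_k (i : nat) : nat := kappa (blk_x i).

Definition blk_dim : nat := \sum_(i < size xs) blk_k i.

Local Notation matalg := (matalg D blk_dim).

Definition mat_block (M : matalg) (i j : 'I_(size xs)) :
    'M[D]_(blk_k i, blk_k j) :=
  submxblock (p_ := fun i : 'I_(size xs) => blk_k i)
             (q_ := fun j : 'I_(size xs) => blk_k j) M i j.

(* E (x) d with E a matrix unit in block (i, j) and d in D_t has degree
   g_i t g_j^-1. *)
Definition matalg_gr (g : G) : set matalg :=
  [set M | forall (i j : 'I_(size xs)) a b t,
    (blk_g i * t * (blk_g j)^-1)%g = g -> dv_gr t (mat_block M i j a b)].

(* Only used when sigma x = kappa x mod 2, so that the half is exact. *)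
Definition blk_p (x : quot T) : nat := (absz ((kappa x)%:Z + sigma x))./2.

Definition S_fixed (x : quot T) : 'M[D]_(kappa x) :=
  if `[< has_signature x >] then
    diag_mx (\row_a (if (a < blk_p x)%N then 1 else -1))
  else if kindH kind then (ch_i c)%:M
  else if kindC kind && (eta (tau x) == delta) then 1%:M
  else \matrix_(a, b) (if (b == a + (kappa x)./2 :> nat)%N then 1
                       else if (a == b + (kappa x)./2 :> nat)%N then -1
                       else 0).

Definition pair_t (i : nat) : G := (g0 * blk_g i * blk_g i.+1)%g.

(* [conform_mx 0] only casts along an equality of sizes: kappa takes the same
   value on both members of a pair. *)
Definition Phi_block (i j : nat) : 'M[D]_(blk_k i, blk_k j) :=
  if (i == j) && (i < m)%N then
    conform_mx 0 (ch_X c (tau (blk_x i)) *: S_fixed (blk_x i))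
  else if [&& (m <= i)%N, ~~ odd (i - m) & j == i.+1] then
    conform_mx 0 ((X (pair_t i))%:M : 'M[D]_(blk_k i))
  else if [&& (m <= j)%N, ~~ odd (j - m) & i == j.+1] then
    conform_mx 0
      (((delta * eta (pair_t j)) *: X (pair_t j))%:M : 'M[D]_(blk_k i))
  else 0.

Definition Phi : matalg :=
  \mxblock_(i < size xs, j < size xs) Phi_block i j.

(* X |-> Phi^-1 phi0(X^T) Phi, with Psi standing for Phi^-1: there is no
   [invmx] over a noncommutative ring. *)
Definition matalg_inv (Psi M : matalg) : matalg :=
  Psi *m map_mx (@dv_inv R G d) M^T *m Phi.

Definition is_Phi_inverse (Psi : matalg) : Prop :=
  Psi *m Phi = 1%:M /\ Phi *m Psi = 1%:M.

End Choices.

Arguments matalg_gr {R G d} c kappa xs g.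
Arguments matalg_inv {R G d} c g0 {kappa} sigma {xs} m Psi M.
Arguments matalg_mul {R} D n M N.

(* Main.v *)
(* Let eps A eps be the corner at the unit eps of a minimal graded left ideal: it
   is a graded division algebra D, and V = A eps is a graded right D-module on
   which A acts faithfully.  Any homogeneous u <> 0 in phi(eps) A eps is
   invertible in the appropriate sense, d |-> u^-1 phi(d) u is an
   anti-automorphism of D, and B(v, w) = u^-1 phi(v) w is a nondegenerate form on
   V whose adjunction is phi.  Averaging over the quaternion group (D_e = H), or
   multiplying u by an element of D that does not commute with D_e (D_e = C),
   makes the anti-automorphism restrict to the conjugation; when D_e = C is
   central, this is what the centrality hypothesis gives.  Gram-Schmidt then
   splits V into hyperbolic pairs and anisotropic lines generated by vectors
   whose degrees lie in the image of the section xi: the Gram matrix of such a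
   basis is Phi, kappa counts the vectors in each coset, and sigma is the
   difference between the numbers of positive and negative ones.  Termination
   comes from the descending chain condition on annihilators. *)

Require Import Defs.
From HB Require Import structures.
From mathcomp Require Import all_boot all_order all_algebra ring lra.
From mathcomp Require Import boolp classical_sets functions cardinality reals.
From mathcomp Require Import complex.

Set Implicit Arguments.
Unset Strict Implicit.
Unset Printing Implicit Defensive.

Import Order.TTheory GRing.Theory Num.Theory.
Local Open Scope classical_set_scope.
Local Open Scope ring_scope.

(** * Words in an abelian group *)

(** The Gram matrix must be [Phi] on the nose, for every choice of the X_t, of the section and of
    the imaginary unit, and for every ordering of the support. So vectors are moved into the degrees
    xi(x) and scaled by elements of D until the form takes the prescribed values. What cannot be
    scaled away is a real sign: where X_t commutes with D_e and eta(t) = delta, a value B(v, v) = r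
    X_t has r real, and scaling v by a nonzero q in D_e multiplies r by the norm phi_0(q) q > 0.
    These cosets carry the signature. An ordering may list the two cosets of a hyperbolic pair
    either way round, so the basis is reoriented once the ordering is known, at the cost of a factor
    delta eta(t); kappa and sigma do not see this. Neither A nor D need be finite-dimensional, so
    dimensions cannot be counted. Instead z |-> v B(w, z) is given by an element of A which kills
    the vectors found so far but not a new one, so each extension shrinks an annihilator. The same
    descent produces the identity of A, which is not given: an idempotent is enlarged until it is a
    left identity, and phi makes it two-sided. *)

Inductive gword := GVar of nat | GOne | GMul of gword & gword | GInv of gword.

Section AbelianWords.
Variables (G : groupType) (GC : forall g h : G, (g * h = h * g)%g).
Variable env : seq G.

Fixpoint geval (w : gword) : G :=
  match w with
  | GVar n => nth 1%g env n
  | GOne => 1%g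
  | GMul a b => (geval a * geval b)%g
  | GInv a => (geval a)^-1%g
  end.

(* [gcount b w i] counts the occurrences of the i-th variable under an odd
   ([b = true]) or even ([b = false]) number of inversions. *)
Fixpoint gcount (b : bool) (w : gword) (i : nat) : nat :=
  match w with
  | GVar n => ~~ b && (i == n)
  | GOne => 0
  | GMul v w => gcount b v i + gcount b w i
  | GInv v => gcount (~~ b) v i
  end.

Fixpoint gscope (w : gword) : bool :=
  match w with
  | GVar n => (n < size env)%N
  | GOne => true
  | GMul v w => gscope v && gscope w
  | GInv v => gscope v
  end.

Let gmon (f : nat -> nat) : G :=
  (\prod_(i <- iota 0 (size env)) nth 1 env i ^+ f i)%g.

Let gmonD f g : gmon (fun i => f i + g i)%N = (gmon f * gmon g)%g.
Proof.
rewrite /gmon -prodgM_commute; first by apply: eq_bigr => i _; rewrite expgnDr.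
by move=> *; apply: GC.
Qed.

Let gmon0 : gmon (fun=> 0%N) = 1%g.
Proof. by rewrite /gmon big1_seq // => i _; rewrite expg0. Qed.

Let gmon1 n : (n < size env)%N -> gmon (fun i => i == n) = nth 1%g env n.
Proof.
move=> ltn; suff H r : uniq r ->
    (\prod_(i <- r) nth 1 env i ^+ (i == n))%g =
    if n \in r then nth 1%g env n else 1%g.
  by rewrite /gmon H ?iota_uniq // mem_iota ltn.
elim: r => [|i r IHr] /=; first by rewrite big_nil.
case/andP=> ir /IHr; rewrite big_cons inE eq_sym => ->.
by case: eqP ir => [-> /negPf ->|_ _]; rewrite ?expg1 ?mulg1 ?expg0 ?mul1g.
Qed.

Let gevalE w :
  gscope w -> (geval w * gmon (gcount true w) = gmon (gcount false w))%g.
Proof.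
elim: w => [n|_|v IHv w IHw /andP[/IHv ev /IHw ew]|v IHv /IHv ev] /=.
- by move=> ltn; rewrite gmon0 gmon1 ?mulg1.
- by rewrite mul1g.
- by rewrite !gmonD -ev -ew !mulgA; congr (_ * _)%g; rewrite -!mulgA;
    congr (_ * _)%g; apply: GC.
- by rewrite -ev mulKg.
Qed.

(** Each word times the monomial of its inverted occurrences is the monomial of the other ones.
    After clearing these denominators both sides are equal products of powers, and cancellation in G
    concludes. *)
Lemma gword_eq v w :
  [&& gscope v, gscope w & all (fun i =>
     gcount false v i + gcount true w i == gcount false w i + gcount true v i)%N
   (iota 0 (size env))] ->
  geval v = geval w.
Proof.
case/and3P=> /gevalE ev /gevalE ew /allP e.
have: gmon (fun i => gcount false v i + gcount true w i)%N =
      gmon (fun i => gcount false w i + gcount true v i)%N.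
  by apply: eq_big_seq => i /e /eqP ->.
rewrite !gmonD -ev -ew -!mulgA [(gmon (gcount true w) * _)%g]GC.
by move/mulIg.
Qed.

End AbelianWords.

Ltac gmem x l :=
  lazymatch l with
  | cons x _ => constr:(true)
  | cons _ ?l => gmem x l
  | nil => constr:(false)
  end.

Ltac gvars t l :=
  lazymatch t with
  | (?a * ?b)%g => let l := gvars a l in gvars b l
  | (?a^-1)%g => gvars a l
  | 1%g => l
  | _ => lazymatch gmem t l with true => l | false => constr:(cons t l) end
  end.

Ltac gindex x l :=
  lazymatch l with
  | cons x _ => constr:(O)
  | cons _ ?l => let n := gindex x l in constr:(S n)
  end.

Ltac gquote t l :=
  lazymatch t with
  | (?a * ?b)%g =>
      let a := gquote a l in let b := gquote b l in constr:(GMul a b)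
  | (?a^-1)%g => let a := gquote a l in constr:(GInv a)
  | 1%g => constr:(GOne)
  | _ => let n := gindex t l in constr:(GVar n)
  end.

(** Decides identities between degrees by reflection; the comparison of exponents is run by
    conversion on [isT]. *)
Ltac abelian GC :=
  lazymatch goal with
  | |- @eq ?T ?a ?b =>
      let l := gvars a (@nil T) in let l := gvars b l in
      let v := gquote a l in let w := gquote b l in
      exact: (@gword_eq _ GC l v w isT)
  end.

(** * Graded-simple algebras *)

Section GradedAlgebra.
Variables (R : realType) (G : groupType).
Variables (A : lmodType R) (mul : A -> A -> A) (gr : G -> set A).
Hypotheses (mul_assoc : assoc_algebra mul) (gr_grading : grading mul gr).

Local Notation "x ** y" := (mul x y) (at level 40, left associativity).

Lemma nmulA x y z : x ** (y ** z) = x ** y ** z.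
Proof. by have [H _ _ _ _] := mul_assoc; apply: H. Qed.
Lemma nmulDl x y z : (x + y) ** z = x ** z + y ** z.
Proof. by have [_ H _ _ _] := mul_assoc; apply: H. Qed.
Lemma nmulDr x y z : x ** (y + z) = x ** y + x ** z.
Proof. by have [_ _ H _ _] := mul_assoc; apply: H. Qed.
Lemma nscaleAl a x y : (a *: x) ** y = a *: (x ** y).
Proof. by have [_ _ _ H _] := mul_assoc; apply: H. Qed.
Lemma nscaleAr a x y : x ** (a *: y) = a *: (x ** y).
Proof. by have [_ _ _ _ H] := mul_assoc; apply: H. Qed.
Lemma nmul0 y : 0 ** y = 0.
Proof. by have := nscaleAl 0 0 y; rewrite !scale0r. Qed.
Lemma nmulr0 x : x ** 0 = 0.
Proof. by have := nscaleAr 0 x 0; rewrite !scale0r. Qed.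
Lemma nmulNl x y : (- x) ** y = - (x ** y).
Proof. by rewrite -scaleN1r nscaleAl scaleN1r. Qed.
Lemma nmulNr x y : x ** (- y) = - (x ** y).
Proof. by rewrite -scaleN1r nscaleAr scaleN1r. Qed.
Lemma nmulBl x y z : (x - y) ** z = x ** z - y ** z.
Proof. by rewrite nmulDl nmulNl. Qed.
Lemma nmulBr x y z : x ** (y - z) = x ** y - x ** z.
Proof. by rewrite nmulDr nmulNr. Qed.
Lemma nmul_suml (I : Type) (s : seq I) (F : I -> A) y :
  (\sum_(i <- s) F i) ** y = \sum_(i <- s) F i ** y.
Proof.
by apply: (big_morph (mul^~ y)) => [? ?|]; rewrite ?nmulDl ?nmul0.
Qed.
Lemma nmul_sumr (I : Type) (s : seq I) (F : I -> A) y :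
  y ** (\sum_(i <- s) F i) = \sum_(i <- s) y ** F i.
Proof.
by apply: (big_morph (mul y)) => [? ?|]; rewrite ?nmulDr ?nmulr0.
Qed.

Lemma gr0 g : gr g 0.
Proof. by case: gr_grading => /(_ g)[]. Qed.
Lemma grD g x y : gr g x -> gr g y -> gr g (x + y).
Proof. by case: gr_grading => /(_ g)[_ + _] _ _ _; apply. Qed.
Lemma grZ g a x : gr g x -> gr g (a *: x).
Proof. by case: gr_grading => /(_ g)[_ _ +] _ _ _; apply. Qed.
Lemma grN g x : gr g x -> gr g (- x).
Proof. by rewrite -scaleN1r; apply: grZ. Qed.
Lemma grB g x y : gr g x -> gr g y -> gr g (x - y).
Proof. by move=> gx gy; apply/grD/grN. Qed.
Lemma gr_sum (I : eqType) g (s : seq I) (F : I -> A) :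
  (forall i, i \in s -> gr g (F i)) -> gr g (\sum_(i <- s) F i).
Proof.
by move=> sF; rewrite big_seq; elim/big_ind: _ => //; [apply: gr0|apply: grD].
Qed.
Lemma grM g h x y : gr g x -> gr h y -> gr (g * h)%g (x ** y).
Proof. by case: gr_grading => _ _ _; apply. Qed.

(** A decomposition is kept as a function on all of G that vanishes outside a finite list, so that
    two decompositions over different lists can be subtracted. *)
Definition components (x : A) (c : G -> A) : Prop :=
  (forall g, gr g (c g)) /\ exists s : seq G,
    [/\ uniq s, forall g, g \notin s -> c g = 0 & x = \sum_(g <- s) c g].

Lemma components_widen (c : G -> A) (s t : seq G) :
  uniq s -> uniq t -> {subset s <= t} -> (forall g, g \notin s -> c g = 0) ->
  \sum_(g <- t) c g = \sum_(g <- s) c g.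
Proof.
move=> us ut st c0; rewrite (bigID (mem s)) /= [X in _ + X]big1 ?addr0.
  rewrite -big_filter; apply: perm_big; apply: uniq_perm => // [|g].
    exact: filter_uniq.
  by rewrite mem_filter; apply/andP/idP => [[]//|sg]; split=> //; apply: st.
by move=> g /c0.
Qed.

Lemma components_lin a x y c d : components x c -> components y d ->
  components (a *: x + y) (fun g => a *: c g + d g).
Proof.
move=> [gc [s [us c0 ->]]] [gd [t [ut d0 ->]]].
split=> [g|]; first by apply: grD => //; apply: grZ.
exists (undup (s ++ t)); split; first exact: undup_uniq.
  move=> g; rewrite mem_undup mem_cat negb_or => /andP[/c0 -> /d0 ->].
  by rewrite scaler0 addr0.
rewrite big_split -scaler_sumr /=.
by congr (_ *: _ + _); apply/esym/components_widen;
  rewrite ?undup_uniq // => g; rewrite mem_undup mem_cat => ->; rewrite ?orbT.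
Qed.

Lemma components_ext x c d g : components x c -> components x d -> c g = d g.
Proof.
move=> xc xd; have := components_lin (-1) xc xd; rewrite scaleN1r addNr.
case=> [ge [s [us e0 /esym sum0]]]; apply/esym/eqP; rewrite -subr_eq0 addrC.
rewrite -scaleN1r; case: gr_grading => _ _ + _ => /(_ s _ us ge sum0 g).
by case: (boolP (g \in s)) => [_ -> //|/e0 -> _].
Qed.

Lemma components_exists x : exists c, components x c.
Proof.
case: gr_grading => _ /(_ x)[s [f [us gf ->]]] _ _.
exists (fun g => if g \in s then f g else 0); split=> [g|].
  by case: ifP => // _; apply: gr0.
exists s; split=> //; first by move=> g /negPf ->.
by apply: eq_big_seq => g ->.
Qed.

Definition hcomp (g : G) (x : A) : A := sval (cid (components_exists x)) g.

Lemma comp_components x : components x (hcomp^~ x).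
Proof. by rewrite /hcomp; case: cid. Qed.

Lemma componentsE x c g : components x c -> hcomp g x = c g.
Proof. exact: (components_ext g (comp_components x)). Qed.

Lemma comp_gr g x : gr g (hcomp g x).
Proof. by have [] := comp_components x. Qed.

Lemma comp_is_linear g : linear (hcomp g).
Proof.
move=> a x y; have := components_lin a (comp_components x) (comp_components y).
by move/(componentsE g) ->.
Qed.
HB.instance Definition _ g :=
  GRing.isLinear.Build R A A *:%R (hcomp g) (comp_is_linear g).

Lemma comp_hom g h x : gr g x -> hcomp h x = if h == g then x else 0.
Proof.
move=> gx; rewrite (@componentsE _ (fun h => if h == g then x else 0)) //.
split=> [k|]; first by case: eqP => [->//|_]; apply: gr0.
exists [:: g]; split=> //; first by move=> k; rewrite inE => /negPf ->.
by rewrite big_seq1 eqxx.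
Qed.

Lemma comp_id g x : gr g x -> hcomp g x = x.
Proof. by move/comp_hom => ->; rewrite eqxx. Qed.

Lemma comp_sum x : exists2 s : seq G, uniq s & x = \sum_(g <- s) hcomp g x.
Proof. by have [_ [s [us _ xE]]] := comp_components x; exists s. Qed.

Lemma comp_neq0 x : x <> 0 -> exists g, hcomp g x <> 0.
Proof.
move=> x0; apply: contrapT => c0; apply: x0; have [s _ ->] := comp_sum x.
by rewrite big1 // => g _; apply: contrapT => ?; apply: c0; exists g.
Qed.

Lemma homogeneous_ind (P : A -> Prop) : P 0 ->
  (forall x y, P x -> P y -> P (x + y)) -> (forall g x, gr g x -> P x) ->
  forall x, P x.
Proof.
move=> P0 PD Pgr x; have [s _ ->] := comp_sum x.
by elim/big_ind: _ => // g _; apply/Pgr/comp_gr.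
Qed.

(** Right multiplication by y shifts all degrees injectively by h, and therefore commutes with
    taking components. *)
Lemma comp_mulr g h x y : gr h y -> hcomp (g * h)%g (x ** y) = hcomp g x ** y.
Proof.
move=> hy; move: x; apply: homogeneous_ind => [|x z xy zy|k x kx].
- by rewrite nmul0 !linear0 nmul0.
- by rewrite nmulDl !linearD /= xy zy nmulDl.
- rewrite (comp_hom _ (grM kx hy)) (comp_hom _ kx).
  by rewrite (inj_eq (@mulIg _ h)); case: ifP => //; rewrite nmul0.
Qed.

Lemma comp_mull g h x y : gr h y -> hcomp (h * g)%g (y ** x) = y ** hcomp g x.
Proof.
move=> hy; move: x; apply: homogeneous_ind => [|x z xy zy|k x kx].
- by rewrite nmulr0 !linear0 nmulr0.
- by rewrite nmulDr !linearD /= xy zy nmulDr.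
- rewrite (comp_hom _ (grM hy kx)) (comp_hom _ kx).
  by rewrite (inj_eq (@mulgI _ h)); case: ifP => //; rewrite nmulr0.
Qed.

Lemma graded_subspaceP I : subspace I ->
  (forall g x, I x -> I (hcomp g x)) <-> graded_subspace gr I.
Proof.
move=> sI; split=> [cI|[_ cI] g x /[dup] Ix /cI[s [f [us If xE]]]].
  split=> // x Ix; have [s us xE] := comp_sum x.
  by exists s, (hcomp^~ x); split=> // g; split; [apply: comp_gr|apply: cI].
rewrite (@componentsE _ (fun g => if g \in s then f g else 0)).
  by case: (g \in s); [have [] := If g|case: sI].
split=> [h|]; first by case: (h \in s); [have [] := If h|apply: gr0].
exists s; split=> //; first by move=> h /negPf ->.
by rewrite xE; apply: eq_big_seq => h ->.
Qed.

Hypothesis A_simple : graded_simple mul gr.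

Lemma graded_ideal_intro I x : subspace I ->
  (forall g x, I x -> I (hcomp g x)) -> (forall r x, I x -> I (r ** x)) ->
  (forall r x, I x -> I (x ** r)) -> I x -> x <> 0 -> I = setT.
Proof.
move=> sI cI lI rI Ix x0; have [_ /(_ I)] := A_simple.
case=> [|I0|//]; last by move: Ix; rewrite I0.
by do 2![split=> //]; apply/graded_subspaceP.
Qed.

(** The elements killed from the left by all of A form a graded two-sided ideal; if it were A, every
    product would vanish. *)
Lemma annihilator_right x : (forall r, r ** x = 0) -> x = 0.
Proof.
move=> x0; apply: contrapT => nx0; have [[a [b ab]] _] := A_simple; apply: ab.
suff JT : [set y | forall r, r ** y = 0] = setT.
  by have : [set y | forall r, r ** y = 0] b by rewrite JT.
apply: (@graded_ideal_intro _ x) => //.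
- split=> [r|y z y0 z0 r|k y y0 r]; rewrite ?nmulr0 // ?nmulDr ?nscaleAr.
    by rewrite y0 z0 addr0.
  by rewrite y0 scaler0.
- move=> g y y0; apply: homogeneous_ind => [|s t|h r hr].
  + by rewrite nmul0.
  + by rewrite nmulDl => -> ->; rewrite addr0.
  + by rewrite -(comp_mull _ _ hr) y0 linear0.
- by move=> r y y0 s; rewrite nmulA y0.
- by move=> r y y0 s; rewrite nmulA y0 nmul0.
Qed.

(** Graded primeness: for homogeneous b the x with x A b = 0 form a graded ideal. If it contained a,
    it would be A, so that A A b = 0 and b = 0. *)
Lemma graded_prime a h b : a <> 0 -> gr h b -> b <> 0 ->
  exists g r, gr g r /\ a ** r ** b <> 0.
Proof.
move=> a0 hb b0; apply: contrapT => ar0.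
have {}ar0 : forall r, a ** r ** b = 0.
  apply: homogeneous_ind => [|s t|g r gr_r].
  + by rewrite nmulr0 nmul0.
  + by rewrite nmulDr nmulDl => -> ->; rewrite addr0.
  + by apply: contrapT => ?; apply: ar0; exists g, r.
have IT : [set x | forall r, x ** r ** b = 0] = setT.
  apply: (@graded_ideal_intro _ a) => //.
  - split=> [r|y z y0 z0 r|k y y0 r]; rewrite ?nmul0 // ?nmulDl ?nscaleAl.
    + by rewrite y0 z0 addr0.
    + by rewrite y0 scaler0.
  - move=> g y y0; apply: homogeneous_ind => [|s t|k r kr].
    + by rewrite nmulr0 nmul0.
    + by rewrite nmulDr nmulDl => -> ->; rewrite addr0.
    + by rewrite -(comp_mulr _ _ kr) -(comp_mulr _ _ hb) y0 linear0.
  - by move=> r y y0 s; rewrite -[r ** y ** s]nmulA -[_ ** b]nmulA y0 nmulr0.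
  - by move=> r y y0 s; rewrite -[y ** r ** s]nmulA y0.
apply: b0; apply: annihilator_right => r; apply: annihilator_right => x.
have : [set x | forall r, x ** r ** b = 0] x by rewrite IT.
by rewrite nmulA; apply.
Qed.

(** * Minimal graded left ideals, division idempotents and the identity element *)

Hypothesis A_dcc : dcc_graded_left_ideals mul gr.

(** Dependent choice turns a family without a minimal member into a strictly descending chain. *)
Lemma minimal_graded_left_ideal (F : set (set A)) : (exists I, F I) ->
  (forall I, F I -> graded_left_ideal mul gr I) ->
  exists2 I, F I & forall J, F J -> J `<=` I -> J = I.
Proof.
move=> [I0 FI0] Fgr; apply: contrapT => nmin.
have next (I : {I | F I}) : {J : {J | F J} | sval J `<=` sval I /\
    sval J <> sval I}.
  apply: cid; apply: contrapT => nJ; apply: nmin; exists (sval I).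
    exact: (svalP I).
  move=> J FJ JI; apply: contrapT => nJI; apply: nJ.
  by exists (exist _ J FJ).
pose chain n := iter n (fun I => sval (next I)) (exist _ I0 FI0).
case: (@A_dcc (fun n => sval (chain n))) => [n|n|n /(_ n.+1 (leqnSn n))].
- exact/Fgr/(svalP (chain n)).
- by case: (svalP (next (chain n))).
- by case: (svalP (next (chain n))).
Qed.

Lemma minimal_left_ideal : exists2 I, graded_left_ideal mul gr I /\
    (exists2 x, I x & x <> 0) &
  forall J, graded_left_ideal mul gr J -> (exists2 x, J x & x <> 0) ->
    J `<=` I -> J = I.
Proof.
case: (@minimal_graded_left_ideal [set I | graded_left_ideal mul gr I /\
  exists2 x, I x & x <> 0]) => [|I []//|I [gI I0] minI].
  exists setT; split; first by split=> //; apply/graded_subspaceP.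
  have [[x [y xy]] _] := A_simple; exists x => // x0; apply: xy.
  by rewrite x0 nmul0.
by exists I => // J gJ J0; apply: minI.
Qed.

(** This says that e A e is a graded division algebra with identity e; A carries no ring structure
    yet, so the corner is described inside A. *)
Definition division_idempotent (e : A) : Prop :=
  [/\ gr 1%g e, e <> 0, e ** e = e &
      forall g d, gr g d -> d <> 0 -> e ** d = d -> d ** e = d ->
      exists d', [/\ gr g^-1%g d', e ** d' = d', d' ** e = d',
                     d ** d' = e & d' ** d = e]].

Lemma graded_left_ideal_subspace I : graded_left_ideal mul gr I -> subspace I.
Proof. by case=> -[]. Qed.

Lemma graded_left_ideal_comp I g x :
  graded_left_ideal mul gr I -> I x -> I (hcomp g x).
Proof.
case=> gI _; apply: (iffRL (graded_subspaceP _)) => //.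
by case: gI.
Qed.

Lemma graded_left_ideal_mulr I g a : graded_left_ideal mul gr I -> gr g a ->
  graded_left_ideal mul gr [set x ** a | x in I].
Proof.
move=> gI ga; have [I0 ID IZ] := graded_left_ideal_subspace gI.
split; last by move=> r _ [x Ix <-]; exists (r ** x);
  rewrite ?nmulA //; apply: gI.2.
apply/graded_subspaceP => [|h _ [x Ix <-]].
  split; first by exists 0; rewrite ?nmul0.
    by move=> _ _ [x Ix <-] [y Iy <-]; exists (x + y); rewrite ?nmulDl; auto.
  by move=> k _ [x Ix <-]; exists (k *: x); rewrite ?nscaleAl; auto.
exists (hcomp (h * g^-1)%g x); first exact: graded_left_ideal_comp.
by rewrite -(comp_mulr _ _ ga) mulgVK.
Qed.

(** Graded Brauer lemma. In a minimal graded left ideal I with I I nonzero, right multiplication by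
    a suitable homogeneous a in I is bijective on I; an e in I of trivial degree with e a = a is
    then a right identity of I. *)
Lemma exists_division_idempotent : exists e, division_idempotent e.
Proof.
have [I [gI [x Ix x0]] minI] := minimal_left_ideal.
have sI := graded_left_ideal_subspace gI; have [I0 ID IZ] := sI.
have IM : forall r y, I y -> I (r ** y) by case: gI.
have IC := graded_left_ideal_comp _ gI.
(* I a is a nonzero graded left ideal inside I, hence equal to I by minimality. *)
have imI g a : gr g a -> I a -> (exists2 y, I y & y ** a <> 0) ->
    forall z, I z -> exists2 y, I y & y ** a = z.
  move=> ga Ia [y Iy ya0] z Iz.
  have IaI : [set x ** a | x in I] = I.
    apply: minI; first exact: graded_left_ideal_mulr ga.
      by exists (y ** a) => //; exists y.
    by move=> _ [w Iw <-]; apply: IM.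
  by have : [set x ** a | x in I] z by rewrite IaI.
(* Otherwise I I = 0, and the left annihilator of I would be a graded ideal containing x, hence all
   of A; but A x = 0 forces x = 0. *)
have [y Iy [z Iz yz]] : exists2 y, I y & exists2 z, I z & y ** z <> 0.
  apply: contrapT => II0.
  have JT : [set r | forall y, I y -> r ** y = 0] = setT.
    apply: (@graded_ideal_intro _ x) => //.
    - split=> [r _|y z y0 z0 r Ir|k y y0 r Ir].
      + by rewrite nmul0.
      + by rewrite nmulDl y0 ?z0 ?addr0.
      + by rewrite nscaleAl y0 ?scaler0.
    - move=> g y y0 r Ir; have [s _ ->] := comp_sum r.
      rewrite nmul_sumr big1 // => h _.
      by rewrite -(comp_mulr _ _ (comp_gr h r)) y0 ?linear0 //; apply: IC.
    - by move=> r y y0 s Is; rewrite -nmulA y0 ?nmulr0.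
    - by move=> r y y0 s Is; rewrite -nmulA y0 //; apply: IM.
    - move=> y Iy; apply: contrapT => ?; apply: II0; exists x => //.
      by exists y.
  apply: x0; apply: annihilator_right => r.
  by have : [set r | forall y, I y -> r ** y = 0] r; [rewrite JT|apply].
have [g a0] : exists g, y ** hcomp g z <> 0.
  apply: contrapT => yz0; apply: yz; have [s _ ->] := comp_sum z.
  rewrite nmul_sumr big1 // => g _; apply: contrapT => ?.
  by apply: yz0; exists g.
set a := hcomp g z in a0; have ga : gr g a by apply: comp_gr.
have Ia : I a by apply: IC.
have [e' Ie' e'a] := imI g a ga Ia (ex_intro2 _ _ y Iy a0) a Ia.
pose e := hcomp 1%g e'.
have Ie : I e by apply: IC.
have ea : e ** a = a by rewrite -(comp_mulr _ _ ga) mul1g e'a comp_id.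
(* The kernel of right multiplication by a in I is a graded left ideal that misses y, so it is 0 by
   minimality. *)
have ann w : I w -> w ** a = 0 -> w = 0.
  move=> Iw wa; apply: contrapT => w0; apply: a0.
  suff : [set w | I w /\ w ** a = 0] y by case.
  rewrite (minI [set w | I w /\ w ** a = 0]) //; last 2 first.
  - by exists w.
  - by move=> ? [].
  split; last by move=> r v [Iv va]; rewrite /= -nmulA va nmulr0; auto.
  apply/graded_subspaceP => [|h v [Iv va]].
    split; rewrite /= ?nmul0 //.
    - move=> v v' [Iv va] [Iv' va']; rewrite nmulDl va va' addr0; auto.
    - move=> k v [Iv va]; rewrite nscaleAl va scaler0; auto.
  by split; [apply: IC|rewrite -(comp_mulr _ _ ga) va linear0].
have Iae w : I w -> w ** e = w.
  move=> Iw; apply/eqP; rewrite -subr_eq0; apply/eqP/ann.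
    by apply: ID; [apply: IM|rewrite -scaleN1r; apply: IZ].
  by rewrite nmulBl -nmulA ea subrr.
have e0 : e <> 0 by move=> e0; apply: a0; rewrite -ea e0 nmul0 nmulr0.
have ge : gr 1%g e by apply: comp_gr.
have linv h d : gr h d -> d <> 0 -> e ** d = d -> d ** e = d ->
    exists d', [/\ gr h^-1%g d', e ** d' = d', d' ** e = d' & d' ** d = e].
  move=> hd d0 ed de; have Id : I d by rewrite -de; apply: IM.
  have [|w Iw wd] := imI h d hd Id _ e Ie; first by exists e; rewrite ?ed.
  have c : hcomp h^-1%g w ** d = e.
    by rewrite -(comp_mulr _ _ hd) mulVg wd comp_id.
  exists (e ** hcomp h^-1%g w); split.
  - by have := grM ge (comp_gr h^-1%g w); rewrite mul1g.
  - by rewrite nmulA Iae.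
  - by rewrite -nmulA Iae //; apply: IC.
  - by rewrite -nmulA c Iae.
exists e; split=> //; first exact: Iae.
move=> h d hd d0 ed de; have [d' [hd' ed' d'e d'd]] := linv h d hd d0 ed de.
have [|d2 [_ _ d2e d2d']] := linv _ d' hd' _ ed' d'e.
  by move=> d'0; apply: e0; rewrite -d'd d'0 nmul0.
(* The left inverse d' has a left inverse d2 in its turn, and d2 = d2 (d' d) = d makes d'
   two-sided. *)
exists d'; split=> //; suff -> : d = d2 by [].
by rewrite -d2e -d'd nmulA d2d'.
Qed.

(** Among the idempotents E of trivial degree that are sums of products (x e)(e y), one with minimal
    left annihilator fixes A e from the left: otherwise a further idempotent w b1 could be added to
    it. *)
Lemma unit_decomposition e phi : graded_involution mul gr phi ->
  division_idempotent e ->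
  exists E, identity_element mul E /\ exists2 s : seq (A * A),
    E = \sum_(p <- s) p.1 ** p.2 &
    forall p, p \in s -> exists g, [/\ gr g p.1, gr g^-1%g p.2,
      p.1 ** e = p.1 & e ** p.2 = p.2].
Proof.
move=> [_ phiM phiK _] [ge e0 ee edivP].
pose good E := exists2 s : seq (A * A), E = \sum_(p <- s) p.1 ** p.2 &
    forall p, p \in s -> exists g, [/\ gr g p.1, gr g^-1%g p.2,
      p.1 ** e = p.1 & e ** p.2 = p.2].
pose ann E := [set r | r ** E = 0].
have annI E : gr 1%g E -> graded_left_ideal mul gr (ann E).
  move=> gE; split=> [|r x]; last first.
    by rewrite /ann /= -nmulA => ->; rewrite nmulr0.
  apply/graded_subspaceP => [|h x].
    split=> [|x y|k x]; rewrite /ann /= ?nmul0 //.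
      by rewrite nmulDl => -> ->; rewrite addr0.
    by rewrite nscaleAl => ->; rewrite scaler0.
  by rewrite /ann /= -(comp_mulr _ _ gE) => ->; rewrite linear0.
case: (@minimal_graded_left_ideal [set ann E | E in
    [set E | [/\ gr 1%g E, E ** E = E & good E]]]).
- exists (ann 0), 0 => //; split; rewrite ?nmul0 //; first exact: gr0.
  by exists [::]; rewrite ?big_nil.
- by move=> _ [E [gE _ _] <-]; apply: annI.
move=> _ [E [gE EE gdE] <-] minE.
have EV v : v ** e = v -> E ** v = v.
  move=> ve; apply: contrapT => Ev.
  have [g] : exists g, hcomp g (v - E ** v) <> 0.
    by apply: comp_neq0 => /eqP; rewrite subr_eq0 => /eqP/esym.
  set w := hcomp g _ => w0; have gw : gr g w by apply: comp_gr.
  have Ew : E ** w = 0.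
    rewrite /w -(comp_mull _ _ gE) mul1g nmulBr nmulA EE subrr.
    by rewrite linear0.
  have we : w ** e = w.
    by rewrite /w -(comp_mulr _ _ ge) mulg1 nmulBl -nmulA ve.
  have [h [r [hr erw]]] := graded_prime e0 gw w0.
  have gd : gr (h * g)%g (e ** r ** w).
    by rewrite -(mul1g (h * g)%g) mulgA; do 2!apply: grM => //.
  have [|| d [dgr ed de _ drw]] := edivP _ _ gd erw.
  - by rewrite !nmulA ee.
  - by rewrite -!nmulA we.
  have hb0 : gr g^-1%g (d ** r).
    suff -> : g^-1%g = ((h * g)^-1 * h)%g by apply: grM.
    by rewrite invgM -mulgA mulVg mulg1.
  (* Subtracting d r E makes b1 E = 0, while b1 w = e survives because E w = 0; so w b1 is an
     idempotent orthogonal to E. *)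
  pose b1 := d ** r - d ** r ** E.
  have gb : gr g^-1%g b1.
    by apply: grB => //; have := grM hb0 gE; rewrite mulg1.
  have bE : b1 ** E = 0 by rewrite /b1 nmulBl -[_ ** E ** E]nmulA EE subrr.
  have eb : e ** b1 = b1 by rewrite /b1 nmulBr !nmulA ed.
  have bw : b1 ** w = e.
    rewrite /b1 nmulBl -[_ ** E ** w]nmulA Ew nmulr0 subr0.
    by rewrite -drw !nmulA de.
  have wbwb : w ** b1 ** (w ** b1) = w ** b1.
    by rewrite nmulA -[w ** b1 ** w]nmulA bw we.
  pose E' := E + w ** b1.
  have E'E : E' ** E = E.
    by rewrite /E' nmulDl EE -nmulA bE nmulr0 addr0.
  have EwbE' : E ** (w ** b1) = 0 by rewrite nmulA Ew nmul0.
  have gE' : gr 1%g E'.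
    by apply: grD => //; rewrite -(mulgV g); apply: grM.
  have E'wb : w ** b1 ** E' = w ** b1.
    by rewrite /E' nmulDr wbwb -nmulA bE nmulr0 add0r.
  have : ann E' = ann E.
    apply: minE.
    - exists E' => //; split=> //.
        by rewrite {2}/E' nmulDr E'E /E' nmulDl EwbE' wbwb add0r.
      case: gdE => s Es sP; exists ((w, b1) :: s).
        by rewrite big_cons -Es addrC.
      move=> p; rewrite inE => /orP[/eqP -> /=|/sP//].
      by exists g; split.
    - by move=> q; rewrite /ann /= => qE'; rewrite -E'E nmulA qE' nmul0.
  (* w b1 annihilates E, but right multiplication by E' fixes it, so equal annihilators force w b1 =
     0. *)
  move/seteqP => [_ /(_ (w ** b1))]; rewrite /ann /=.
  rewrite -nmulA bE nmulr0 E'wb => /(_ erefl) wb0.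
  by apply: w0; rewrite -we -bw nmulA wb0 nmul0.
(* (E r - r) A e = 0 because E fixes A e; graded primeness then gives E r = r. *)
have El r : E ** r = r.
  apply/eqP; rewrite -subr_eq0; apply/eqP; apply: contrapT => Er0.
  have [g [s [_]]] := graded_prime Er0 ge e0; apply.
  by rewrite !nmulBl -!nmulA EV ?subrr // -!nmulA ee.
(* phi turns the left identity E into a right identity, and the two coincide. *)
have phiEr r : r ** phi E = r by rewrite -[r in LHS]phiK -phiM El phiK.
have EphiE : phi E = E by rewrite -[LHS]El phiEr.
by exists E; split=> // x; rewrite El -{1}EphiE phiEr.
Qed.

End GradedAlgebra.

(** * Unital algebras and their corners *)

(** Bundling the identity just constructed with the bare multiplication lets the ring theory of
    [algType] take over. *)
Record unital_algebra (R : realType) := UnitalAlgebra {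
  ua_lmod : lmodType R;
  ua_mul : ua_lmod -> ua_lmod -> ua_lmod;
  ua_one : ua_lmod;
  ua_assoc : assoc_algebra ua_mul;
  ua_oneP : identity_element ua_mul ua_one;
  ua_one_neq0 : ua_one != 0
}.

Definition ua_type (R : realType) (a : unital_algebra R) : Type := ua_lmod a.

Section UnitalAlgebra.
Variables (R : realType) (a : unital_algebra R).
Local Notation A := (ua_type a).

HB.instance Definition _ := GRing.Lmodule.copy A (ua_lmod a).

Fact ua_mulA : associative (@ua_mul R a).
Proof. exact/nmulA/ua_assoc. Qed.
Fact ua_mul1 : left_id (ua_one a) (@ua_mul R a).
Proof. by move=> x; have [] := @ua_oneP _ a x. Qed.
Fact ua_mulr1 : right_id (ua_one a) (@ua_mul R a).
Proof. by move=> x; have [] := @ua_oneP _ a x. Qed.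
Fact ua_mulDl : left_distributive (@ua_mul R a) +%R.
Proof. exact/nmulDl/ua_assoc. Qed.
Fact ua_mulDr : right_distributive (@ua_mul R a) +%R.
Proof. exact/nmulDr/ua_assoc. Qed.

HB.instance Definition _ := GRing.Zmodule_isNzRing.Build A
  ua_mulA ua_mul1 ua_mulr1 ua_mulDl ua_mulDr (ua_one_neq0 a).

Fact ua_scaleAl (k : R) (x y : A) : k *: (x * y) = k *: x * y.
Proof. by rewrite -(nscaleAl (ua_assoc a)). Qed.
HB.instance Definition _ := GRing.Lmodule_isLalgebra.Build R A ua_scaleAl.

Fact ua_scaleAr (k : R) (x y : A) : k *: (x * y) = x * (k *: y).
Proof. by rewrite -(nscaleAr (ua_assoc a)). Qed.
HB.instance Definition _ := GRing.Lalgebra_isAlgebra.Build R A ua_scaleAr.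

End UnitalAlgebra.

Record idempotent_elt (R : realType) (A : algType R) := IdempotentElt {
  idem : A;
  idemK : idem * idem = idem;
  idem_neq0 : idem != 0
}.

Section Corner.
Variables (R : realType) (A : algType R) (e0 : idempotent_elt A).
Local Notation e := (idem e0).

Definition corner_pred : {pred A} := fun x => e * x * e == x.

Fact corner_submod : submod_closed corner_pred.
Proof.
split=> [|k x y]; rewrite !unfold_in ?mulr0 ?mul0r //.
move=> /eqP ex /eqP ey.
by rewrite mulrDr mulrDl -scalerAr -scalerAl ex ey.
Qed.
HB.instance Definition _ :=
  GRing.isSubmodClosed.Build R A corner_pred corner_submod.

Record corner := Corner { cval : A; _ : cval \in corner_pred }.

HB.instance Definition _ := [isSub for cval].
HB.instance Definition _ := [Choice of corner by <:].
HB.instance Definition _ := [SubChoice_isSubLmodule of corner by <:].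

Lemma cval_inj : injective cval. Proof. exact: val_inj. Qed.

Fact cval_is_linear : linear cval. Proof. exact: (@linearP _ _ _ _ val). Qed.
HB.instance Definition _ :=
  GRing.isLinear.Build R corner A *:%R cval cval_is_linear.

Lemma cvalD x y : cval (x + y) = cval x + cval y. Proof. exact: linearD. Qed.
Lemma cvalZ k x : cval (k *: x) = k *: cval x. Proof. exact: linearZ. Qed.
Lemma cval0 : cval 0 = 0. Proof. exact: linear0. Qed.
Lemma cval_sum (I : Type) (s : seq I) P (F : I -> corner) :
  cval (\sum_(i <- s | P i) F i) = \sum_(i <- s | P i) cval (F i).
Proof. exact: linear_sum. Qed.

Lemma cornerP (x : corner) : e * cval x * e = cval x.
Proof. by case: x => x /= /eqP. Qed.

Fact corner_proj_subproof (x : A) : e * x * e \in corner_pred.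
Proof. by rewrite unfold_in !mulrA idemK -!mulrA idemK. Qed.

Definition corner_proj (x : A) : corner := Corner (corner_proj_subproof x).

Lemma cval_projE (x : A) : e * x = x -> x * e = x -> cval (corner_proj x) = x.
Proof. by move=> ex xe; rewrite /= ex xe. Qed.

Lemma cval_mull (x : corner) : e * cval x = cval x.
Proof. by rewrite -[cval x]cornerP !mulrA idemK. Qed.

Lemma cval_mulr (x : corner) : cval x * e = cval x.
Proof. by rewrite -[cval x]cornerP -!mulrA idemK. Qed.

(** The projection only supplies the proof of membership; the value is the plain product, by
    [cvalM]. *)
Definition corner_mul (x y : corner) : corner := corner_proj (cval x * cval y).
Definition corner_one : corner := corner_proj e.

Lemma cvalM x y : cval (corner_mul x y) = cval x * cval y.
Proof. by rewrite cval_projE ?mulrA ?cval_mull // -mulrA cval_mulr. Qed.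

Lemma cval1 : cval corner_one = e.
Proof. by rewrite cval_projE ?idemK. Qed.

Fact corner_mulA : associative corner_mul.
Proof. by move=> x y z; apply: cval_inj; rewrite !cvalM mulrA. Qed.
Fact corner_mul1 : left_id corner_one corner_mul.
Proof. by move=> x; apply: cval_inj; rewrite cvalM cval1 cval_mull. Qed.
Fact corner_mulr1 : right_id corner_one corner_mul.
Proof. by move=> x; apply: cval_inj; rewrite cvalM cval1 cval_mulr. Qed.
Fact corner_mulDl : left_distributive corner_mul +%R.
Proof.
move=> x y z; apply: cval_inj.
by rewrite !(cvalM, cvalD) mulrDl.
Qed.
Fact corner_mulDr : right_distributive corner_mul +%R.
Proof.
move=> x y z; apply: cval_inj.
by rewrite !(cvalM, cvalD) mulrDr.
Qed.
Fact corner_one_neq0 : corner_one != 0.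
Proof.
by apply/eqP => /(congr1 cval)/eqP; rewrite cval1 cval0 (negPf (idem_neq0 e0)).
Qed.

HB.instance Definition _ := GRing.Zmodule_isNzRing.Build corner
  corner_mulA corner_mul1 corner_mulr1 corner_mulDl corner_mulDr
  corner_one_neq0.

Fact corner_scaleAl (k : R) (x y : corner) : k *: (x * y) = k *: x * y.
Proof.
apply: cval_inj.
by rewrite cvalZ [x * y]/(corner_mul _ _) [_ * y]/(corner_mul _ _) !cvalM
  cvalZ -scalerAl.
Qed.
HB.instance Definition _ := GRing.Lmodule_isLalgebra.Build R corner
  corner_scaleAl.

Fact corner_scaleAr (k : R) (x y : corner) : k *: (x * y) = x * (k *: y).
Proof.
apply: cval_inj.
by rewrite cvalZ [x * y]/(corner_mul _ _) [x * _]/(corner_mul _ _) !cvalM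
  cvalZ -scalerAr.
Qed.
HB.instance Definition _ := GRing.Lalgebra_isAlgebra.Build R corner
  corner_scaleAr.

Lemma cval_mul (x y : corner) : cval (x * y) = cval x * cval y.
Proof. exact: cvalM. Qed.

Lemma cval_one : cval 1 = e.
Proof. exact: cval1. Qed.

End Corner.

(** * Finite-dimensional real division algebras *)

(** The norm is the sum of the squares of the coordinates. Its definiteness makes unital morphisms
    injective, and it later provides the factors by which vectors are rescaled. *)
Lemma kind_norm (R : realType) (k : divkind) (x : kind_alg R k) :
  exists n : R, [/\ kind_conj x * x = n%:A, x * kind_conj x = n%:A, 0 <= n &
    (n == 0) = (x == 0)].
Proof.
case: k x => x /=.
- exists (x * x); split; rewrite -?expr2 ?sqr_ge0 ?mulf_eq0 ?orbb //;
    by rewrite -[LHS]mulr1.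
- case: x => a b; exists (a ^+ 2 + b ^+ 2).
  have e (u v : R) : u = a ^+ 2 + b ^+ 2 -> v = 0 ->
      (u +i* v)%C = (a ^+ 2 + b ^+ 2)%:A :> Rcomplex R.
    by move=> -> ->; congr (_ +i* _)%C; rewrite ?mulr1 ?mulr0.
  split; [apply: e; ring|apply: e; ring|by rewrite addr_ge0 ?sqr_ge0|].
  by rewrite eq_complex /= paddr_eq0 ?sqr_ge0 // !sqrf_eq0.
- case: x => a b c d; exists (a ^+ 2 + b ^+ 2 + c ^+ 2 + d ^+ 2).
  split.
  + by congr Quat => /=; ring.
  + by congr Quat => /=; ring.
  + by rewrite !addr_ge0 ?sqr_ge0.
  apply/eqP/eqP => [|[-> -> -> ->]]; last by rewrite expr0n /= !addr0.
  move/eqP; rewrite !paddr_eq0 ?addr_ge0 ?sqr_ge0 // !sqrf_eq0.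
  by case/andP=> /andP[/andP[/eqP -> /eqP ->] /eqP ->] /eqP ->.
Qed.

Lemma kind_inj (R : realType) (k : divkind) (D : algType R)
  (f : {lrmorphism kind_alg R k -> D}) : injective f.
Proof.
apply: raddf_inj => x fx0; apply/eqP.
have [n [_ /(congr1 f) xn _ <-]] := kind_norm x.
move: xn; rewrite rmorphM /= fx0 mul0r rmorph_alg => /esym/eqP.
by rewrite scaler_eq0 oner_eq0 orbF.
Qed.

Section Quadratic.
Variables (R : realType) (D : algType R) (De : set D).
Hypotheses (De1 : De 1) (DeD : forall x y, De x -> De y -> De (x + y))
  (DeZ : forall (a : R) x, De x -> De (a *: x))
  (DeM : forall x y, De x -> De y -> De (x * y)).
Hypothesis De_domain : forall x y, De x -> De y -> x * y = 0 -> x = 0 \/ y = 0.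
Hypothesis De_fin : finite_dim De.

Let De_horner x p : De x -> De (horner_alg x p).
Proof.
move=> Dx; elim/poly_ind: p => [|p c IHp].
  by rewrite rmorph0 -(scale0r 1); apply: DeZ.
rewrite rmorphD rmorphM /= horner_algX horner_algC; apply: DeD; last exact: DeZ.
exact: DeM.
Qed.

(** The n + 1 powers of x up to x^n lie in the span of n vectors, so their coefficient matrix has a
    nonzero left kernel. *)
Lemma annihilating_poly x : De x -> exists2 p : {poly R}, p != 0 &
  horner_alg x p = 0.
Proof.
move=> Dx; have [n [b [_ bP]]] := De_fin.
have DX i : De (x ^+ i).
  by elim: i => [|i IHi]; rewrite ?expr0 ?exprS //; apply: DeM.
have /choice[c cP] : forall i : 'I_n.+1, exists c : 'I_n -> R,
  x ^+ i = \sum_j c j *: b j by move=> i; apply: bP.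
pose M := \matrix_(i, j) c i j.
have : kermx M != 0.
  rewrite -mxrank_eq0 mxrank_ker subn_eq0 -ltnNge.
  by rewrite ltnS; apply: rank_leq_col.
case/rowV0Pn => v /sub_kermxP vM v0.
exists (rVpoly v).
  by apply: contraNneq v0 => rv0; rewrite -(rVpolyK v) rv0 linear0.
rewrite /rVpoly poly_def rmorph_sum /=.
transitivity (\sum_(i < n.+1) v 0 i *: x ^+ i).
  apply: eq_bigr => i _; rewrite insubT //= => ?.
  rewrite linearZ /= rmorphXn /= horner_algX.
  by rewrite mulr_algl; congr (v 0 _ *: _); apply: val_inj.
under eq_bigr => i _ do rewrite cP scaler_sumr.
rewrite exchange_big big1 //= => j _.
under eq_bigr => i _ do rewrite scalerA.
rewrite -scaler_suml; suff -> : \sum_i v 0 i * c i j = 0 by rewrite scale0r.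
transitivity ((v *m M) 0 j); last by rewrite vM mxE.
by rewrite mxE; apply: eq_bigr => i _; rewrite mxE.
Qed.

(** Induction on the size of an annihilating polynomial: a complex root a + b i gives a real factor
    X - a or (X - a)^2 + b^2, and in a domain x is a root either of this factor or of the smaller
    cofactor. *)
Lemma completed_square x : De x -> exists a r : R, (x - a%:A) ^+ 2 = r%:A.
Proof.
move=> Dx; have [p] := annihilating_poly Dx.
elim: {p}(size p) {-2}p (leqnn (size p)) => [|n IHn] p.
  by rewrite leqn0 size_poly_eq0 => /eqP ->; rewrite eqxx.
move=> szp p0 px0.
have step q u : p = u * q -> q != 0 -> (1 < size q)%N ->
    (horner_alg x q = 0 -> exists a r : R, (x - a%:A) ^+ 2 = r%:A) ->
    exists a r : R, (x - a%:A) ^+ 2 = r%:A.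
  move=> pE q0 szq; have := px0; rewrite pE rmorphM => uq.
  have [ux _|qx] := De_domain (De_horner u Dx) (De_horner q Dx) uq; last exact.
  have u0 : u != 0 by apply: contraNneq p0 => u0; rewrite pE u0 mul0r.
  apply: (IHn u) => //; rewrite -ltnS; apply: leq_trans szp.
  rewrite pE size_mul //; case: (size q) szq => [|[|k]] // _.
  by rewrite addnS /= addnS ltnS leq_addr.
have [sz1|/closed_rootP[z]] := eqVneq (size (map_poly (real_complex R) p)) 1%N.
  move: sz1; rewrite size_map_poly => /eqP/size_poly1P[c c0 pc].
  move: px0; rewrite pc horner_algC => /eqP.
  by rewrite scaler_eq0 (negPf c0) oner_eq0.
case: z => a b; have [->|b0] := eqVneq b 0.
  rewrite -[(a +i* 0)%C]/(real_complex R a) fmorph_root => /factor_theorem[q pE].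
  apply: (step ('X - a%:P) q) => //; rewrite ?polyXsubC_eq0 ?size_XsubC //.
  rewrite rmorphB /= horner_algX horner_algC => xa.
  by exists a, 0; rewrite xa expr0n scale0r.
pose q := 'X ^+ 2 - (a *+ 2) *: 'X + (a ^+ 2 + b ^+ 2)%:P : {poly R}.
move=> pz.
have szq : size q = 3.
  rewrite /q -addrA size_polyDl ?size_polyXn //.
  apply: leq_ltn_trans (size_polyD _ _) _; rewrite gtn_max size_polyN.
  rewrite (leq_ltn_trans (size_scale_leq _ _)) ?size_polyX //.
  by rewrite (leq_ltn_trans (size_polyC_leq1 _)).
have q0 : q != 0 by rewrite -size_poly_eq0 szq.
have qz : (map_poly (real_complex R) q).[(a +i* b)%C] = 0.
  rewrite /q rmorphD rmorphB /= map_polyXn map_polyZ /= map_polyX map_polyC /=.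
  rewrite !hornerE expr2.
  by apply/eqP; rewrite eq_complex /=; apply/andP; split; apply/eqP => /=; ring.
(* The remainder is real of degree at most 1 and vanishes at a non-real number. *)
have r0 : modp p q = 0.
  have szr : (size (modp p q) <= 2)%N by have := ltn_modp p q; rewrite szq q0.
  have : (map_poly (real_complex R) (modp p q)).[(a +i* b)%C] = 0.
    move: pz; rewrite [in root _](divp_eq p q) rmorphD rmorphM /= rootE.
    by rewrite hornerD hornerM qz mulr0 add0r => /eqP.
  have -> : modp p q = (modp p q)`_1 *: 'X + ((modp p q)`_0)%:P.
    apply/polyP => -[|[|i]]; rewrite !coefE ?mulr0 ?add0r ?mulr1 ?addr0 //.
    by rewrite nth_default // (leq_trans szr).
  set r1 := _`_1; set r0 := _`_0.
  rewrite rmorphD /= map_polyZ map_polyX map_polyC !hornerE /=.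
  move/eqP; rewrite eq_complex /= => /andP[/eqP re /eqP im].
  have r10 : r1 = 0.
    apply/eqP; rewrite -(mulIr_eq0 _ (mulIf b0)); apply/eqP.
    by rewrite -[RHS]im; ring.
  have r00 : r0 = 0 by rewrite -[RHS]re r10; ring.
  by rewrite r10 r00 scale0r add0r.
apply: (step q (divp p q)) => //; first by rewrite [LHS](divp_eq p q) r0 addr0.
  by rewrite szq.
rewrite /q rmorphD rmorphB /= rmorphXn linearZ /= horner_algX horner_algC.
rewrite mulr_algl => qx; exists a, (- b ^+ 2).
have -> : (x - a%:A) ^+ 2 = x ^+ 2 - (a *+ 2) *: x + (a ^+ 2)%:A.
  rewrite expr2 mulrBl !mulrBr mulr_algl mulr_algr -scalerAl mul1r scalerA.
  by rewrite opprB addrA mulr2n scalerDl opprD !addrA addrAC.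
by apply: (addIr (b ^+ 2)%:A); rewrite -addrA -scalerDl qx scaleNr addNr.
Qed.

Lemma make_lrmorphism k (f : kind_alg R k -> D) :
  linear f -> f 1 = 1 -> {morph f : x y / x * y} ->
  exists F : {lrmorphism kind_alg R k -> D}, F =1 f.
Proof.
move=> flin f1 fM.
pose lin := GRing.isLinear.Build R (kind_alg R k) D *:%R f flin.
pose mor := GRing.isMonoidMorphism.Build (kind_alg R k) D f (conj f1 fM).
pose F : {lrmorphism kind_alg R k -> D} := HB.pack f lin mor.
by exists F.
Qed.

(* Completing the square, x - a is a square root of some real r; R(i) already
   contains two of them, and in a domain there are no others commuting with i. *)
Lemma commuting_with_i x i : De x -> De i -> i * i = -1 -> i * x = x * i ->
  exists a b : R, x = a%:A + b *: i.
Proof.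
move=> Dx Di ii ix; have [a [r]] := completed_square Dx.
set y := x - a%:A => yr.
have Dy : De y by apply: DeD => //; rewrite -scaleNr; apply: DeZ.
have iy : i * y = y * i.
  by rewrite mulrBr mulrBl ix mulr_algl mulr_algr.
have xE u v : y = u%:A + v *: i -> exists a b : R, x = a%:A + b *: i.
  by move=> yE; exists (a + u), v; rewrite scalerDl -addrA -yE addrC subrK.
clearbody y.
have root u v : y * (u%:A + v *: i) = (u%:A + v *: i) * y ->
    (u%:A + v *: i) * (u%:A + v *: i) = r%:A -> exists a b : R, x = a%:A + b *: i.
  set w := u%:A + v *: i => yw ww.
  have Dw : De w by apply: DeD; apply: DeZ.
  have wE : w = u%:A + v *: i by [].
  clearbody w.
  have : (y - w) * (y + w) = 0.
    by rewrite mulrDr !mulrBl yw -expr2 yr ww addrA subrK subrr.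
  case/De_domain; first by apply: DeD => //; rewrite -scaleN1r; apply: DeZ.
  - exact: DeD.
  - by move/eqP; rewrite subr_eq0 wE => /eqP; apply: xE.
  - by move/eqP; rewrite addr_eq0 => /eqP yE; apply: (xE (- u) (- v));
      rewrite yE wE opprD !scaleNr.
have [r0|r0] := leP 0 r.
  apply: (root (Num.sqrt r) 0); rewrite scale0r addr0.
    by rewrite mulr_algl mulr_algr.
  by rewrite mulr_algl scalerA -expr2 sqr_sqrtr.
apply: (root 0 (Num.sqrt (- r))); rewrite scale0r add0r.
  by rewrite -scalerAl -scalerAr iy.
rewrite -scalerAl -scalerAr ii scalerA -expr2 sqr_sqrtr ?oppr_ge0 ?(ltW r0) //.
by rewrite scalerN scaleNr opprK.
Qed.

(** If r were s^2 with s real, (x - s)(x + s) = 0 would make x real; so r < 0 and rescaling turns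
    the square into -1. *)
Lemma imaginary_unit x (r : R) : De x -> x * x = r%:A ->
  (forall a : R, x <> a%:A) -> exists s : R, (s *: x) * (s *: x) = -1.
Proof.
move=> Dx xr nx.
have r0 : r < 0.
  rewrite ltNge; apply/negP => r0; set s := Num.sqrt r.
  have : (x - s%:A) * (x + s%:A) = 0.
    rewrite mulrDr !mulrBl mulr_algr mulr_algl xr mulr_algl scalerA -expr2.
    by rewrite sqr_sqrtr // addrA subrK subrr.
  case/De_domain; rewrite -?scaleNr; try by apply: DeD => //; apply: DeZ.
  - by move/eqP; rewrite scaleNr subr_eq0 => /eqP /nx.
  - by move/eqP; rewrite addr_eq0 -scaleNr => /eqP /nx.
exists (Num.sqrt (- r))^-1.
rewrite -scalerAl -scalerAr xr !scalerA -invfM -expr2 sqr_sqrtr.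
  by rewrite invrN mulNr mulVf ?lt_eqF // scaleN1r.
by rewrite oppr_ge0 ltW.
Qed.

(** If not everything is real or commutes with i, a nonzero commutator with i anticommutes with i
    and becomes j after rescaling. Any element then splits into a part commuting with i and a part
    that commutes with i once multiplied by j. *)
Lemma frobenius :
  exists k (f : {lrmorphism kind_alg R k -> D}), range f = De.
Proof.
have [allR|] := pselect (forall x, De x -> exists a : R, x = a%:A).
  have [|||F FE] := @make_lrmorphism KindR (fun a => a%:A).
  - by move=> k x y; rewrite scalerDl scalerA.
  - by rewrite scale1r.
  - by move=> x y; rewrite mulr_algl scalerA.
  exists KindR, F; apply/seteqP; split=> [_ [a _ <-]|x /allR[a ->]].
    by rewrite FE; apply: DeZ.
  by exists a.
move/existsNP => [x /not_implyP[Dx nx]].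
have {nx} nx (a : R) : x <> a%:A by move=> xa; apply: nx; exists a.
have [a [r xr]] := completed_square Dx.
have Dxa : De (x - a%:A) by apply: DeD => //; rewrite -scaleNr; apply: DeZ.
have [|s ii] := imaginary_unit Dxa xr.
  by move=> b /eqP; rewrite subr_eq -scalerDl => /eqP/nx.
move: ii; set i := s *: _ => ii.
have Di : De i by apply: DeZ.
clearbody i.
have [allC|] := pselect (forall x, De x -> i * x = x * i).
  have [|||F FE] := @make_lrmorphism KindC
    (fun z : Rcomplex R => (complex.Re z)%:A + complex.Im z *: i).
  - move=> k [u v] [w z] /=; rewrite !scalerDl scalerDr !scalerA.
    by rewrite addrACA.
  - by rewrite /= scale1r scale0r addr0.
  - move=> [u v] [w z] /=; rewrite mulrDl !mulrDr !mulr_algl -!scalerAl.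
    rewrite mulr_algr -scalerAr ii !scalerA scalerN !scalerDl scaleNr.
    by rewrite addrACA; congr (_ + _); rewrite addrC.
  exists KindC, F; apply/seteqP; split=> [_ [[u v] _ <-]|y Dy].
    by rewrite FE; apply: DeD; apply: DeZ.
  have [u [v yE]] := commuting_with_i Dy Di ii (allC y Dy).
  by exists (u +i* v)%C => //; rewrite FE.
move/existsNP => [w /not_implyP[Dw nw]].
have DB u v : De u -> De v -> De (u - v).
  by move=> Du Dv; apply: DeD => //; rewrite -scaleN1r; apply: DeZ.
have i0 : i <> 0.
  by move=> i0; move/eqP: ii; rewrite i0 mul0r eq_sym oppr_eq0 oner_eq0.
pose y := w * i - i * w.
have y0 : y <> 0 by move=> /eqP; rewrite subr_eq0 => /eqP/esym.
have iy : i * y = - (y * i).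
  by rewrite mulrBr mulrBl -!mulrA ii mulrN1 !mulrA ii mulN1r opprB opprK addrC.
have Dy : De y by apply: DB; apply: DeM.
clearbody y.
have [|b [c yy]] := commuting_with_i (DeM Dy Dy) Di ii.
  by rewrite mulrA iy mulNr -[y * i * y]mulrA iy mulrN opprK mulrA.
(* y commutes with y y = b + c i but anticommutes with i. *)
have c0 : c = 0.
  have : y * (y * y) = y * y * y by rewrite mulrA.
  rewrite yy mulrDr mulrDl mulr_algr mulr_algl => /addrI.
  rewrite -scalerAl -scalerAr iy scalerN => /eqP; rewrite -addr_eq0 -mulr2n.
  rewrite -scaler_nat scalerA scaler_eq0 mulf_eq0 pnatr_eq0 /=.
  case/orP=> [/eqP //|/eqP/(De_domain Dy Di)[]//].
have {}yy : y * y = b%:A by rewrite yy c0 scale0r addr0.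
have [|t jj] := imaginary_unit Dy yy.
  move=> d yd; have : y * i = 0.
    have := iy; rewrite {1}yd mulr_algr -mulr_algl -yd => /eqP.
    rewrite -addr_eq0 -mulr2n -scaler_nat scaler_eq0 pnatr_eq0 /=.
    by move/eqP.
  by case/(De_domain Dy Di).
move: jj; set j := t *: y => jj.
have Dj : De j by apply: DeZ.
have ij : i * j = - (j * i) by rewrite -scalerAr iy scalerN scalerAl.
clearbody j.
pose k := i * j.
have ji : j * i = - k by rewrite /k ij opprK.
have ik : i * k = - j by rewrite /k mulrA ii mulN1r.
have jk : j * k = i by rewrite /k ij mulrN mulrA jj mulN1r opprK.
have kj : k * j = - i by rewrite /k -mulrA jj mulrN1.
have ki : k * i = j by rewrite /k -mulrA ji mulrN ik opprK.
have kk : k * k = -1 by rewrite {1}/k -mulrA jk ii.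
have Dk : De k by apply: DeM.
have kE : i * j = k by [].
clearbody k.
pose f (q : quaternion R) : D :=
  (q_re q)%:A + q_i q *: i + q_j q *: j + q_k q *: k.
have fD u v : f (u + v) = f u + f v.
  case: u v => [u1 u2 u3 u4] [v1 v2 v3 v4]; rewrite /f /= !scalerDl.
  by do 2![rewrite [RHS]addrACA; congr (_ + _)]; rewrite addrACA.
have fZ u v : f (u *: v) = u *: f v.
  by case: v => [v1 v2 v3 v4]; rewrite /f /= !scalerDr !scalerA.
have fi v : f (Defs.mulq (Quat 0 1 0 0) v) = i * f v.
  case: v => [v1 v2 v3 v4]; rewrite /f /= !mulrDr mulr_algr -!scalerAr ii ik.
  rewrite !(mul0r, mul1r, oppr0, add0r, subr0, addr0) !scalerN scaleNr.
  by rewrite kE ?scaleNr [RHS](ACl (2*1*4*3)).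
have fj v : f (Defs.mulq (Quat 0 0 1 0) v) = j * f v.
  case: v => [v1 v2 v3 v4]; rewrite /f /= !mulrDr mulr_algr -!scalerAr jj jk ji.
  rewrite !(mul0r, mul1r, oppr0, add0r, subr0, addr0) !scalerN !scaleNr.
  by rewrite [RHS](ACl (3*4*1*2)).
have fk v : f (Defs.mulq (Quat 0 0 0 1) v) = k * f v.
  case: v => [v1 v2 v3 v4]; rewrite /f /= !mulrDr mulr_algr -!scalerAr kk ki kj.
  rewrite !(mul0r, mul1r, oppr0, add0r, subr0, addr0) !scalerN !scaleNr.
  by rewrite [RHS](ACl (4*3*2*1)).
have [|||F FE] := @make_lrmorphism KindH f.
- by move=> c' u v; rewrite fD fZ.
- by rewrite /f /= scale1r !scale0r !addr0.
- move=> [u1 u2 u3 u4] v.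
  have -> : Quat u1 u2 u3 u4 * v = u1 *: v + u2 *: Defs.mulq (Quat 0 1 0 0) v +
      u3 *: Defs.mulq (Quat 0 0 1 0) v + u4 *: Defs.mulq (Quat 0 0 0 1) v.
    by case: v => [v1 v2 v3 v4]; congr Quat => /=; ring.
  by rewrite !fD !fZ fi fj fk -[u1 *: _]mulr_algl !scalerAl -!mulrDl.
exists KindH, F; apply/seteqP; split=> [_ [q _ <-]|z Dz].
  by rewrite FE; do !apply: DeD; apply: DeZ => //; apply: DeM.
pose h := 2%:R^-1 : R.
have hh (v : D) : h *: v + h *: v = v.
  by rewrite -scalerDl -mulr2n -mulr_natr mulVf ?scale1r ?pnatr_eq0.
have Dizi : De (i * z * i) by apply: DeM => //; apply: DeM.
(* Conjugation by i maps z to - i z i; these are the parts of z on which it acts as 1 and as -1. *)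
pose zp := h *: (z - i * z * i); pose zm := h *: (z + i * z * i).
have Dzm : De zm by apply/DeZ/DeD.
have izm : i * zm = - (zm * i).
  rewrite -scalerAr -scalerAl -scalerN mulrDr mulrDl !mulrA ii.
  by rewrite -[i * z * i * i]mulrA ii mulN1r mulrN1 opprB addrC mulNr addrC.
have [||p1 [p2 zpE]] := @commuting_with_i zp i _ Di ii.
- by apply/DeZ/DB.
- rewrite -scalerAr -scalerAl mulrBr mulrBl !mulrA ii -[_ * i * i]mulrA ii.
  by rewrite mulrN1 mulN1r mulNr !opprK addrC.
have [||m1 [m2 zmE]] := @commuting_with_i (zm * j) i _ Di ii.
- exact: DeM.
- by rewrite mulrA izm mulNr -!mulrA ij mulrN opprK.
have zE : z = zp + zm.
  by rewrite -scalerDr addrACA addNr addr0 scalerDr hh.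
(* From zm j = m1 + m2 i and j j = -1 one gets zm = - m1 j - m2 k. *)
exists (Quat p1 p2 (- m1) (- m2)) => //.
have zm2 : zm = - (zm * j * j) by rewrite -mulrA jj mulrN1 opprK.
rewrite FE /f /= zE zpE zm2 zmE mulrDl mulr_algl -scalerAl kE opprD !scaleNr.
by rewrite addrA.
Qed.

End Quadratic.

(** * The graded division algebra and its involution *)

Lemma algebra_assoc (R : realType) (A : algType R) :
  assoc_algebra ( *%R : A -> A -> A).
Proof.
split=> *; [exact: mulrA|exact: mulrDl|exact: mulrDr|..].
  by rewrite scalerAl.
by rewrite scalerAr.
Qed.

(* Averaging over the group {1, -1, i, -i, j, -j, k, -k} makes [x iota(p)]
   equivariant; for some p among 1, i, j, k the average is nonzero because
   the sum over p of p q (conj p) is 4 Re(q). *)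
Lemma quaternion_intertwiner (R : realType) (B : algType R)
    (rho iota : quaternion R -> B) (x : B) :
  linear rho -> linear iota -> {morph rho : p q / p * q} ->
  {morph iota : p q / p * q} -> rho 1 * x = x -> x * iota 1 = x -> x <> 0 ->
  exists (s : seq (quaternion R * quaternion R)),
    let d := \sum_(p <- s) rho p.1 * x * iota p.2 in
    d <> 0 /\ forall c, rho c * d = d * iota c.
Proof.
move=> rhoL iotaL rhoM iotaM rho1 iota1 x0.
pose q1 : quaternion R := 1.
pose qi : quaternion R := Quat 0 1 0 0.
pose qj : quaternion R := Quat 0 0 1 0.
pose qk : quaternion R := Quat 0 0 0 1.
have rhoD p q : rho (p + q) = rho p + rho q.
  by have := rhoL 1 p q; rewrite !scale1r.
have iotaD p q : iota (p + q) = iota p + iota q.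
  by have := iotaL 1 p q; rewrite !scale1r.
have rho0 : rho 0 = 0 by apply: (addrI (rho 0)); rewrite -rhoD !addr0.
have iota0 : iota 0 = 0 by apply: (addrI (iota 0)); rewrite -iotaD !addr0.
have rhoZ a p : rho (a *: p) = a *: rho p.
  by have := rhoL a p 0; rewrite rho0 !addr0.
have iotaZ a p : iota (a *: p) = a *: iota p.
  by have := iotaL a p 0; rewrite iota0 !addr0.
have rhoN p : rho (- p) = - rho p by rewrite -scaleN1r rhoZ scaleN1r.
have iotaN p : iota (- p) = - iota p by rewrite -scaleN1r iotaZ scaleN1r.
(* q and -q contribute the same term, so four of the eight group elements suffice. *)
pose s p := [seq (q, p * conjq q) | q <- [:: q1; qi; qj; qk]].
pose d p := \sum_(t <- s p) rho t.1 * x * iota t.2.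
have dE p : d p = rho q1 * x * iota p + rho qi * x * iota (p * - qi) +
    rho qj * x * iota (p * - qj) + rho qk * x * iota (p * - qk).
  rewrite /d /s big_map !big_cons big_nil addr0 !addrA /=.
  have -> : conjq q1 = 1 by congr Quat; rewrite oppr0.
  rewrite mulr1.
  have -> : conjq qi = - qi by congr Quat; rewrite ?oppr0.
  have -> : conjq qj = - qj by congr Quat; rewrite ?oppr0.
  by have -> : conjq qk = - qk by congr Quat; rewrite ?oppr0.
have qii : qi * qi = - q1 by congr Quat => /=; ring.
have qjj : qj * qj = - q1 by congr Quat => /=; ring.
have qkk : qk * qk = - q1 by congr Quat => /=; ring.
have qij : qi * qj = qk by congr Quat => /=; ring.
have qji : qj * qi = - qk by congr Quat => /=; ring.
have qjk : qj * qk = qi by congr Quat => /=; ring.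
have qkj : qk * qj = - qi by congr Quat => /=; ring.
have qki : qk * qi = qj by congr Quat => /=; ring.
have qik : qi * qk = - qj by congr Quat => /=; ring.
have mulX p q y : rho p * (rho q * x * y) = rho (p * q) * x * y.
  by rewrite rhoM !mulrA.
have Xmul p q y : y * x * iota p * iota q = y * x * iota (p * q).
  by rewrite iotaM !mulrA.
have com : [/\ forall p, rho qi * d p = d p * iota qi,
    forall p, rho qj * d p = d p * iota qj &
    forall p, rho qk * d p = d p * iota qk].
  split=> p; rewrite !dE !mulrDr !mulrDl !mulX !Xmul -?mulrA;
   rewrite ?mulNr ?mulrN ?(qii, qjj, qkk, qij, qji, qjk, qkj, qki, qik, mulr1);
   rewrite ?mulrN ?opprK ?mulr1 ?(rhoN, iotaN) ?mulrN ?mulNr ?opprK.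
  - by rewrite [RHS](ACl (2*1*4*3)).
  - by rewrite [RHS](ACl (3*4*1*2)).
  - by rewrite [RHS](ACl (4*3*2*1)).
have [comi comj comk] := com.
have rhoq1 q y : rho q1 * (rho q * x * y) = rho q * x * y.
  by rewrite mulX mul1r.
have key : d q1 + d qi * iota (- qi) + d qj * iota (- qj) + d qk * iota (- qk)
    = rho q1 * x * iota (4%:R *: q1).
  rewrite !dE !mulrDl !Xmul !addrA.
  rewrite (ACl ((1*5*9*13)*(2*6*10*14)*(3*7*11*15)*(4*8*12*16))) /=.
  rewrite -!mulrDr -!iotaD.
  have -> : q1 + qi * - qi + qj * - qj + qk * - qk = 4%:R *: q1.
    by congr Quat => /=; ring.
  have -> : q1 * - qi + qi * - qi * - qi + qj * - qi * - qj + qk * - qi * - qk = 0.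
    by congr Quat => /=; ring.
  have -> : q1 * - qj + qi * - qj * - qi + qj * - qj * - qj + qk * - qj * - qk = 0.
    by congr Quat => /=; ring.
  have -> : q1 * - qk + qi * - qk * - qi + qj * - qk * - qj + qk * - qk * - qk = 0.
    by congr Quat => /=; ring.
  by rewrite iota0 !mulr0 !addr0.
have [p dp0] : exists p, d p <> 0.
  apply: contrapT => d0; apply: x0.
  have {}d0 p : d p = 0 by apply: contrapT => ?; apply: d0; exists p.
  move: key; rewrite !d0 !mul0r !addr0 iotaZ rho1 -scalerAr iota1 => /esym/eqP.
  by rewrite scaler_eq0 pnatr_eq0 /= => /eqP.
exists (s p); split=> // c; rewrite -/(d p).
have {}rhoq1 : rho q1 * d p = d p by rewrite dE !mulrDr !rhoq1.
have {}iotaq1 : d p * iota q1 = d p by rewrite dE !mulrDl !Xmul !mulr1.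
have -> : c = q_re c *: q1 + q_i c *: qi + q_j c *: qj + q_k c *: qk.
  by case: c => c1 c2 c3 c4; congr Quat => /=; ring.
rewrite !(rhoD, iotaD, rhoZ, iotaZ) !mulrDl !mulrDr -!scalerAl -!scalerAr.
by rewrite rhoq1 iotaq1 comi comj comk.
Qed.

(** * The corner at a division idempotent and its link with the image under phi *)

Section GradedUnital.
Variables (R : realType) (G : groupType).
Variables (A : algType R) (gr : G -> set A) (phi : A -> A).
Hypotheses (gr_grading : grading *%R gr) (A_simple : graded_simple *%R gr).
Hypothesis phi_inv : graded_involution *%R gr phi.

Lemma phiD x y : phi (x + y) = phi x + phi y.
Proof. by case: phi_inv => /(_ 1 x y); rewrite !scale1r. Qed.
Lemma phi0 : phi 0 = 0.
Proof. by apply: (addrI (phi 0)); rewrite -phiD !addr0. Qed.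
Lemma phiZ a x : phi (a *: x) = a *: phi x.
Proof. by case: phi_inv => /(_ a x 0); rewrite phi0 !addr0. Qed.
Lemma phiN x : phi (- x) = - phi x.
Proof. by rewrite -scaleN1r phiZ scaleN1r. Qed.
Lemma phiM x y : phi (x * y) = phi y * phi x.
Proof. by case: phi_inv. Qed.
Lemma phiK : involutive phi.
Proof. by case: phi_inv. Qed.
Lemma phi1 : phi 1 = 1.
Proof. by rewrite -[LHS]mulr1 -{2}[1]phiK -phiM mulr1 phiK. Qed.
Lemma phi_gr g x : gr g x -> gr g (phi x).
Proof. by move=> gx; case: phi_inv => _ _ _ /(_ g) <-; exists x. Qed.
Lemma phi_eq0 x : phi x = 0 -> x = 0.
Proof. by move=> px; rewrite -[x]phiK px phi0. Qed.

Local Notation aA := (@algebra_assoc R A).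

(** The identity component of 1 is a right identity on homogeneous elements, hence everywhere, so it
    equals 1. *)
Lemma gr1 : gr 1%g 1.
Proof.
suff <- : hcomp gr_grading 1%g 1 = 1 by apply: comp_gr.
suff c1 x : x * hcomp gr_grading 1%g 1 = x by rewrite -[LHS]mul1r c1.
move: x; apply: (homogeneous_ind gr_grading) => [|x y xc yc|g x gx].
- by rewrite mul0r.
- by rewrite mulrDl xc yc.
- by rewrite -(comp_mull aA gr_grading _ _ gx) mulg1 mulr1 comp_id.
Qed.

Variables (e : idempotent_elt A).
Hypothesis e_div : division_idempotent *%R gr (idem e).
Local Notation eps := (idem e).
Local Notation D := (corner e).

Let ge : gr 1%g eps. Proof. by case: e_div. Qed.
Let e0 : eps <> 0. Proof. by case: e_div. Qed.
Let ee : eps * eps = eps. Proof. exact: idemK. Qed.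

Definition corner_gr (g : G) : set D := [set d | gr g (cval d)].

Lemma corner_grE g d : corner_gr g d = gr g (cval d). Proof. by []. Qed.

Lemma comp_corner g x : eps * x * eps = x ->
  eps * hcomp gr_grading g x * eps = hcomp gr_grading g x.
Proof.
move=> xe; rewrite -(comp_mull aA gr_grading _ _ ge) mul1g.
by rewrite -(comp_mulr aA gr_grading _ _ ge) mulg1 xe.
Qed.

Lemma corner_grading : grading *%R corner_gr.
Proof.
split=> [g|x|s f us fg sum0 g sg|g h x y gx hy].
- split=> [|x y|a x]; rewrite !corner_grE ?cval0 ?cvalD ?cvalZ.
  + exact: (gr0 gr_grading).
  + exact: (grD gr_grading).
  + exact: (grZ gr_grading).
- have [s us xE] := comp_sum gr_grading (cval x).
  exists s, (fun g => corner_proj e (hcomp gr_grading g (cval x))).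
  have cE g : cval (corner_proj e (hcomp gr_grading g (cval x))) =
      hcomp gr_grading g (cval x).
    by rewrite /= comp_corner // cornerP.
  split=> // [g|]; first by rewrite corner_grE cE; apply: comp_gr.
  by apply: cval_inj; rewrite cval_sum {1}xE; apply: eq_bigr => g _; rewrite cE.
- case: gr_grading => _ _ /(_ s (fun g => cval (f g)) us) + _.
  move=> /(_ fg); rewrite -cval_sum sum0 cval0 => /(_ erefl g sg) fg0.
  by apply: cval_inj; rewrite fg0 cval0.
- by rewrite corner_grE cval_mul; apply: (grM gr_grading).
Qed.

Lemma corner_division g d : corner_gr g d -> d <> 0 ->
  exists d', [/\ corner_gr g^-1%g d', d * d' = 1 & d' * d = 1].
Proof.
move=> gd d0; have [_ _ _ divP] := e_div.
have [|||d' [gd' ed' d'e dd' d'd]] := divP g (cval d) gd.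
- by move=> cd0; apply: d0; apply: cval_inj; rewrite cd0 cval0.
- exact: cval_mull.
- exact: cval_mulr.
have cE : cval (corner_proj e d') = d' by rewrite cval_projE.
exists (corner_proj e d'); rewrite corner_grE cE; split=> //.
  by apply: cval_inj; rewrite cval_mul cE dd' cval_one.
by apply: cval_inj; rewrite cval_mul cE d'd cval_one.
Qed.

Lemma corner_fin : finite_dim (gr 1%g) -> finite_dim (corner_gr 1%g).
Proof.
case=> n [b [gb bP]]; exists n, (fun i => corner_proj e (b i)).
split=> [i|x gx].
  rewrite corner_grE; have := grM gr_grading (grM gr_grading ge (gb i)) ge.
  by rewrite !mulg1.
have [c cE] := bP _ gx; exists c; apply: cval_inj; rewrite cval_sum.
rewrite -[LHS]cornerP cE mulr_sumr mulr_suml; apply: eq_bigr => i _.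
by rewrite cvalZ /= -scalerAr -scalerAl.
Qed.

Lemma corner_frobenius : finite_dim (gr 1%g) ->
  exists k (f : {lrmorphism kind_alg R k -> D}), range f = corner_gr 1%g.
Proof.
move=> /corner_fin De_fin; apply: frobenius => //.
- by rewrite corner_grE cval_one.
- by move=> x y; apply: (grD corner_grading).
- by move=> a x; apply: (grZ corner_grading).
- by move=> x y gx gy; have := grM corner_grading gx gy; rewrite mulg1.
- move=> x y gx gy xy; have [|x0] := pselect (x = 0); first by left.
  have [d [_ _ dx]] := corner_division gx x0.
  by right; rewrite -[y]mul1r -dx -mulrA xy mulr0.
Qed.

(* Such a u is invertible as a map between the right ideals of [eps] and
   [phi eps], so that d |-> u^-1 phi(d) u maps [eps A eps] to itself. *)
Definition linking (g : G) (u : A) : Prop :=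
  [/\ gr g u, u <> 0, phi eps * u = u & u * eps = u].

Lemma linking_exists : exists g u, linking g u.
Proof.
have pe0 : phi eps <> 0 by move=> /phi_eq0.
have [g [r [gr_r per]]] := graded_prime aA gr_grading A_simple pe0 ge e0.
exists g, (phi eps * r * eps); split=> //.
- have := grM gr_grading (grM gr_grading (phi_gr ge) gr_r) ge.
  by rewrite mul1g mulg1.
- by rewrite !mulrA -phiM ee.
- by rewrite -!mulrA ee.
Qed.

(** Primeness and division in eps A eps give a left inverse u'. Then u u' is an idempotent of
    phi(eps) A phi(eps), and phi carries it to a nonzero homogeneous idempotent of eps A eps, which
    must be eps. *)
Lemma linking_inverse g u : linking g u -> exists u',
  [/\ gr g^-1%g u', eps * u' = u', u' * phi eps = u', u' * u = eps &
      u * u' = phi eps].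
Proof.
case=> gu u0 pu ue.
have [h [r [hr eru]]] := graded_prime aA gr_grading A_simple e0 gu u0.
have gd : gr (h * g)%g (eps * r * u).
  by have := grM gr_grading (grM gr_grading ge hr) gu; rewrite mul1g.
case: e_div => _ _ _ /(_ _ _ gd eru)[||d [gd' ed de _ du]].
- by rewrite !mulrA ee.
- by rewrite -[_ * u * eps]mulrA ue.
pose u' := d * r * phi eps; have eu' : eps * u' = u' by rewrite !mulrA ed.
have u'e : u' * phi eps = u' by rewrite -mulrA -phiM ee.
have u'u : u' * u = eps by rewrite /u' -mulrA pu -du !mulrA de.
have gu' : gr g^-1%g u'.
  have := grM gr_grading (grM gr_grading gd' hr) (phi_gr ge).
  by rewrite mulg1 invgM -mulgA mulVg mulg1.
exists u'; split=> //.
pose f := u * u'; have ff : f * f = f by rewrite /f mulrA -[_ * u' * u]mulrA u'u ue.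
have f0 : phi f <> 0.
  by move=> /phi_eq0 f0; apply: u0; rewrite -ue -u'u mulrA -/f f0 mul0r.
have gf : gr 1%g (phi f) by apply: phi_gr; rewrite -(mulgV g); apply: (grM gr_grading).
case: e_div => _ _ _ /(_ _ _ gf f0)[||d2 [_ _ _ fd _]].
- by rewrite -[X in X * _]phiK -phiM /f -mulrA u'e.
- by rewrite -[X in _ * X]phiK -phiM /f mulrA pu.
have : phi f * phi f * d2 = eps by rewrite -phiM ff fd.
rewrite -mulrA fd => fe; rewrite -/f -[f]phiK; congr phi.
by rewrite -[RHS]fe -[X in _ = _ * X]phiK -phiM /f mulrA pu.
Qed.

Section Kind.
Variables (k : divkind) (iota : {lrmorphism kind_alg R k -> D}).
Hypothesis iota_range : range iota = corner_gr 1%g.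

Local Notation J c := (cval (iota c)).

Lemma iotaD c d : J (c + d) = J c + J d.
Proof. by rewrite rmorphD cvalD. Qed.
Lemma iotaZ a c : J (a *: c) = a *: J c.
Proof. by rewrite linearZ cvalZ. Qed.
Lemma iotaM c d : J (c * d) = J c * J d.
Proof. by rewrite rmorphM cval_mul. Qed.
Lemma iota1 : J 1 = eps.
Proof. by rewrite rmorph1 cval_one. Qed.
Lemma iotaN c : J (- c) = - J c.
Proof. by rewrite -scaleN1r iotaZ scaleN1r. Qed.
Lemma iota_mull c : eps * J c = J c.
Proof. exact: cval_mull. Qed.
Lemma iota_mulr c : J c * eps = J c.
Proof. exact: cval_mulr. Qed.
Lemma iota_gr c : gr 1%g (J c).
Proof. by have : corner_gr 1%g (iota c) by rewrite -iota_range; exists c. Qed.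

(* [d |-> u^-1 phi(d) u] restricts to the conjugation on [D_e]. *)
Definition conjugating (u : A) : Prop :=
  forall c, phi (cval (iota c)) * u = u * cval (iota (kind_conj c)).

Lemma conjugatingD u v : conjugating u -> conjugating v -> conjugating (u + v).
Proof. by move=> cu cv c; rewrite mulrDl mulrDr cu cv. Qed.

Lemma kind_conjK (c : kind_alg R k) : kind_conj (kind_conj c) = c.
Proof.
case: k c => [c|[a b]|[a1 b1 c1 d1]] //=; first by rewrite /conjc opprK.
by rewrite /conjq /= !opprK.
Qed.

Lemma kind_conjM (c d : kind_alg R k) :
  kind_conj (c * d) = kind_conj d * kind_conj c.
Proof.
case: k c d => [c d|[a b] [c d]|[a1 b1 c1 d1] [a2 b2 c2 d2]] /=.
- exact: mulrC.
- by congr (_ +i* _)%C; ring.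
- by congr Quat => /=; ring.
Qed.

Lemma conjugating_phi u : conjugating u -> conjugating (phi u).
Proof.
move=> cu c; apply: (can_inj phiK); rewrite !phiM !phiK.
by rewrite cu kind_conjK.
Qed.

End Kind.

Hypothesis A_central : [set r | [/\ center *%R r, gr 1%g r & phi r = r]] =
  [set a *: (1 : A) | a in setT].
Hypothesis unit_sum : exists2 s : seq (A * A),
  1 = \sum_(p <- s) p.1 * p.2 &
  forall p, p \in s -> exists g,
    [/\ gr g p.1, gr g^-1%g p.2, p.1 * eps = p.1 & eps * p.2 = p.2].

(* If [D_e = C] is central in D then, with [1 = \sum_l a_l b_l],
   the element [\sum_l a_l i b_l] is central in A; if moreover
   [u^-1 phi(_) u] fixed i, it would be symmetric, hence real. *)
Lemma central_contradiction u I : (exists g, linking g u) ->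
  gr 1%g I -> eps * I = I -> I * eps = I -> I * I = - eps ->
  (forall d : D, cval d * I = I * cval d) -> phi I * u <> u * I.
Proof.
move=> [g lu] gI eI Ie II Icom phiI.
have [u' [_ _ _ u'u uu']] := linking_inverse lu; have [gu u0 pu ue] := lu.
have [s sE sP] := unit_sum.
have Dcom x y : eps * x = x -> y * eps = y -> x * y * I = I * (x * y).
  move=> ex ye; have cE : cval (corner_proj e (x * y)) = x * y.
    by rewrite cval_projE ?mulrA ?ex // -mulrA ye.
  by have := Icom (corner_proj e (x * y)); rewrite cE.
pose z := \sum_(p <- s) p.1 * I * p.2.
(* With 1 expanded on both sides, the factors p.2 r q.1 lie in the corner and commute with I. *)
have zr r : z * r = r * z.
  rewrite -[LHS]mulr1 [X in _ * X = _]sE -[RHS]mul1r [X in _ = X * _]sE.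
  rewrite mulr_sumr mulr_suml.
  transitivity (\sum_(q <- s) \sum_(p <- s) p.1 * I * p.2 * r * (q.1 * q.2)).
    by apply: eq_bigr => q _; rewrite /z !mulr_suml.
  rewrite exchange_big /=; apply: eq_big_seq => p ps; rewrite /z !mulr_sumr.
  apply: eq_big_seq => q qs.
  have [_ [_ _ _ ep]] := sP p ps; have [_ [_ _ qe _]] := sP q qs.
  rewrite !mulrA; congr (_ * _); rewrite -!mulrA; congr (_ * _); rewrite !mulrA.
  by have := Dcom p.2 (r * q.1) ep; rewrite -mulrA qe !mulrA => ->.
have gz : gr 1%g z.
  apply: (gr_sum gr_grading) => p ps; have [g' [gp1 gp2 _ _]] := sP p ps.
  rewrite -(mulgV g'); have := grM gr_grading (grM gr_grading gp1 gI) gp2.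
  by rewrite mulg1.
have ze : z * eps = I.
  rewrite -[RHS]mul1r sE /z !mulr_suml; apply: eq_big_seq => p ps.
  have [_ [_ _ _ ep]] := sP p ps.
  rewrite -!mulrA; congr (_ * _); rewrite !mulrA.
  have := Dcom p.2 eps ep; rewrite ee => /(_ erefl).
  by rewrite -!mulrA eI mulrA => ->.
(* z and phi(z) are central and, under [phiI], both give I when multiplied by eps; primeness
   identifies them. *)
have pz : phi z = z.
  apply/eqP; rewrite -subr_eq0; apply/eqP; apply: contrapT => pz0.
  have [h [r [_]]] := graded_prime aA gr_grading A_simple pz0 ge e0; apply.
  have pzr : (phi z - z) * r = r * (phi z - z).
    rewrite mulrBl mulrBr zr; congr (_ - _).
    by rewrite -[r in LHS]phiK -[r in RHS]phiK -!phiM zr.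
  rewrite pzr -mulrA mulrBl ze.
  have pzu x : phi z * x = x * phi z.
    by rewrite -[x in LHS]phiK -[x in RHS]phiK -!phiM zr.
  have -> : phi z * eps = I; last by rewrite subrr mulr0.
  rewrite -u'u mulrA pzu -[LHS]mulrA -{1}pu [phi z * _]mulrA -phiM.
  by rewrite -zr ze phiI mulrA u'u eI.
have : [set r | [/\ center *%R r, gr 1%g r & phi r = r]] z by split.
rewrite A_central => -[a _ za].
(* A real multiple of eps cannot have the square - eps. *)
have IE : I = a *: eps by rewrite -ze -za -scalerAl mul1r.
move: II; rewrite IE -scalerAl -scalerAr ee scalerA -[- eps]scaleN1r.
move/eqP; rewrite -subr_eq0 -scalerBl scaler_eq0 (negPf (idem_neq0 e)) orbF.
by rewrite opprK paddr_eq0 ?ler01 ?oner_eq0 ?andbF // -expr2 sqr_ge0.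
Qed.

Lemma complex_sqrtN1 (z : Rcomplex R) :
  z * z = -1 -> z = 'i%C \/ z = - 'i%C.
Proof.
move=> zz; have : (z - 'i%C) * (z + 'i%C) = 0 :> R[i].
  by rewrite mulrDr !mulrBl zz [z * _]mulrC -expr2 sqr_i addrA subrK subrr.
move/eqP; rewrite mulf_eq0 subr_eq0 addr_eq0.
by case/orP=> /eqP ->; [left|right].
Qed.

(** Over C the map d |-> u^-1 phi(d) u sends i to a square root of -1 in D_e, so only a sign can be
    wrong. *)
Lemma conjugating_linking k (iota : {lrmorphism kind_alg R k -> D}) :
  range iota = corner_gr 1%g -> exists g u, linking g u /\ conjugating iota u.
Proof.
case: k iota => iota rng.
- have [g [u lu]] := linking_exists; exists g, u; split=> // c.
  have cE : cval (iota c) = c *: eps.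
    by rewrite -{1}[c]mulr1 -[c * 1]/(c *: (1 : R^o)) iotaZ iota1.
  by have [_ _ pu ue] := lu; rewrite cE phiZ -scalerAl -scalerAr pu ue.
- have [g [u lu]] := linking_exists; have [gu u0 pu ue] := lu.
  pose I := cval (iota 'i%C).
  have [eI Ie gI] : [/\ eps * I = I, I * eps = I & gr 1%g I].
    by rewrite iota_mull iota_mulr; split=> //; apply: (iota_gr rng).
  have II : I * I = - eps.
    rewrite -iotaM -(iota1 iota) -iotaN; congr (cval (iota _)).
    exact: (sqr_i R).
  have cj v : phi I * v = - (v * I) -> phi eps * v = v -> v * eps = v ->
      conjugating iota v.
    move=> phiI pv ve [a b].
    have JE c d : cval (iota (c +i* d)%C) = c *: eps + d *: I.
      rewrite -(iota1 iota) -!iotaZ -iotaD; congr (cval (iota _)).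
      by congr (_ +i* _)%C; rewrite ?(mulr0, mulr1, addr0, add0r).
    rewrite !JE phiD !phiZ mulrDl mulrDr -!scalerAl -!scalerAr pv ve phiI.
    by rewrite scaleNr scalerN.
  have [u' [gu' eu' u'p u'u uu']] := linking_inverse lu.
  have : corner_gr 1%g (corner_proj e (u' * phi I * u)).
    rewrite corner_grE cval_projE ?mulrA ?eu' // -?mulrA ?ue //.
    have := grM gr_grading (grM gr_grading gu' (phi_gr gI)) gu.
    by rewrite mulg1 mulVg mulrA.
  rewrite -rng => -[z _ zE].
  have phiI : phi I * u = u * cval (iota z).
    rewrite zE cval_projE ?mulrA ?eu' // -?mulrA ?ue // !mulrA uu'.
    by rewrite -[phi eps * phi I]phiM Ie.
  have [|zi|zi] := @complex_sqrtN1 z.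
    apply: (@kind_inj R KindC D iota); apply: cval_inj.
    rewrite -[z * z]/((z : kind_alg R KindC) * z) iotaM.
    rewrite -[RHS]/(cval (iota (- 1))) iotaN iota1.
    rewrite -[X in X * _]iota_mull -u'u -[u' * u * _]mulrA -phiI -!mulrA -phiI.
    by rewrite (mulrA (phi I)) -phiM II phiN mulNr mulrN pu u'u.
  + have {zi}phiI : phi I * u = u * I by rewrite phiI zi.
    have [Icom|] := pselect (forall d : D, cval d * I = I * cval d).
      by have := central_contradiction (ex_intro _ g lu) gI eI Ie II Icom.
    move/existsNP => [d0 d0I].
    have [h [d [gd dI]]] : exists h (d : D), corner_gr h d /\
        cval d * I <> I * cval d.
      apply: contrapT => nd; apply: d0I.
      have [s _ ->] := comp_sum corner_grading d0.
      rewrite cval_sum mulr_suml mulr_sumr; apply: eq_bigr => h _.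
      apply: contrapT => dI; apply: nd.
      by exists h, (hcomp corner_grading h d0); split=> //; apply: comp_gr.
    have dn0 : d <> 0 by move=> d00; apply: dI; rewrite d00 cval0 mul0r mulr0.
    have [d' [gd' dd' d'd]] := corner_division gd dn0.
    (* Conjugation by the homogeneous d preserves D_e, so d i d^-1 is i or - i, and the choice of d
       excludes i. *)
    have : corner_gr 1%g (d * iota 'i%C * d').
      have gi : corner_gr 1%g (iota 'i%C) by rewrite -rng; exists 'i%C.
      have := grM corner_grading (grM corner_grading gd gi) gd'.
      by rewrite mulg1 mulgV.
    rewrite -rng => -[y _ yE].
    have dIy : d * iota 'i%C = iota y * d by rewrite yE -[_ * d' * d]mulrA d'd mulr1.
    have [|yi|yi] := @complex_sqrtN1 y.
      apply: (@kind_inj R KindC D iota).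
      rewrite -[y * y]/((y : kind_alg R KindC) * y) rmorphM /= yE.
      rewrite !mulrA -[_ * d' * d]mulrA d'd mulr1 -[_ * iota _ * iota _]mulrA.
      have -> : iota 'i%C * iota 'i%C = -1.
        rewrite -rmorphM -(rmorphN1 iota); congr (iota _).
        exact: (sqr_i R).
      by rewrite -[RHS]/(iota (- 1)) rmorphN1 mulrN1 mulNr dd'.
    * by case: dI; have := congr1 (@cval _ _ e) dIy; rewrite yi !cval_mul.
    * have {yE}dId : cval d * I = - (I * cval d).
        have := congr1 (@cval _ _ e) dIy; rewrite yi !cval_mul => ->.
        by rewrite -[cval (iota (- _))]/(cval (iota (- ('i%C : kind_alg R KindC))))
          iotaN mulNr.
      have ud0 : u * cval d <> 0.
        move=> ud; apply: dn0; apply: cval_inj.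
        by rewrite cval0 -[LHS]cval_mull -u'u -mulrA ud mulr0.
      exists (g * h)%g, (u * cval d); split.
        split=> //; first exact: (grM gr_grading).
          by rewrite mulrA pu.
        by rewrite -mulrA cval_mulr.
      apply: cj; rewrite ?mulrA ?phiI ?pu //; last by rewrite -mulrA cval_mulr.
      by rewrite -!mulrA dId mulrN opprK.
  + exists g, u; split=> //; apply: cj => //.
    rewrite phiI zi.
    rewrite -[cval (iota (- _))]/(cval (iota (- ('i%C : kind_alg R KindC)))).
    by rewrite iotaN mulrN.
- have [g [u lu]] := linking_exists; have [gu u0 pu ue] := lu.
  (* phi composed with the quaternion conjugation is multiplicative, so that averaging applies. *)
  have [|||||||s [d0 dJ]] := @quaternion_intertwiner R A
    (fun q => phi (cval (iota (conjq q)))) (fun q => cval (iota q)) u.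
  + move=> a p q; have -> : conjq (a *: p + q) = a *: conjq p + conjq q.
      by case: p q => ? ? ? ? [? ? ? ?]; congr Quat => /=; ring.
    by rewrite iotaD iotaZ phiD phiZ.
  + by move=> a p q; rewrite iotaD iotaZ.
  + move=> p q; rewrite -phiM -iotaM; congr (phi (cval (iota _))).
    exact: (kind_conjM (k := KindH) p q).
  + by move=> p q; rewrite iotaM.
  + have -> : conjq 1 = 1 :> quaternion R by congr Quat; rewrite oppr0.
    by rewrite (iota1 iota).
  + by rewrite (iota1 iota).
  + exact: u0.
  exists g, (\sum_(p <- s) phi (cval (iota (conjq p.1))) * u * cval (iota p.2)).
  split; last first.
    move=> c; have := dJ (conjq c).
    by rewrite [conjq (conjq c)](kind_conjK (k := KindH) c).
  split=> //.
  + apply: (gr_sum gr_grading) => p _; rewrite -[g]mul1g -[(1 * g)%g]mulg1.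
    apply: (grM gr_grading); last exact: (iota_gr rng).
    by apply: (grM gr_grading) => //; apply: phi_gr; apply: (iota_gr rng).
  + rewrite mulr_sumr; apply: eq_bigr => p _.
    by rewrite !mulrA -phiM iota_mulr.
  + rewrite mulr_suml; apply: eq_bigr => p _.
    by rewrite -!mulrA iota_mulr.
Qed.

(* The condition [conjugating u] is linear in u and stable under phi, so u may be
   replaced by u + phi(u); for [D_e = C] the sign is absorbed by passing to u i. *)
Lemma hermitian_linking k (iota : {lrmorphism kind_alg R k -> D}) :
  range iota = corner_gr 1%g -> exists g u delta,
  [/\ linking g u, conjugating iota u, phi u = delta *: u,
      delta = 1 \/ delta = -1 & kindC k -> delta = 1].
Proof.
move=> rng; have [g [u [lu cu]]] := conjugating_linking rng.
have [v [lv cv [d [dE pv]]]] : exists v, [/\ linking g v, conjugating iota v &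
    exists d, (d = 1 \/ d = -1) /\ phi v = d *: v].
  (* If the symmetrisation of u vanishes, u itself is skew and serves with the sign -1. *)
  have [gu u0 pu ue] := lu; have [v0|v0] := pselect (u + phi u = 0).
    exists u; split=> //; exists (-1); split; first by right.
    by apply/eqP; rewrite scaleN1r -addr_eq0 addrC v0.
  exists (u + phi u); split.
  - split=> //; first by apply: (grD gr_grading) => //; apply: phi_gr.
      by rewrite mulrDr pu -phiM ue.
    by rewrite mulrDl ue -[eps]phiK -phiM pu.
  - by apply/(conjugatingD cu)/conjugating_phi.
  - by exists 1; split; [left|rewrite phiD phiK addrC scale1r].
have [kC|] := boolP (kindC k); last by exists g, v, d; split.
case: dE pv => -> pv; first by exists g, v, 1; split=> //; left.
case: k kC iota rng cu cv => // _ iota rng _ cv.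
pose I := cval (iota 'i%C); have [gv v0 pev ve] := lv.
have phiI : phi I * v = - (v * I).
  rewrite cv -mulrN -iotaN; congr (_ * cval (iota _)).
  by congr (_ +i* _)%C; rewrite ?oppr0.
have II : I * I = - eps.
  by rewrite -iotaM -(iota1 iota) -iotaN; congr (cval (iota _)); apply: (sqr_i R).
exists g, (v * I), 1; split=> //; last by left.
- split.
  + by rewrite -[g]mulg1; apply: (grM gr_grading) => //; apply: (iota_gr rng).
  + move=> vI; apply: v0; rewrite -ve -[eps]opprK -II mulrN mulrA vI mul0r.
    by rewrite oppr0.
  + by rewrite mulrA pev.
  + by rewrite -mulrA iota_mulr.
- move=> c; rewrite mulrA cv -!mulrA; congr (_ * _).
  rewrite -!iotaM; congr (cval (iota _)).
  exact: (mulrC (kind_conj c : R[i]) 'i%C).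
- by rewrite phiM pv scaleN1r mulrN phiI opprK scale1r.
Qed.

End GradedUnital.

(** * Graded hermitian spaces *)

(* A graded right D-module V inside A on which A acts faithfully, with a
   nondegenerate sesquilinear form B of degree [hs_deg] for which phi is the
   adjunction; [hs_rank1 v w] acts as z |-> v B(w, z). *)
Record hermitian_space (R : realType) (G : groupType) (A : lmodType R)
    (mul : A -> A -> A) (gr : G -> set A) (phi : A -> A) (d : divdata R G) :=
  HermitianSpace {
  hs_V : set A;
  hs_act : A -> dv_alg d -> A;
  hs_B : A -> A -> dv_alg d;
  hs_rank1 : A -> A -> A;
  hs_deg : G;
  hs_graded : graded_subspace gr hs_V;
  hs_actDl : forall v w a, hs_act (v + w) a = hs_act v a + hs_act w a;
  hs_actDr : forall v a b, hs_act v (a + b) = hs_act v a + hs_act v b;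
  hs_actZ : forall (k : R) v a, hs_act (k *: v) a = k *: hs_act v a;
  hs_actZr : forall (k : R) v a, hs_act v (k *: a) = k *: hs_act v a;
  hs_act1 : forall v, hs_V v -> hs_act v 1 = v;
  hs_actM : forall v a b, hs_act v (a * b) = hs_act (hs_act v a) b;
  hs_actV : forall v a, hs_V v -> hs_V (hs_act v a);
  hs_mulV : forall r v, hs_V v -> hs_V (mul r v);
  hs_mul_act : forall r v a, mul r (hs_act v a) = hs_act (mul r v) a;
  hs_act_gr : forall g h v a, gr g v -> dv_gr h a -> gr (g * h)%g (hs_act v a);
  hs_BDl : forall v v' w, hs_B (v + v') w = hs_B v w + hs_B v' w;
  hs_BDr : forall v w w', hs_B v (w + w') = hs_B v w + hs_B v w';
  hs_BZl : forall (k : R) v w, hs_B (k *: v) w = k *: hs_B v w;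
  hs_BZr : forall (k : R) v w, hs_B v (k *: w) = k *: hs_B v w;
  hs_B_actr : forall v w a, hs_B v (hs_act w a) = hs_B v w * a;
  hs_B_actl : forall v w a, hs_B (hs_act v a) w = dv_inv a * hs_B v w;
  hs_B_sym : forall v w, dv_inv (hs_B v w) = dv_delta d *: hs_B w v;
  hs_B_adj : forall r v w, hs_B v (mul r w) = hs_B (mul (phi r) v) w;
  hs_B_gr : forall g h v w, gr g v -> gr h w ->
    dv_gr (hs_deg * g * h)%g (hs_B v w);
  hs_B_nondeg : forall w, hs_V w -> (forall v, hs_V v -> hs_B v w = 0) -> w = 0;
  hs_rank1E : forall v w z, hs_V z ->
    mul (hs_rank1 v w) z = hs_act v (hs_B w z);
  hs_rank1_gr : forall g h v w, gr g v -> gr h w ->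
    gr (g * h * hs_deg)%g (hs_rank1 v w);
  hs_faithful : forall r, (forall v, hs_V v -> mul r v = 0) -> r = 0
}.

Section HermitianSpaceExists.
Variables (R : realType) (G : groupType).
Hypothesis GC : forall g h : G, (g * h = h * g)%g.
Variables (A : algType R) (gr : G -> set A) (phi : A -> A).
Hypotheses (gr_grading : grading *%R gr) (A_simple : graded_simple *%R gr).
Hypothesis phi_inv : graded_involution *%R gr phi.
Hypothesis A_fin : finite_dim (gr 1%g).
Hypothesis A_central : [set r | [/\ center *%R r, gr 1%g r & phi r = r]] =
  [set a *: (1 : A) | a in setT].
Variable e : idempotent_elt A.
Hypothesis e_div : division_idempotent *%R gr (idem e).
Local Notation eps := (idem e).
Hypothesis unit_sum : exists2 s : seq (A * A),
  1 = \sum_(p <- s) p.1 * p.2 &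
  forall p, p \in s -> exists g,
    [/\ gr g p.1, gr g^-1%g p.2, p.1 * eps = p.1 & eps * p.2 = p.2].

Lemma unital_hermitian_space :
  exists d : divdata R G, inhabited (hermitian_space *%R gr phi d).
Proof.
have ee : eps * eps = eps by apply: idemK.
have ge : gr 1%g eps by case: e_div.
have e0 : eps <> 0 by apply/eqP/idem_neq0.
have [k [iota rng]] := corner_frobenius gr_grading e_div A_fin.
have [g [u [delta [lu cu phiu dsign dC]]]] :=
  hermitian_linking gr_grading A_simple phi_inv e_div A_central unit_sum rng.
have [u' [gu' eu' u'p u'u uu']] :=
  linking_inverse gr_grading A_simple phi_inv e_div lu.
have [gu u0 pu ue] := lu.
have phM x y : phi (x * y) = phi y * phi x by apply: (phiM phi_inv).
have phD x y : phi (x + y) = phi x + phi y by apply: (phiD phi_inv).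
have phZ c x : phi (c *: x) = c *: phi x by apply: (phiZ phi_inv).
have phK : involutive phi by apply: (phiK phi_inv).
have phgr h x : gr h x -> gr h (phi x) by apply: (phi_gr phi_inv).
have dd : delta * delta = 1 by case: dsign => ->; rewrite ?mulrNN mulr1.
have phiu' : phi u' = delta *: u'.
  have : phi u' = eps * phi u' by rewrite -[eps]phK -phM u'p.
  rewrite -u'u -mulrA => ->.
  rewrite -[u]scale1r -dd -scalerA -phiu -scalerAl -phM u'u -scalerAr.
  by rewrite u'p.
pose psi (x : corner e) : corner e := corner_proj e (u' * phi (cval x) * u).
have psiE x : cval (psi x) = u' * phi (cval x) * u.
  by rewrite cval_projE ?mulrA ?eu' // -?mulrA ?ue.
have phe (x : corner e) : phi (cval x) * phi eps = phi (cval x).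
  by rewrite -phM (cval_mull x).
have psiM x y : psi (x * y) = psi y * psi x.
  apply: cval_inj; rewrite cval_mul !psiE cval_mul phM !mulrA.
  by rewrite -[_ * u * u']mulrA uu' -[_ * phi eps]mulrA phe.
have psiK : involutive psi.
  move=> x; apply: cval_inj; rewrite !psiE !phM phK phiu phiu'.
  rewrite -!scalerAl -!scalerAr -!scalerAl scalerA dd scale1r.
  by rewrite !mulrA u'u -[_ * u' * u]mulrA u'u cornerP.
have psi_gr h x : corner_gr gr h x -> corner_gr gr h (psi x).
  rewrite !corner_grE psiE => gx.
  have := grM gr_grading (grM gr_grading gu' (phgr _ _ gx)) gu.
  by have -> : (g^-1 * h * g = h)%g by abelian GC.
have psi_inv : graded_involution *%R (@corner_gr R G A gr e) psi.
  split=> // [c x y|h].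
    apply: cval_inj; rewrite cvalD cvalZ !psiE cvalD cvalZ phD phZ.
    by rewrite mulrDr mulrDl -scalerAr -scalerAl.
  apply/seteqP; split=> [_ [x gx <-]|x gx]; first exact: psi_gr.
  by exists (psi x); [apply: psi_gr|apply: psiK].
have iota_conj a : psi (iota a) = iota (kind_conj a).
  by apply: cval_inj; rewrite psiE -mulrA cu mulrA u'u cval_mull.
have cdiv h (x : corner e) : corner_gr gr h x -> x <> 0 ->
    exists y, x * y = 1 /\ y * x = 1.
  by move=> gx /(corner_division e_div gx)[y [_ xy yx]]; exists y.
pose d := @DivData R G (corner e) (@corner_gr R G A gr e) psi k iota delta
  (corner_grading gr_grading e_div) cdiv (@kind_inj _ _ _ iota) rng
  psi_inv iota_conj dsign (fun kC _ => dC kC).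
have dvE x : @dv_inv _ _ d x = psi x by [].
exists d; split.
pose B v w : corner e := corner_proj e (u' * phi v * w).
have BE v w : cval (B v w) = u' * phi v * w * eps by rewrite /= !mulrA eu'.
pose V := [set v : A | v * eps = v].
(* The form has the degree g^-1 of u', which becomes g_0; and v B(w, z) is the product of v u'
   phi(w) with z. *)
apply: (@HermitianSpace R G A *%R gr phi d V (fun v a => v * cval a) B
  (fun v w => v * u' * phi w) g^-1%g).
- have sV : subspace V.
    split=> [|x y|c x]; rewrite /V /= ?mul0r //.
      by rewrite mulrDl => -> ->.
    by rewrite -scalerAl => ->.
  apply/(graded_subspaceP gr_grading) => // h v Vv.
  by rewrite /V /= -(comp_mulr (@algebra_assoc R A) _ _ _ ge) mulg1 Vv.
- by move=> *; rewrite mulrDl.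
- by move=> *; rewrite cvalD mulrDr.
- by move=> *; rewrite scalerAl.
- by move=> *; rewrite cvalZ scalerAr.
- by move=> v Vv; rewrite cval_one.
- by move=> *; rewrite cval_mul mulrA.
- by move=> v a _; rewrite /V /= -mulrA (cval_mulr a).
- by move=> r v Vv; rewrite /V /= -mulrA Vv.
- by move=> *; rewrite mulrA.
- by move=> h h' v a gv ga; apply: (grM gr_grading).
- by move=> *; apply: cval_inj; rewrite cvalD !BE phD mulrDr !mulrDl.
- by move=> *; apply: cval_inj; rewrite cvalD !BE mulrDr !mulrDl.
- by move=> *; apply: cval_inj; rewrite cvalZ !BE phZ -scalerAr -!scalerAl.
- by move=> *; apply: cval_inj; rewrite cvalZ !BE -scalerAr -!scalerAl.
- move=> v w a; apply: cval_inj; rewrite cval_mul !BE -!mulrA.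
  by rewrite cval_mulr cval_mull.
- move=> v w a; apply: cval_inj; rewrite cval_mul dvE psiE !BE phM !mulrA.
  by rewrite -[_ * u * u']mulrA uu' -[_ * phi (cval a) * phi eps]mulrA phe.
- move=> v w; apply: cval_inj; rewrite cvalZ dvE psiE !BE !phM phK phiu'.
  rewrite -!scalerAr -!scalerAl; congr (_ *: _).
  by rewrite !mulrA u'p -[_ * u' * u]mulrA u'u.
- by move=> r v w; apply: cval_inj; rewrite !BE phM phK !mulrA.
- move=> h h' v w gv gw; rewrite /= corner_grE BE.
  have := grM gr_grading (grM gr_grading (grM gr_grading gu' (phgr _ _ gv)) gw) ge.
  by rewrite mulg1.
- move=> w Vw Bw; apply: contrapT => w0.
  have u'0 : u' <> 0 by move=> u'0; apply: e0; rewrite -u'u u'0 mul0r.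
  have [h wh0] := comp_neq0 gr_grading w0.
  have aA := @algebra_assoc R A.
  have gwh := comp_gr gr_grading h w.
  have [h' [r [gr_r]]] := graded_prime aA gr_grading A_simple u'0 gwh wh0.
  apply; rewrite -(comp_mull aA gr_grading _ _ (grM gr_grading gu' gr_r)).
  (* The pairing of phi(r) eps with w is u' r w, whose component is nonzero by primeness. *)
  have V1 : V (phi r * eps) by rewrite /V /= -mulrA ee.
  have := congr1 (@cval _ _ e) (Bw _ V1).
  rewrite BE phM phK !mulrA u'p cval0 -mulrA Vw => ->.
  exact: linear0.
- move=> v w z Vz; rewrite BE /V /= in Vz *.
  by rewrite -!mulrA Vz !mulrA.
- move=> h h' v w gv gw.
  have := grM gr_grading (grM gr_grading gv gu') (phgr _ _ gw).
  by have -> : (h * g^-1 * h' = h * h' * g^-1)%g by abelian GC.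
- move=> r rV; apply: contrapT => r0.
  have [h [s [_]]] :=
    graded_prime (@algebra_assoc R A) gr_grading A_simple r0 ge e0.
  by apply; rewrite -mulrA rV // /V /= -mulrA ee.
Qed.

End HermitianSpaceExists.

Lemma hermitian_space_exists (R : realType) (G : groupType)
    (GC : forall g h : G, (g * h = h * g)%g)
    (A : lmodType R) (mul : A -> A -> A) (gr : G -> set A) (phi : A -> A) :
  assoc_algebra mul -> grading mul gr -> graded_simple mul gr ->
  dcc_graded_left_ideals mul gr -> finite_dim (gr 1%g) ->
  graded_involution mul gr phi -> central_with_involution mul gr phi ->
  exists d : divdata R G, inhabited (hermitian_space mul gr phi d).
Proof.
move=> mA gG sA dccA fA invA centA.
have [e e_div] := exists_division_idempotent mA gG sA dccA.
have [E [E1 unit_sum]] := unit_decomposition mA gG sA dccA invA e_div.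
have E0 : E != 0.
  apply/eqP => E0; have [[x [y xy]] _] := sA; apply: xy.
  by rewrite -[x](E1 x).1 E0 !(nmul0 mA).
pose a := UnitalAlgebra mA E1 E0; pose A' : algType R := ua_type a.
have [ge e0 ee _] := e_div; move/eqP in e0.
pose e' : idempotent_elt A' := @IdempotentElt R A' e ee e0.
(* [ua_type a] unfolds to A; the hermitian space over it is taken apart and rebuilt over the
   original structures. *)
have [|d [[V act B T g0]]] := @unital_hermitian_space R G GC A' gr phi gG sA invA fA
  (centA E E1) e' e_div.
  exact: unit_sum.
move=> *; exists d; split.
by apply: (@HermitianSpace R G A mul gr phi d V act B T g0).
Qed.

(** * Graded division algebras with involution *)

Section DivisionData.
Variables (R : realType) (G : groupType).
Hypothesis GC : forall g h : G, (g * h = h * g)%g.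
Variable d : divdata R G.
Local Notation D := (dv_alg d).
Local Notation T := (dv_supp d).
Local Notation Dgr := (@dv_gr R G d).
Local Notation psi := (@dv_inv R G d).
Local Notation iota := (dv_iota d).
Local Notation delta := (dv_delta d).
Local Notation gD := (dv_grading d).

Lemma psiD x y : psi (x + y) = psi x + psi y.
Proof. exact: (phiD (dv_involution d)). Qed.
Lemma psi0 : psi 0 = 0.
Proof. exact: (phi0 (dv_involution d)). Qed.
Lemma psiZ a x : psi (a *: x) = a *: psi x.
Proof. exact: (phiZ (dv_involution d)). Qed.
Lemma psiN x : psi (- x) = - psi x.
Proof. exact: (phiN (dv_involution d)). Qed.
Lemma psiM x y : psi (x * y) = psi y * psi x.
Proof. exact: (phiM (dv_involution d)). Qed.
Lemma psiK : involutive psi.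
Proof. exact: (phiK (dv_involution d)). Qed.
Lemma psi1 : psi 1 = 1.
Proof. exact: (phi1 (dv_involution d)). Qed.
Lemma psi_gr g x : Dgr g x -> Dgr g (psi x).
Proof. exact: (phi_gr (dv_involution d)). Qed.
Lemma delta_sqr : delta * delta = 1.
Proof. by case: (dv_sign d) => ->; rewrite ?mulrNN mulr1. Qed.

Lemma dv_e_iota a : Dgr 1%g (iota a).
Proof. by rewrite -dv_iota_range; exists a. Qed.
Lemma dv_eP c : Dgr 1%g c -> exists a, c = iota a.
Proof. by rewrite -dv_iota_range => -[a _ <-]; exists a. Qed.

(** The given inverse is not known to be homogeneous, but its component of degree g^-1 is already a
    right inverse. *)
Lemma dv_inverse g x : Dgr g x -> x <> 0 ->
  exists y, [/\ Dgr g^-1%g y, x * y = 1 & y * x = 1].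
Proof.
move=> gx x0; have [y [xy yx]] := dv_division gx x0.
have gy := comp_gr gD g^-1%g y; suff yE : y = hcomp gD g^-1%g y.
  by rewrite -yE in gy; exists y.
have xyE : x * hcomp gD g^-1%g y = 1.
  rewrite -(comp_mull (@algebra_assoc R D) gD _ _ gx) mulgV xy.
  by apply: comp_id; apply: (gr1 gD).
by rewrite -[LHS]mulr1 -xyE mulrA yx mul1r.
Qed.

Lemma dv_domain g h x y : Dgr g x -> Dgr h y -> x * y = 0 -> x = 0 \/ y = 0.
Proof.
move=> gx gy xy; have [|x0] := pselect (x = 0); first by left.
have [z [_ _ zx]] := dv_inverse gx x0.
by right; rewrite -[y]mul1r -zx -mulrA xy mulr0.
Qed.

Lemma dv_supp1 : T 1%g.
Proof. by exists 1; [apply: (gr1 gD)|apply/eqP/oner_neq0]. Qed.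

Lemma dv_suppM g h : T g -> T h -> T (g * h)%g.
Proof.
move=> [x gx x0] [y gy y0]; exists (x * y); first exact: (grM gD).
by move/(dv_domain gx gy) => [].
Qed.

Lemma dv_suppV g : T g -> T g^-1%g.
Proof.
move=> [x gx x0]; have [y [gy xy _]] := dv_inverse gx x0; exists y => //.
by move=> y0; move/eqP: xy; rewrite y0 mulr0 eq_sym oner_eq0.
Qed.

Lemma dv_gr_neq0 g x : Dgr g x -> ~ T g -> x = 0.
Proof. by move=> gx nT; apply: contrapT => x0; apply: nT; exists x. Qed.

Lemma quot_piP g h : quot_pi T g = quot_pi T h <-> T (g^-1 * h)%g.
Proof.
split=> [/(congr1 (@sval _ _))/= gh|Tgh].
  have : lcoset_of T g h.
    by rewrite gh; exists 1%g; [apply: dv_supp1|rewrite mulg1].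
  by case=> t Tt <-; rewrite mulKg.
apply: val_inj; rewrite /= /lcoset_of; apply/seteqP; split=> _ [t Tt <-].
  exists ((g^-1 * h)^-1 * t)%g; last by abelian GC.
  by apply: dv_suppM => //; apply: dv_suppV.
exists (g^-1 * h * t)%g; last by abelian GC.
exact: dv_suppM.
Qed.

Lemma quot_pi_surj (x : quot T) : exists g, quot_pi T g = x.
Proof.
case: x => S SP; have [g _ gS] := set_mem SP.
by exists g; apply: val_inj.
Qed.

Lemma dv_component t x beta : Dgr t x -> x <> 0 -> Dgr t beta ->
  exists a, beta = x * iota a.
Proof.
move=> gx x0 gb; have [y [gy xy _]] := dv_inverse gx x0.
have [a aE] : exists a, y * beta = iota a.
  by apply: dv_eP; rewrite -(mulVg t); apply: (grM gD).
by exists a; rewrite -aE mulrA xy mul1r.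
Qed.

(** Over C, x + delta psi(x) has the required symmetry; if it vanishes, psi(x) = - delta x and x i
    has it. Over H, averaging x over the quaternion group makes it commute with D_e. *)
Lemma dv_normalized_exists t : T t -> exists x : D, [/\ Dgr t x, x <> 0,
  kindH (dv_kind d) -> forall c, Dgr 1%g c -> x * c = c * x &
  kindC (dv_kind d) -> setK d t -> psi x = delta *: x].
Proof.
case=> x gx x0; case E : (dv_kind d); first by exists x; split.
- have [Kt|] := pselect (setK d t); last by exists x; split.
  have xi c : Dgr 1%g c -> x * c = c * x.
    by move: Kt; rewrite /setK E /= => -[_]; apply.
  have [y0|y0] := pselect (x + delta *: psi x = 0); last first.
    exists (x + delta *: psi x); split=> // [|_ _].
      by apply: (grD gD) => //; apply/(grZ gD)/psi_gr.
    by rewrite psiD psiZ psiK scalerDr scalerA delta_sqr scale1r addrC.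
  have [i [gi i0 psii]] : exists i : D, [/\ Dgr 1%g i, i <> 0 & psi i = - i].
    move: (dv_e_iota) (@dv_conj R G d) (@dv_iota_inj R G d); move: iota.
    rewrite E => f fg fc fI; exists (f 'i%C); split=> //.
      by rewrite -(rmorph0 f) => /fI [] /eqP; rewrite oner_eq0.
    rewrite fc -rmorphN; congr (f _).
    by congr (_ +i* _)%C; rewrite oppr0.
  exists (x * i); split=> // [||_ _].
  - by rewrite -(mulg1 t); apply: (grM gD).
  - by case/(dv_domain gx gi).
  - have px : psi x = - delta *: x.
      apply/eqP; rewrite scaleNr -addr_eq0 -[psi x]scale1r -delta_sqr -scalerA.
      by rewrite -scalerDr addrC y0 scaler0.
    by rewrite psiM psii px mulNr -scalerAr scaleNr opprK xi.
- have [f [fE fg]] : exists f : {lrmorphism quaternion R -> D},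
     range f = Dgr 1%g /\ forall q, Dgr 1%g (f q).
    move: (dv_e_iota) (@dv_iota_range R G d); move: iota.
    by rewrite E => f; exists f.
  have [|||||||s [x'0 x'P]] := @quaternion_intertwiner R D f f x.
  + exact: linearP.
  + exact: linearP.
  + exact: rmorphM.
  + exact: rmorphM.
  + by rewrite rmorph1 mul1r.
  + by rewrite rmorph1 mulr1.
  + exact: x0.
  exists (\sum_(p <- s) f p.1 * x * f p.2); split=> //.
    apply: (gr_sum gD) => p _; rewrite -[t]mul1g -[(1 * t)%g]mulg1.
    by apply: (grM gD) => //; apply: (grM gD).
  by move=> _ c; rewrite -fE => -[q _ <-]; rewrite x'P.
Qed.

Lemma choices_inhabited : inhabited (choices d).
Proof.
have /choice[X XP] : forall t, exists x : D, T t -> [/\ Dgr t x, x <> 0,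
    kindH (dv_kind d) -> forall c, Dgr 1%g c -> x * c = c * x &
    kindC (dv_kind d) -> setK d t -> psi x = delta *: x].
  move=> t; have [/dv_normalized_exists[x xP]|nT] := pselect (T t).
    by exists x.
  by exists 0.
have /choice[xi xiP] := quot_pi_surj.
have [i iP] : exists i : D, kindH (dv_kind d) -> Dgr 1%g i /\ i * i = -1.
  case E : (dv_kind d); try by exists 0.
  move: (dv_e_iota); move: iota; rewrite E => f fg.
  exists (f (Quat 0 1 0 0)) => _; split=> //.
  rewrite -rmorphM -(rmorphN1 f); congr (f _).
  by congr Quat => /=; ring.
split; apply: (@Choices R G d X xi i) => //.
- by move=> t /XP[].
- by move=> kH t c /XP[_ _ /(_ kH) + _]; apply.
- move=> kC t Kt; have Tt : T t by move: Kt; rewrite /setK kC => -[].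
  by have [_ _ _] := XP t Tt; apply.
Qed.

End DivisionData.

(** * Commutation rules and signs of the elements X_t *)

Section ChoicesTheory.
Variables (R : realType) (G : groupType).
Hypothesis GC : forall g h : G, (g * h = h * g)%g.
Variables (d : divdata R G) (c : choices d).
Local Notation D := (dv_alg d).
Local Notation T := (dv_supp d).
Local Notation Dgr := (@dv_gr R G d).
Local Notation psi := (@dv_inv R G d).
Local Notation iota := (dv_iota d).
Local Notation delta := (dv_delta d).
Local Notation kind := (dv_kind d).
Local Notation gD := (dv_grading d).
Local Notation X := (ch_X c).
Local Notation eta := (@Defs.eta R G d c).

Lemma X_gr t : T t -> Dgr t (X t).
Proof. by case/(ch_X_gr c). Qed.
Lemma X_neq0 t : T t -> X t <> 0.
Proof. by case/(ch_X_gr c). Qed.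
Lemma X_inverse t : T t -> exists y, [/\ Dgr t^-1%g y, X t * y = 1 & y * X t = 1].
Proof. by move=> Tt; apply: (dv_inverse (X_gr Tt)); apply: X_neq0. Qed.

Lemma grMe x y : Dgr 1%g x -> Dgr 1%g y -> Dgr 1%g (x * y).
Proof. by move=> gx gy; rewrite -(mulg1 1%g); apply: (grM gD). Qed.

Lemma gr_e1 (r : R) : Dgr 1%g (r%:A : D).
Proof. by apply: (grZ gD); apply: (gr1 gD). Qed.

Lemma psi_real (r : R) : psi r%:A = r%:A.
Proof. by rewrite psiZ psi1. Qed.

Lemma fixed_real a : Dgr 1%g a -> psi a = a -> exists r : R, a = r%:A.
Proof.
move=> /dv_eP[z ->]; rewrite dv_conj => /(@dv_iota_inj R G d).
suff : kind_conj z = z -> exists r : R, z = r%:A.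
  by move=> H /H[r ->]; exists r; rewrite rmorph_alg.
move: (z); case: kind => [x _|[a1 b1] [] /eqP|[a1 b1 c1 d1] [] /eqP].
- by exists x; rewrite -[LHS]mulr1.
- rewrite eq_sym -addr_eq0 -mulr2n mulrn_eq0 /= => /eqP ->.
  by exists a1; congr (_ +i* _)%C; rewrite ?mulr1 ?mulr0.
- rewrite eq_sym -addr_eq0 -mulr2n mulrn_eq0 /= => /eqP -> /eqP.
  rewrite eq_sym -addr_eq0 -mulr2n mulrn_eq0 /= => /eqP -> /eqP.
  rewrite eq_sym -addr_eq0 -mulr2n mulrn_eq0 /= => /eqP ->.
  by exists a1; congr Quat => /=; rewrite ?mulr1 ?mulr0.
Qed.

Lemma e_norm a : Dgr 1%g a -> exists n : R,
  [/\ psi a * a = n%:A, a * psi a = n%:A, 0 <= n & (n == 0) = (a == 0)].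
Proof.
move=> /dv_eP[z ->]; have [n [zz zz' n0 nz]] := kind_norm z.
exists n; split=> //.
- by rewrite dv_conj -rmorphM zz; apply: (rmorph_alg iota).
- by rewrite dv_conj -rmorphM zz'; apply: (rmorph_alg iota).
- rewrite nz; apply/eqP/eqP => [->|]; first by rewrite rmorph0.
  by rewrite -[X in _ = X -> _](rmorph0 iota) => /(@dv_iota_inj R G d).
Qed.

Lemma kindR_real a : kindR kind -> Dgr 1%g a -> psi a = a.
Proof.
move=> kR /dv_eP[z ->]; rewrite dv_conj; congr (iota _).
by move: (z) kR; case: kind.
Qed.

Lemma kindC_comm a b : kindC kind -> Dgr 1%g a -> Dgr 1%g b -> a * b = b * a.
Proof.
move=> kC /dv_eP[z ->] /dv_eP[w ->]; rewrite -!rmorphM; congr (iota _).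
by move: (z) (w) kC; case: kind => // *; apply: (@mulrC R[i]).
Qed.

(** For t outside K, scaling a vector by q replaces the coefficient b in B(v, v) = X_t b by q b q; a
    square root thus reduces b to 1, and no signature remains. *)
Lemma kindC_sqrt a : kindC kind -> Dgr 1%g a -> a <> 0 ->
  exists q, [/\ Dgr 1%g q, q <> 0 & q * a * q = 1].
Proof.
move=> kC /dv_eP[z ->] z0.
suff [q qE] : exists q, q * z * q = 1.
  exists (iota q); split; rewrite -?rmorphM ?qE ?rmorph1 //.
    exact: dv_e_iota.
  move=> q0; suff : q * z * q = 0 by move/eqP; rewrite qE oner_eq0.
  by apply: (@dv_iota_inj R G d); rewrite rmorphM /= q0 mulr0 rmorph0.
have {z0} : z <> 0 by move=> z0'; apply: z0; rewrite z0' rmorph0.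
move: (z) kC; case: kind => // y _ y0.
have s0 : sqrtc y != 0 :> R[i] by rewrite sqrtc_eq0; apply/eqP.
exists (sqrtc y)^-1; suff : (sqrtc y)^-1 * y * (sqrtc y)^-1 = 1 :> R[i] by [].
by rewrite -{2}(sqr_sqrtc y) expr2 mulrA mulVf // mul1r mulfV.
Qed.

Lemma kindC_unit : kindC kind -> exists I : D, [/\ Dgr 1%g I, I * I = -1,
  psi I = - I & forall a, Dgr 1%g a -> exists r s : R, a = r%:A + s *: I].
Proof.
move=> kC; move: (@dv_e_iota R G d) (@dv_eP R G d) (@dv_conj R G d) kC.
move: iota; case: kind => // f fg fP fc _.
exists (f 'i%C); split=> //.
- by rewrite -rmorphM -(rmorphN1 f); congr (f _); apply: (sqr_i R).
- rewrite fc -rmorphN; congr (f _).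
  by congr (_ +i* _)%C; rewrite oppr0.
- move=> a /fP[[r s] ->]; exists r, s.
  rewrite -(rmorph1 f) -!linearZ -rmorphD; congr (f _).
  by congr (_ +i* _)%C; rewrite ?(mulr0, mulr1, addr0, add0r).
Qed.

Lemma kindH_central a : kindH kind -> Dgr 1%g a ->
  (forall b, Dgr 1%g b -> a * b = b * a) -> exists r : R, a = r%:A.
Proof.
move=> kH ga ab; apply: fixed_real => //.
have [z zE] := dv_eP ga; rewrite zE dv_conj; congr (iota _).
have {ab} : forall w, z * w = w * z.
  move=> w; apply: (@dv_iota_inj R G d).
  by rewrite !rmorphM /= -zE ab //; apply: dv_e_iota.
move: (z) kH; case: kind => // -[a1 b1 c1 d1] _ zw.
have /(congr1 (@q_k R))/= := zw (Quat 0 1 0 0).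
have /(congr1 (@q_k R))/= := zw (Quat 0 0 1 0).
have /(congr1 (@q_j R))/= := zw (Quat 0 1 0 0).
rewrite !(mulr0, mul0r, mulr1, mul1r, addr0, add0r, subr0, sub0r, oppr0).
move=> dd bb cc; rewrite /conjq /=; congr Quat; lra.
Qed.

Lemma eta_sign t : eta t = 1 \/ eta t = -1.
Proof. by rewrite /Defs.eta; case: ifP; [left|right]. Qed.

Lemma eta_sqr t : eta t * eta t = 1.
Proof. by case: (eta_sign t) => ->; rewrite ?mulrNN mulr1. Qed.

Lemma eta_delta t : eta t <> delta -> eta t = - delta.
Proof.
by case: (eta_sign t) => ->; case: (dv_sign d) => ->; rewrite ?opprK.
Qed.

Lemma eta_ndelta t : eta t = - delta -> eta t <> delta.
Proof.
move=> -> e; have := delta_sqr d; have : delta = 0 by lra.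
by move=> ->; rewrite mulr0 => /eqP; rewrite eq_sym oner_eq0.
Qed.

Definition X_commuting t := forall a, Dgr 1%g a -> a * X t = X t * a.
Definition X_conjugating t := forall a, Dgr 1%g a -> a * X t = X t * psi a.

Lemma X_commutes t : T t -> (kindC kind -> setK d t) -> X_commuting t.
Proof.
move=> Tt tK a ga; case E: kind.
- have [|r ->] := fixed_real ga; first by apply: kindR_real; rewrite ?E.
  by rewrite mulr_algl mulr_algr.
- have := tK _; rewrite E => /(_ isT); rewrite /setK E /= => -[_ H].
  by rewrite (H (X t)) //; apply: X_gr.
- by rewrite ch_X_H ?E.
Qed.

(** Conjugation by X_t maps I to a square root of -1 in D_e, that is to I or - I; the first would
    put t in K. *)
Lemma X_conjugates t : T t -> kindC kind -> ~ setK d t -> X_conjugating t.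
Proof.
move=> Tt kC nK; have [I [gI II psiI eI]] := kindC_unit kC.
have [y [gy Xy yX]] := X_inverse Tt.
have XI : I * X t = - (X t * I).
  pose J := X t * I * y; have gJ : Dgr 1%g J.
    have := grM gD (grM gD (X_gr Tt) gI) gy.
    by rewrite mulg1 mulgV.
  have JX : J * X t = X t * I by rewrite /J -mulrA yX mulr1.
  have JJ : J * J = -1.
    by rewrite {2}/J !mulrA JX -[_ * I * I]mulrA II mulrN1 mulNr Xy.
  have : (J - I) * (J + I) = 0.
    by rewrite mulrDr !mulrBl JJ II (kindC_comm kC gJ gI) addrA subrK subrr.
  case/(dv_domain (grB gD gJ gI) (grD gD gJ gI)).
  - move/eqP; rewrite subr_eq0 => /eqP JI; exfalso; apply: nK.
    rewrite /setK kC; split=> // x a gx ga.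
    have [b xE] := dv_component (X_gr Tt) (X_neq0 Tt) gx.
    rewrite xE -mulrA (kindC_comm kC _ ga) ?mulrA; last exact: dv_e_iota.
    congr (_ * _); have [r [s ->]] := eI a ga.
    rewrite mulrDl mulrDr mulr_algl mulr_algr -scalerAl -scalerAr.
    by rewrite -JX JI.
  - by move/eqP; rewrite addr_eq0 => /eqP JI; rewrite -JX JI mulNr opprK.
move=> a /eI[r [s ->]]; rewrite psiD psi_real psiZ psiI scalerN.
by rewrite mulrDl mulrDr mulr_algl mulr_algr mulrN -scalerAl -scalerAr XI scalerN.
Qed.

(** Write psi(X_t) = X_t b with b in D_e. It suffices that b is real, since psi is an involution.
    Over H this holds because b is central, and over C outside K because b b = 1. *)
Lemma psi_X t : T t -> psi (X t) = eta t *: X t.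
Proof.
move=> Tt; have gX := X_gr Tt; have X0 := X_neq0 Tt.
suff [r rE] : exists r : R, psi (X t) = r *: X t.
  have rr : r * r = 1.
    have := psiK (X t); rewrite {1}rE psiZ rE scalerA => /eqP.
    rewrite -subr_eq0 -[X in _ - X]scale1r -scalerBl scaler_eq0.
    by rewrite subr_eq0; case/orP => [/eqP //|/eqP].
  have : r \in [:: 1; -1].
    rewrite !inE -subr_eq0 -[r == -1]subr_eq0 opprK -mulf_eq0.
    by rewrite mulrDr mulr1 mulrBl rr mul1r addrA subrK subrr.
  rewrite /Defs.eta; case: asboolP => [->|nX]; first by rewrite scale1r.
  by rewrite !inE => /orP[]/eqP rr1; move: nX; rewrite rE rr1 ?scale1r.
have [a psiX] := dv_component gX X0 (psi_gr gX).
have ga := @dv_e_iota R G d a; set b := iota a in psiX ga.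
have real : (exists r : R, b = r%:A) -> exists r : R, psi (X t) = r *: X t.
  by case=> r br; exists r; rewrite psiX br mulr_algr.
case E : kind.
- by apply/real/fixed_real => //; apply: kindR_real; rewrite ?E.
- have kC : kindC kind by rewrite E.
  have [Kt|nK] := pselect (setK d t); first by exists delta; apply: ch_X_C.
  have cX := X_conjugates Tt kC nK.
  have : X t * (b * b) = X t.
    have := psiK (X t); rewrite psiX psiM psiX mulrA cX ?psiK -?mulrA //.
    exact: psi_gr.
  move=> XX; have [y [_ Xy yX]] := X_inverse Tt.
  have bb : b * b = 1 by rewrite -[LHS]mul1r -yX -mulrA XX.
  have : (b - 1) * (b + 1) = 0.
    by rewrite mulrDr !mulrBl bb !mulr1 !mul1r addrA subrK subrr.
  have g1 := gr1 gD.
  case/(dv_domain (grB gD ga g1) (grD gD ga g1)).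
  + by move/eqP; rewrite subr_eq0 => /eqP b1; apply: real; exists 1; rewrite scale1r.
  + move/eqP; rewrite addr_eq0 => /eqP b1; apply: real; exists (-1).
    by rewrite scaleN1r.
- have kH : kindH kind by rewrite E.
  apply/real/kindH_central => // a' ga'.
  have [y [_ Xy yX]] := X_inverse Tt.
  have XC := ch_X_H c kH Tt.
  have : psi (X t) * a' = a' * psi (X t).
    have := congr1 (fun z => psi z) (XC _ (psi_gr ga')).
    by rewrite !psiM psiK => ->.
  rewrite psiX mulrA -XC // -!mulrA => /(congr1 ( *%R y)).
  by rewrite !mulrA yX !mul1r.
Qed.

Lemma eta_K t : kindC kind -> setK d t -> eta t = delta.
Proof.
move=> kC Kt; have Tt : T t by move: Kt; rewrite /setK kC => -[].
have := psi_X Tt; rewrite (ch_X_C c kC Kt) => /eqP.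
rewrite -subr_eq0 -scalerBl scaler_eq0 subr_eq0.
by case/orP=> /eqP // /(X_neq0 Tt).
Qed.

(** Here psi(a) X_t = X_t a for a in D_e, so psi acts on D_t as the scalar eta(t). This makes the
    form alternating on a coset where eta = - delta. *)
Lemma psi_bilinear t b : T t -> kindR kind \/ (kindC kind /\ ~ setK d t) ->
  Dgr t b -> psi b = eta t *: b.
Proof.
move=> Tt kt gb; have [a ->] := dv_component (X_gr Tt) (X_neq0 Tt) gb.
have ga := @dv_e_iota R G d a.
rewrite psiM psi_X // -scalerAr; congr (_ *: _).
case: kt => [kR|[kC nK]].
  rewrite kindR_real //; apply: X_commutes => //.
  by case: kind kR.
by rewrite X_conjugates ?psiK //; apply: psi_gr.
Qed.

(** For b = X_t a the symmetry condition becomes psi(a) = a. The resulting real coefficient is the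
    source of the signature. *)
Lemma hermitian_value t b : T t -> X_commuting t -> eta t = delta ->
  Dgr t b -> psi b = delta *: b -> exists r : R, b = r *: X t.
Proof.
move=> Tt cX et gb; have [a ->] := dv_component (X_gr Tt) (X_neq0 Tt) gb.
have ga := @dv_e_iota R G d a.
rewrite psiM psi_X // et -scalerAr cX; last exact: psi_gr.
move/(congr1 ( *:%R delta)); rewrite !scalerA delta_sqr !scale1r => XX.
have [y [_ Xy yX]] := X_inverse Tt.
have [|r rE] := fixed_real ga; last by exists r; rewrite rE mulr_algr.
by rewrite -[LHS]mul1r -[RHS]mul1r -yX -!mulrA XX.
Qed.

(* With p, i pure of norm 1, [1 - p i] intertwines p and i; it vanishes
   only for p = - i, when any element anticommuting with i will do. *)
Lemma quaternion_conjugate p i : kindH kind -> Dgr 1%g p -> p <> 0 ->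
  psi p = - p -> Dgr 1%g i -> i * i = -1 ->
  exists q, [/\ Dgr 1%g q, q <> 0 & psi q * p * q = i].
Proof.
move=> kH gp p0 psip gi ii.
have [n [np _ n0 nz]] := e_norm gp.
have {n0} n0 : 0 < n by rewrite lt_neqAle n0 eq_sym nz andbT; apply/eqP.
pose m := Num.sqrt n; have m0 : 0 < m by rewrite sqrtr_gt0.
have mm : m * m = n by rewrite -expr2 sqr_sqrtr ?ltW.
pose p1 := m^-1 *: p.
have gp1 : Dgr 1%g p1 by apply: (grZ gD).
have p1p1 : p1 * p1 = -1.
  have pp : p * p = - n%:A by rewrite -np psip mulNr opprK.
  rewrite -scalerAl -scalerAr scalerA pp -invfM mm scalerN scalerA.
  by rewrite mulVf ?gt_eqF // scale1r.
have [q0 [gq0 q00 pq]] : exists q, [/\ Dgr 1%g q, q <> 0 & p1 * q = q * i].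
  have g1 : Dgr 1%g (1 : D) by apply: (gr1 gD).
  have [pi|pi] := pselect (1 - p1 * i = 0); last first.
    exists (1 - p1 * i); split=> //; first by apply/(grB gD)/grMe.
    rewrite mulrBr mulrBl mulr1 mul1r mulrA p1p1 mulN1r opprK.
    by rewrite -mulrA ii mulrN1 opprK addrC.
  have pE : p1 = - i.
    move/eqP: pi; rewrite subr_eq0 => /eqP pi.
    by rewrite -[RHS]mul1r pi -mulrA mulrN ii opprK mulr1.
  have [q [gq qi]] : exists q, Dgr 1%g q /\ i * q <> q * i.
    apply: contrapT => nq; have [b gb|r ir] := kindH_central kH gi.
      by apply: contrapT => ?; apply: nq; exists b.
    move/eqP: ii; rewrite ir mulr_algl scalerA -scaleN1r -subr_eq0 -scalerBl.
    rewrite scaler_eq0 oner_eq0 orbF opprK paddr_eq0 ?ler01 ?oner_eq0 ?andbF //.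
    by rewrite -expr2 sqr_ge0.
  exists (q * i - i * q); split.
  - by apply: (grB gD); apply: grMe.
  - by move/eqP; rewrite subr_eq0 => /eqP/esym.
  - rewrite pE mulNr mulrBr mulrBl !mulrA ii -[q * i * i]mulrA ii.
    by rewrite mulN1r mulrN1 opprK opprD addrC.
have [k [kq _ k0 kz]] := e_norm gq0.
have {k0} k0 : 0 < k by rewrite lt_neqAle k0 eq_sym kz andbT; apply/eqP.
(* psi(q0) p q0 = m k i, so q0 has to be divided by the square root of m k. *)
pose s := Num.sqrt (m * k); have s0 : 0 < s by rewrite sqrtr_gt0 mulr_gt0.
have ss : s * s = m * k by rewrite -expr2 sqr_sqrtr // ltW // mulr_gt0.
exists (s^-1 *: q0); split.
- exact: (grZ gD).
- by move/eqP; rewrite scaler_eq0 invr_eq0 gt_eqF //= => /eqP.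
have -> : p = m *: p1 by rewrite scalerA mulfV ?scale1r ?gt_eqF.
have -> : psi (s^-1 *: q0) * (m *: p1) * (s^-1 *: q0) =
    (m * (s^-1 * s^-1)) *: (psi q0 * (p1 * q0)).
  clearbody p1; rewrite psiZ -[_ * (m *: p1)]scalerAr -!scalerAl -scalerAr.
  by rewrite !scalerA !mulrA.
rewrite pq (mulrA (psi q0)) kq mulr_algl scalerA -invfM ss.
have -> : m * (m * k)^-1 * k = 1.
  by rewrite invfM !mulrA mulfV ?gt_eqF // mul1r mulVf ?gt_eqF.
by rewrite scale1r.
Qed.

End ChoicesTheory.

(** * Orthogonal bases *)

Section GramSchmidt.
Variables (R : realType) (G : groupType).
Hypothesis GC : forall g h : G, (g * h = h * g)%g.
Variables (A : lmodType R) (mul : A -> A -> A) (gr : G -> set A).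
Variable (phi : A -> A).
Hypotheses (mul_assoc : assoc_algebra mul) (gr_grading : grading mul gr).
Hypothesis A_dcc : dcc_graded_left_ideals mul gr.
Variables (d : divdata R G) (hs : hermitian_space mul gr phi d) (c : choices d).
Local Notation D := (dv_alg d).
Local Notation T := (dv_supp d).
Local Notation Dgr := (@dv_gr R G d).
Local Notation psi := (@dv_inv R G d).
Local Notation delta := (dv_delta d).
Local Notation kind := (dv_kind d).
Local Notation gD := (dv_grading d).
Local Notation X := (ch_X c).
Local Notation xi := (ch_xi c).
Local Notation eta := (@Defs.eta R G d c).
Local Notation V := (hs_V hs).
Local Notation act := (hs_act hs).
Local Notation B := (hs_B hs).
Local Notation g0 := (hs_deg hs).
Local Notation fixed := (fixed_cosets (d := d) g0).
Local Notation tau := (tau c g0).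
Local Notation sigd := (has_signature c g0).

Lemma V_subspace : subspace V.
Proof. by case: (hs_graded hs). Qed.
Lemma V0 : V 0. Proof. by case: V_subspace. Qed.
Lemma VD v w : V v -> V w -> V (v + w).
Proof. by case: V_subspace => _ H _; apply: H. Qed.
Lemma VZ (k : R) v : V v -> V (k *: v).
Proof. by case: V_subspace => _ _; apply. Qed.
Lemma VB v w : V v -> V w -> V (v - w).
Proof. by move=> Vv Vw; apply: VD => //; rewrite -scaleN1r; apply: VZ. Qed.
Lemma V_comp g v : V v -> V (hcomp gr_grading g v).
Proof.
by apply: (iffRL (graded_subspaceP gr_grading V_subspace)); apply: hs_graded.
Qed.

Lemma act0l a : act 0 a = 0.
Proof. by have := hs_actZ hs 0 0 a; rewrite !scale0r. Qed.
Lemma act0r v : act v 0 = 0.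
Proof. by have := hs_actZr hs 0 v 0; rewrite !scale0r. Qed.
Lemma B0l w : B 0 w = 0.
Proof. by have := hs_BZl hs 0 0 w; rewrite !scale0r. Qed.
Lemma B0r v : B v 0 = 0.
Proof. by have := hs_BZr hs 0 v 0; rewrite !scale0r. Qed.
Lemma BNr v w : B v (- w) = - B v w.
Proof. by rewrite -scaleN1r hs_BZr scaleN1r. Qed.
Lemma BBr v w w' : B v (w - w') = B v w - B v w'.
Proof. by rewrite hs_BDr BNr. Qed.
Lemma BBl v v' w : B (v - v') w = B v w - B v' w.
Proof. by rewrite hs_BDl -scaleN1r hs_BZl scaleN1r. Qed.
Lemma B_suml (I : Type) (s : seq I) (F : I -> A) w :
  B (\sum_(i <- s) F i) w = \sum_(i <- s) B (F i) w.
Proof. by apply: (big_morph (B^~ w)) => [? ?|]; rewrite ?hs_BDl ?B0l. Qed.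
Lemma B_sumr (I : Type) (s : seq I) (F : I -> A) w :
  B w (\sum_(i <- s) F i) = \sum_(i <- s) B w (F i).
Proof. by apply: (big_morph (B w)) => [? ?|]; rewrite ?hs_BDr ?B0r. Qed.

Lemma B_swap v w : B w v = delta *: psi (B v w).
Proof. by rewrite hs_B_sym scalerA delta_sqr scale1r. Qed.
Lemma B_orth v w : B v w = 0 -> B w v = 0.
Proof. by move=> vw; rewrite B_swap vw psi0 scaler0. Qed.

Lemma B_comp g h v w : gr h v ->
  hcomp gD (g0 * h * g)%g (B v w) = B v (hcomp gr_grading g w).
Proof.
move=> gv; move: w; apply: (homogeneous_ind gr_grading) => [|x y xE yE|k w gw].
- by rewrite B0r !linear0 B0r.
- by rewrite hs_BDr !linearD /= xE yE hs_BDr.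
- rewrite (comp_hom gD _ (hs_B_gr hs gv gw)) (comp_hom gr_grading _ gw).
  by rewrite (inj_eq (@mulgI _ _)); case: ifP => // _; rewrite B0r.
Qed.

Lemma act_neq0 v a g : V v -> Dgr g a -> a <> 0 -> v <> 0 -> act v a <> 0.
Proof.
move=> Vv ga a0 v0 va; have [b [_ ab _]] := dv_inverse ga a0.
by apply: v0; rewrite -(hs_act1 Vv) -ab hs_actM va act0l.
Qed.

Lemma fixedP x : fixed x <-> T (tau x).
Proof.
split=> [[g Tg xE]|Tx]; last by exists (xi x) => //; apply: ch_xiK.
have /(quot_piP GC) Tgx : quot_pi T g = quot_pi T (xi x) by rewrite ch_xiK.
have -> : (tau x = g0 * (g * g) * ((g^-1 * xi x) * (g^-1 * xi x)))%g.
  by rewrite /Defs.tau; abelian GC.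
by apply: dv_suppM => //; apply: dv_suppM.
Qed.

(** The cosets on which the form is alternating: eta = - delta, with D_e = R, or D_e = C and tau(x)
    outside K. Only there may both vectors of a hyperbolic pair lie over one coset. *)
Definition skew_coset x : Prop := [/\ fixed x, ~ sigd x, ~~ kindH kind &
  ~~ (kindC kind && (eta (tau x) == delta))].

(* The element b of D_e with B(v, v) = X_tau b for the anisotropic basis vectors v
   in the coset x; [s = true] selects the negative ones. *)
Definition diag_value x (s : bool) : D :=
  if `[< sigd x >] then (if s then -1 else 1)
  else if kindH kind then ch_i c else 1.

(* Either a hyperbolic pair of vectors ([p_has] holds on both sides) or a single
   anisotropic vector ([p_has] holds on one side only). *)
Record piece := Piece {
  p_x : bool -> quot T;
  p_v : bool -> A;
  p_has : bool -> bool
}.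

Definition pair_deg (p : piece) : G :=
  (g0 * xi (p_x p false) * xi (p_x p true))%g.

Definition pair_valid (p : piece) : Prop :=
  [/\ p_has p false /\ p_has p true, T (pair_deg p),
    B (p_v p false) (p_v p true) = X (pair_deg p),
    forall s, B (p_v p s) (p_v p s) = 0 &
    p_x p false = p_x p true -> skew_coset (p_x p false)].

Definition single_valid (p : piece) : Prop := exists s,
  [/\ p_has p s /\ ~~ p_has p (~~ s), fixed (p_x p s), ~ skew_coset (p_x p s),
    s -> sigd (p_x p s) &
    B (p_v p s) (p_v p s) = X (tau (p_x p s)) * diag_value (p_x p s) s].

Definition valid (p : piece) : Prop :=
  (forall s, p_has p s -> V (p_v p s) /\ gr (xi (p_x p s)) (p_v p s)) /\
  (pair_valid p \/ single_valid p).

(** * Splitting off a hyperbolic pair or an anisotropic line *)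

Section NewPiece.
Variable W : set A.
Hypotheses (W_V : forall v, W v -> V v)
  (W_D : forall v w, W v -> W w -> W (v + w))
  (W_act : forall v a, W v -> W (act v a))
  (W_comp : forall g v, W v -> W (hcomp gr_grading g v))
  (W_nondeg : forall v, W v -> v <> 0 -> exists2 w, W w & B w v <> 0).

(** X_t with t = g^-1 xi(gT) moves v into the degree prescribed by the section. *)
Lemma in_section g v : W v -> gr g v ->
  exists a, [/\ W (act v a), gr (xi (quot_pi T g)) (act v a) &
    exists2 h, Dgr h a & a <> 0].
Proof.
move=> Wv gv; pose x := quot_pi T g.
have /(quot_piP GC) Tgx : quot_pi T g = quot_pi T (xi x) by rewrite ch_xiK.
exists (X (g^-1 * xi x)%g); split; first exact: W_act.
  by have := hs_act_gr hs gv (X_gr c Tgx); rewrite mulVKg.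
by exists (g^-1 * xi x)%g; [apply: X_gr|apply: X_neq0].
Qed.

Lemma nonzero_pairing v : W v -> v <> 0 -> exists x y v w,
  [/\ W v /\ gr (xi x) v, W w /\ gr (xi y) w, T (g0 * xi x * xi y)%g &
      B v w = X (g0 * xi x * xi y)%g].
Proof.
move=> Wv /(comp_neq0 gr_grading)[g].
set v1 := hcomp _ _ _ => v10.
have Wv1 : W v1 by apply: W_comp.
have gv1 : gr g v1 by apply: comp_gr.
have [w Ww Bw] := W_nondeg Wv1 v10.
have [h Bwh] : exists h, B v1 (hcomp gr_grading h w) <> 0.
  apply: contrapT => nB; apply: Bw; apply: B_orth.
  have [s _ ->] := comp_sum gr_grading w.
  rewrite B_sumr big1 // => h _; apply: contrapT => ?; apply: nB.
  by exists h.
move: Bwh; set w1 := hcomp _ _ _ => Bvw.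
have Ww1 : W w1 by apply: W_comp.
have gw1 : gr h w1 by apply: comp_gr.
have [a [Wva gva [ha ga a0]]] := in_section Wv1 gv1.
have [b [Wwb gwb [hb gb b0]]] := in_section Ww1 gw1.
set x := quot_pi T g in gva; set y := quot_pi T h in gwb.
pose beta := B (act v1 a) (act w1 b).
have beta0 : beta <> 0.
  rewrite /beta hs_B_actr hs_B_actl => ab0.
  have gB := hs_B_gr hs gv1 gw1.
  have := dv_domain (grM gD (psi_gr ga) gB) gb ab0.
  case=> [|/b0 //] /(dv_domain (psi_gr ga) gB)[|/Bvw //].
  by move=> pa0; apply: a0; rewrite -[a]psiK pa0 psi0.
have gbeta : Dgr (g0 * xi x * xi y)%g beta by apply: hs_B_gr.
have Txy : T (g0 * xi x * xi y)%g by exists beta.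
have [bi [gbi bbi bib]] := dv_inverse gbeta beta0.
(* Acting on the second vector by the inverse of the value times X_t brings the value to X_t
   exactly. *)
exists x, y, (act v1 a), (act (act w1 b) (bi * X (g0 * xi x * xi y)%g)).
split=> //.
- split; first exact: W_act.
  have gc := grM gD gbi (X_gr c Txy); rewrite mulVg in gc.
  by have := hs_act_gr hs gwb gc; rewrite mulg1.
- by rewrite hs_B_actr mulrA -/beta bbi mul1r.
Qed.

(** Only i i = -1 is given. With the norm n of i, psi(i) i = n yields psi(i) = - n i; applying psi
    again gives n n = 1, and n is nonnegative. *)
Lemma ch_i_pure : kindH kind -> psi (ch_i c) = - ch_i c.
Proof.
move=> kH; have [gi ii] := ch_i_H c kH; have [n [nn _ n0 _]] := e_norm gi.
have pi : psi (ch_i c) = - (n *: ch_i c).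
  by rewrite -[LHS]mulr1 -[1]opprK -ii mulrN mulrA nn mulr_algl.
have : psi (psi (ch_i c)) = (n * n) *: ch_i c.
  by rewrite pi psiN psiZ pi scalerN opprK scalerA.
rewrite psiK -[X in X = _]scale1r => /eqP; rewrite -subr_eq0 -scalerBl.
rewrite scaler_eq0 subr_eq0 => /orP[/eqP nn1|/eqP i0]; last first.
  by move/eqP: ii; rewrite i0 mul0r eq_sym oppr_eq0 oner_eq0.
suff n1 : n = 1 by rewrite pi n1 scale1r.
by apply/eqP; rewrite -(@eqrXn2 _ 2) // expr1n expr2 -nn1.
Qed.

Lemma nskew_eta x : T (tau x) -> ~ skew_coset x ->
  (kindH kind /\ eta (tau x) = - delta) \/ eta (tau x) = delta.
Proof.
move=> Tx nsk; have fx : fixed x by apply/fixedP.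
have [->|/eqP/eta_delta et] := eqVneq (eta (tau x)) delta; first by right.
left; split=> //; apply: contrapT => /negP kH; apply: nsk; split=> //.
  rewrite /Defs.has_signature => -[_]; case: ifP => [kC|_].
    by move/(eta_K c kC) => e; apply: (eta_ndelta et).
  exact: eta_ndelta.
by rewrite negb_and; apply/orP; right; apply/eqP/eta_ndelta.
Qed.

(** Polarisation: for isotropic v and w, B(v + w, v + w) = 2 X_t if eta = delta. If D_e = H and eta
    = - delta the two terms cancel, and w i in place of w gives 2 X_t i. *)
Lemma anisotropic x v w : ~ skew_coset x -> T (tau x) -> W v -> gr (xi x) v -> W w ->
  gr (xi x) w -> B v w = X (tau x) ->
  exists u, [/\ W u, gr (xi x) u & B u u <> 0].
Proof.
move=> nsk Tx Wv gv Ww gw Bvw.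
have [Bv|] := pselect (B v v = 0); last by exists v.
have [Bw|] := pselect (B w w = 0); last by exists w.
have Bwv : B w v = (delta * eta (tau x)) *: X (tau x).
  by rewrite B_swap Bvw psi_X // scalerA.
have two0 (z : D) : z <> 0 -> z + z <> 0.
  move=> z0 /eqP; rewrite -mulr2n -scaler_nat scaler_eq0 pnatr_eq0 /=.
  by move/eqP.
have [[kH et]|et] := nskew_eta Tx nsk.
  have [gi ii] := ch_i_H c kH; pose w' := act w (ch_i c).
  have gw' : gr (xi x) w' by have := hs_act_gr hs gw gi; rewrite mulg1.
  exists (v + w'); split; first by apply: W_D => //; apply: W_act.
    exact: (grD gr_grading).
  rewrite hs_BDl !hs_BDr Bv add0r !hs_B_actr !hs_B_actl Bvw Bwv Bw.
  rewrite mulr0 mul0r addr0 ch_i_pure // et mulrN delta_sqr scaleN1r mulrNN.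
  rewrite -ch_X_H //; apply: two0 => Xi0.
  have := dv_domain (X_gr c Tx) gi Xi0; case=> [/(X_neq0 Tx)//|i0].
  by move/eqP: ii; rewrite i0 mul0r eq_sym oppr_eq0 oner_eq0.
exists (v + w); split; first exact: W_D; first exact: (grD gr_grading).
rewrite hs_BDl !hs_BDr Bv Bw Bvw Bwv et delta_sqr scale1r add0r addr0.
exact/two0/X_neq0.
Qed.

(** Scaling u by q in D_e changes the coefficient b of B(u, u) = X_t b into psi(q) b q if X_t
    commutes with D_e, and into q b q if it conjugates. This reduces b to a sign, to the chosen
    imaginary unit, or to 1. *)
Lemma diagonal_vector x u : ~ skew_coset x -> T (tau x) -> W u -> gr (xi x) u ->
  B u u <> 0 -> exists (s : bool) v, [/\ W v, gr (xi x) v, s -> sigd x &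
    B v v = X (tau x) * diag_value x s].
Proof.
move=> nsk Tx Wu gu Bu.
have gB : Dgr (tau x) (B u u).
  by rewrite /Defs.tau mulgA; apply: hs_B_gr.
have symB : psi (B u u) = delta *: B u u by rewrite hs_B_sym.
have scaled q : Dgr 1%g q -> W (act u q) /\ gr (xi x) (act u q).
  by move=> gq; split; [apply: W_act|have := hs_act_gr hs gu gq; rewrite mulg1].
have [sx|nsx] := pselect (sigd x).
  have [fx et] : fixed x /\ eta (tau x) = delta.
    by case: sx => fx; case: ifP => // kC /(eta_K c kC).
  have cX : X_commuting c (tau x).
    apply: X_commutes => // kC; case: sx => _; by rewrite kC.
  have [r rE] := hermitian_value Tx cX et gB symB.
  have r0 : `|r| != 0.
    by rewrite normr_eq0; apply/eqP => r0; apply: Bu; rewrite rE r0 scale0r.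
  pose q := (Num.sqrt `|r|)^-1.
  have qq : q * q = `|r|^-1 by rewrite -invfM -expr2 sqr_sqrtr.
  exists (r < 0), (q *: u); split=> //.
  - by have [] := scaled _ (gr_e1 d q); rewrite hs_actZr hs_act1 //; apply: W_V.
  - exact: (grZ gr_grading).
  - rewrite hs_BZl hs_BZr scalerA qq rE scalerA /diag_value asboolT //.
    case: ltP => [rn|rp].
      by rewrite ltr0_norm // invrN mulNr mulVf ?scaleN1r ?mulrN1 ?lt_eqF.
    rewrite ger0_norm // mulVf ?scale1r ?mulr1 //.
    by rewrite -normr_eq0.
have [q [gq Bq]] : exists q, Dgr 1%g q /\
    B (act u q) (act u q) = X (tau x) * diag_value x false.
  have [b BE] := dv_component (X_gr c Tx) (X_neq0 Tx) gB.
  set be := dv_iota d b in BE; have gb : Dgr 1%g be by apply: dv_e_iota.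
  have b0 : be <> 0 by move=> b0; apply: Bu; rewrite BE b0 mulr0.
  rewrite /diag_value asboolF //; have [kH|nkH] := boolP (kindH kind).
    have et : eta (tau x) = - delta.
      have [[]//|et] := nskew_eta Tx nsk; case: nsx; split; first exact/fixedP.
      by case: kind kH.
    have pb : psi be = - be.
      have : X (tau x) * psi be = X (tau x) * - be.
        move: symB; rewrite BE psiM psi_X // et -scalerAr -ch_X_H //; last first.
          exact: psi_gr.
        move/(congr1 ( *:%R delta)).
        by rewrite !scalerA mulrN delta_sqr scaleN1r scale1r mulrN => <-; rewrite opprK.
      have [y [_ _ yX]] := X_inverse c Tx.
      by move/(congr1 ( *%R y)); rewrite !mulrA yX !mul1r.
    have [gi ii] := ch_i_H c kH.
    have [q [gq _ qE]] := quaternion_conjugate kH gb b0 pb gi ii.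
    exists q; split=> //; rewrite hs_B_actl hs_B_actr BE !mulrA.
    by rewrite -ch_X_H //; [rewrite -!mulrA (mulrA (psi q)) qE|apply: psi_gr].
  have [et kC] : eta (tau x) = delta /\ kindC kind.
    have [[kH]|et] := nskew_eta Tx nsk; first by rewrite kH in nkH.
    split=> //; apply: contrapT => /negP nkC; apply: nsx.
    by split; [apply/fixedP|rewrite (negPf nkC)].
  have nK : ~ setK d (tau x).
    by move=> Kx; apply: nsx; split; [apply/fixedP|rewrite kC].
  have [q [gq _ qE]] := kindC_sqrt kC gb b0.
  exists q; split=> //; rewrite hs_B_actl hs_B_actr BE !mulrA.
  rewrite (X_conjugates c Tx kC nK); last exact: psi_gr.
  by rewrite psiK -!mulrA (mulrA q) qE.
exists false, (act u q); have [Wq gq'] := scaled q gq; split=> //.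
Qed.

Lemma new_piece v : W v -> v <> 0 -> exists p, valid p /\
  forall s, p_has p s -> W (p_v p s).
Proof.
move=> Wv v0; have [x [y [{Wv v0}v [w [[Wv gv] [Ww gw] Txy Bvw]]]]] :=
  nonzero_pairing Wv v0.
have pairP : B v v = 0 -> B w w = 0 -> (x = y -> skew_coset x) -> exists p, valid p /\
    forall s, p_has p s -> W (p_v p s).
  move=> Bv Bw xy; exists (Piece (fun s => if s then y else x)
    (fun s => if s then w else v) xpredT); split; last by case.
  split; first by case=> _; split=> //; apply: W_V.
  by left; split=> //; case.
(* If B(u, u) were nonzero its degree would lie in T and, together with the degree of B(v, w), would
   give x = y. *)
have isotropic z u : x <> y -> W u -> gr (xi z) u -> (z = x \/ z = y) ->
    B u u = 0.
  move=> xy Wu gu zxy; apply: (dv_gr_neq0 (hs_B_gr hs gu gu)) => Tz.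
  apply: xy.
  suff /(quot_piP GC) : T ((xi x)^-1 * xi y)%g by rewrite !ch_xiK.
  case: zxy => zE; rewrite zE in Tz.
    have -> : ((xi x)^-1 * xi y = g0 * xi x * xi y * (g0 * xi x * xi x)^-1)%g.
      by abelian GC.
    by apply: dv_suppM => //; apply: dv_suppV.
  have -> : ((xi x)^-1 * xi y = g0 * xi y * xi y * (g0 * xi x * xi y)^-1)%g.
    by abelian GC.
  by apply: dv_suppM => //; apply: dv_suppV.
have [xy|xy] := pselect (x = y); last first.
  by apply: pairP => //; [apply: (isotropic x)|apply: (isotropic y)] => //;
    [left|right].
have tE : (g0 * xi x * xi y = tau x)%g by rewrite -xy /Defs.tau mulgA.
rewrite -xy in gw; rewrite tE in Bvw Txy.
have [sk|nsk] := pselect (skew_coset x); last first.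
  have [u [Wu gu Bu]] := anisotropic nsk Txy Wv gv Ww gw Bvw.
  have [s [z [Wz gz sx Bz]]] := diagonal_vector nsk Txy Wu gu Bu.
  exists (Piece (fun=> x) (fun=> z) (fun s' => s' == s)); split=> //.
  split=> [s' _|]; first by split=> //; apply: W_V.
  right; exists s; split=> //=; first by rewrite eqxx; split=> //; case: (s).
  exact/fixedP.
(* On a skew coset psi multiplies B(u, u) both by delta and by - delta. *)
have alt u : gr (xi x) u -> B u u = 0.
  move=> gu; have gB : Dgr (tau x) (B u u).
    by rewrite /Defs.tau mulgA; apply: hs_B_gr.
  have [fx nsx kH kCe] := sk.
  have bil : kindR kind \/ (kindC kind /\ ~ setK d (tau x)).
    case E : kind kH => //= _; [by left|right]; split=> // Kx; apply: nsx.
    by split=> //; rewrite E.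
  have et : eta (tau x) = - delta.
    apply: eta_delta => et; case: bil => [kR|[kC _]].
      by apply: nsx; split=> //; case: kind kR.
    by move: kCe; rewrite kC et eqxx.
  have := psi_bilinear c Txy bil gB; rewrite hs_B_sym et scaleNr => /eqP.
  rewrite -addr_eq0 -scalerDr scaler_eq0 -mulr2n -scaler_nat scaler_eq0.
  rewrite pnatr_eq0 /= => /orP[/eqP d0|/eqP //].
  by have := delta_sqr d; rewrite d0 mul0r => /eqP; rewrite eq_sym oner_eq0.
by apply: pairP; rewrite ?alt.
Qed.

End NewPiece.

Lemma diag_value_gr x s : Dgr 1%g (diag_value x s) /\ diag_value x s <> 0.
Proof.
have g1 : Dgr 1%g 1 by apply: (gr1 gD).
have n1 : (1 : D) <> 0 by apply/eqP/oner_neq0.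
rewrite /diag_value; case: ifP => _; first case: s => //.
  by split; [apply: (grN gD)|move/eqP; rewrite oppr_eq0 => /eqP].
case: ifP => // kH; have [gi ii] := ch_i_H c kH; split=> // i0.
by move/eqP: ii; rewrite i0 mul0r eq_sym oppr_eq0 => /eqP.
Qed.

Lemma piece_has_deg p s : valid p -> p_has p s ->
  V (p_v p s) /\ gr (xi (p_x p s)) (p_v p s).
Proof. by case=> + _; apply. Qed.

(** The orthogonal projection onto the span of the piece, written with the inverse of its Gram
    matrix; delta eta(t) is its own inverse. *)
Lemma piece_projection p : valid p -> exists P : A -> A,
  [/\ forall z, V z -> V (P z), forall g z, gr g z -> gr g (P z),
      forall z s, p_has p s -> B (p_v p s) (P z) = B (p_v p s) z &
      forall y, (forall s, p_has p s -> B (p_v p s) y = 0) ->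
        forall z, B (P z) y = 0].
Proof.
move=> pv; have [pV [[[h0 h1] Tt B01 Bss _]|[s [[hs0 hsN] fx nsk sx Bs]]]] := pv.
- have [[V0' gv0] [V1 gv1]] := (pV _ h0, pV _ h1).
  have [b [gb Xb bX]] := X_inverse c Tt.
  have B10 : B (p_v p true) (p_v p false) =
      (delta * eta (pair_deg p)) *: X (pair_deg p).
    by rewrite B_swap B01 psi_X // scalerA.
  pose b' := (delta * eta (pair_deg p)) *: b.
  have gb' : Dgr (pair_deg p)^-1%g b' by apply: (grZ gD).
  have B10b : B (p_v p true) (p_v p false) * b' = 1.
    rewrite B10 -scalerAl -scalerAr Xb scalerA mulrACA delta_sqr eta_sqr.
    by rewrite mulr1 scale1r.
  exists (fun z => act (p_v p false) (b' * B (p_v p true) z) +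
                   act (p_v p true) (b * B (p_v p false) z)); split.
  + by move=> z Vz; apply: VD; apply: hs_actV.
  + move=> g z gz; apply: (grD gr_grading).
      have := hs_act_gr hs gv0 (grM gD gb' (hs_B_gr hs gv1 gz)).
      by congr (gr _ _); rewrite /pair_deg; abelian GC.
    have := hs_act_gr hs gv1 (grM gD gb (hs_B_gr hs gv0 gz)).
    by congr (gr _ _); rewrite /pair_deg; abelian GC.
  + move=> z [] _; rewrite hs_BDr !hs_B_actr Bss mul0r ?addr0 ?add0r mulrA.
      by rewrite B10b mul1r.
    by rewrite B01 Xb mul1r.
  + by move=> y yp z; rewrite hs_BDl !hs_B_actl !yp // !mulr0 addr0.
- have [Vv gv] := pV _ hs0; have Tx := (fixedP _).1 fx.
  have [gd d0] := diag_value_gr (p_x p s) s.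
  have gB : Dgr (tau (p_x p s)) (B (p_v p s) (p_v p s)).
    by rewrite /Defs.tau mulgA; apply: hs_B_gr.
  have B0 : B (p_v p s) (p_v p s) <> 0.
    rewrite Bs => /(dv_domain (X_gr c Tx) gd)[/(X_neq0 Tx)//|//].
  have [b [gb Bb bB]] := dv_inverse gB B0.
  exists (fun z => act (p_v p s) (b * B (p_v p s) z)); split.
  + by move=> z Vz; apply: hs_actV.
  + move=> g z gz; have := hs_act_gr hs gv (grM gD gb (hs_B_gr hs gv gz)).
    by congr (gr _ _); rewrite /Defs.tau; abelian GC.
  + move=> z s' hs'; have -> : s' = s.
      by move: hs' hsN; case: (s) (s') => [] [] // ->.
    by rewrite hs_B_actr mulrA Bb mul1r.
  + by move=> y yp z; rewrite hs_B_actl yp // mulr0.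
Qed.

Definition piece0 : piece :=
  Piece (fun=> quot_pi T 1%g) (fun=> 0) (fun=> false).

Local Notation "L `@ i" := (nth piece0 L i) (at level 3).

Definition orthogonal_to (L : seq piece) (y : A) : Prop :=
  forall i s, (i < size L)%N -> p_has L`@i s -> B (p_v L`@i s) y = 0.

Definition orthogonal_family (L : seq piece) : Prop :=
  (forall i, (i < size L)%N -> valid L`@i) /\
  forall i j s s', (i < size L)%N -> (j < size L)%N -> i <> j ->
    p_has L`@i s -> p_has L`@j s' -> B (p_v L`@i s) (p_v L`@j s') = 0.

Definition complete_family (L : seq piece) : Prop :=
  forall z, V z -> orthogonal_to L z -> z = 0.

(** The orthogonal projection onto the span, characterised by pairings alone; it is what makes the
    orthogonal complement nondegenerate. *)
Definition has_projection (L : seq piece) : Prop := exists P : A -> A,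
  [/\ forall z, V z -> V (P z), forall g z, gr g z -> gr g (P z),
      forall z, orthogonal_to L (z - P z) &
      forall y, orthogonal_to L y -> forall z, B (P z) y = 0].

Lemma extend_family L p : orthogonal_family L -> has_projection L ->
  valid p -> (forall s, p_has p s -> orthogonal_to L (p_v p s)) ->
  orthogonal_family (p :: L) /\ has_projection (p :: L).
Proof.
move=> [Lv Lo] [P [PV Pgr PL Py]] pv pL; split.
  split=> [[|i]//|[|i] [|j] s s'] //=.
  - exact: Lv.
  - by move=> _ jL _ hp hj; apply/B_orth/pL.
  - by move=> iL _ _ hi hp; apply: pL.
  - by move=> iL jL ij; apply: Lo => // ijE; apply: ij; rewrite ijE.
have [Q [QV Qgr QL Qy]] := piece_projection pv.
exists (fun z => P z + Q z); split.
- by move=> z Vz; apply: VD; auto.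
- by move=> g z gz; apply: (grD gr_grading); auto.
- move=> z [|i] s /=; rewrite opprD addrA.
    by move=> _ hp; rewrite !BBr QL // (B_orth (Py _ (pL s hp) z)) subr0 subrr.
  move=> iL hi; rewrite BBr (PL z i s) // sub0r; apply/eqP; rewrite oppr_eq0.
  by apply/eqP/B_orth/Qy => s' hs'; apply/B_orth/pL.
- move=> y yL z; rewrite hs_BDl Py ?Qy ?addr0 //.
    by move=> s hp; apply: (yL 0%N).
  by move=> i s iL; apply: (yL i.+1).
Qed.

Theorem orthogonal_basis : exists L,
  orthogonal_family L /\ complete_family L.
Proof.
pose ann L := [set r | forall i s, (i < size L)%N -> p_has L`@i s ->
  mul r (p_v L`@i s) = 0].
have gann L : orthogonal_family L -> graded_left_ideal mul gr (ann L).
  move=> [Lv _]; split=> [|r x xL i s iL hi]; last first.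
    by rewrite -(nmulA mul_assoc) xL // (nmulr0 mul_assoc).
  apply/(graded_subspaceP gr_grading) => [|g x xL i s iL hi].
    split=> [i s _ _|x y xL yL i s iL hi|k x xL i s iL hi].
    - exact: (nmul0 mul_assoc).
    - by rewrite (nmulDl mul_assoc) xL // yL // addr0.
    - by rewrite (nscaleAl mul_assoc) xL // scaler0.
  have [_ gi] := piece_has_deg (Lv i iL) hi.
  by rewrite -(comp_mulr mul_assoc gr_grading _ _ gi) xL // linear0.
case: (minimal_graded_left_ideal A_dcc (F := [set ann L | L in
    [set L | orthogonal_family L /\ has_projection L]])).
- exists (ann [::]), [::] => //; split; first by split.
  exists (fun=> 0); split=> [z _|g z _|z i //|y _ z].
  + exact: V0.
  + exact: (gr0 gr_grading).
  + exact: B0l.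
- by move=> _ [L [oL _] <-]; apply: gann.
move=> _ [L [oL pL] <-] minL; exists L; split=> // z Vz Lz.
have [P [PV Pgr PL Py]] := pL.
apply: contrapT => z0.
pose W := [set v | V v /\ orthogonal_to L v].
have WV v : W v -> V v by case.
have WD v w : W v -> W w -> W (v + w).
  move=> [Vv Lv] [Vw Lw]; split; first exact: VD.
  by move=> i s iL hi; rewrite hs_BDr Lv // Lw // addr0.
have Wact v a : W v -> W (act v a).
  move=> [Vv Lv]; split; first exact: hs_actV.
  by move=> i s iL hi; rewrite hs_B_actr Lv // mul0r.
have Wcomp g v : W v -> W (hcomp gr_grading g v).
  move=> [Vv Lv]; split; first exact: V_comp.
  move=> i s iL hi; have [_ gi] := piece_has_deg (oL.1 i iL) hi.
  by rewrite -(B_comp _ _ gi) Lv // linear0.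
have Wnd v : W v -> v <> 0 -> exists2 w, W w & B w v <> 0.
  move=> [Vv Lv] v0; have [w Vw Bw] : exists2 w, V w & B w v <> 0.
    apply: contrapT => nB; apply: v0; apply: (hs_B_nondeg Vv) => w Vw.
    by apply: contrapT => ?; apply: nB; exists w.
  (* Subtracting its projection moves w into W without changing its pairing with v. *)
  exists (w - P w); last by rewrite BBl (Py v Lv) subr0.
  by split; [apply: VB => //; apply: PV|apply: PL].
have [p [pv pW]] := new_piece WV WD Wact Wcomp Wnd (conj Vz Lz) z0.
have pL' s : p_has p s -> orthogonal_to L (p_v p s) by move=> /pW[].
have [oL' prL'] := extend_family oL pL pv pL'.
have annE : ann (p :: L) = ann L.
  apply: minL; first by exists (p :: L).
  by move=> r rL i s iL hi; apply: (rL i.+1).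
have [s [s' [hs0 hs1 Bn]]] : exists s s', [/\ p_has p s, p_has p s' &
    B (p_v p s') (p_v p s) <> 0].
  case: pv => pV [[[h0 h1] Tt B01 Bss _]|[s [[hs0 hsN] fx nsk sx Bs]]].
    by exists true, false; split=> //; rewrite B01; apply: X_neq0.
  exists s, s; split=> //; rewrite Bs => Bs0.
  have Tx := (fixedP _).1 fx; have [gd d0] := diag_value_gr (p_x p s) s.
  by case/(dv_domain (X_gr c Tx) gd): Bs0 => [/(X_neq0 Tx)|].
have [Vs gs] := piece_has_deg pv hs0; have [Vs' gs'] := piece_has_deg pv hs1.
(* The new vectors are orthogonal to L, so r kills every vector of L; but it maps the new vector
   [p_v p s] to a nonzero one, so the annihilator has become smaller. *)
pose r := hs_rank1 hs (p_v p s) (p_v p s').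
have : ann L r.
  move=> i t iL hi; have [Vi gi] := piece_has_deg (oL.1 i iL) hi.
  by rewrite /r hs_rank1E // (B_orth (pL' s' hs1 i t iL hi)) act0r.
rewrite -annE => /(_ 0%N s (ltn0Sn _) hs0); rewrite /= /r hs_rank1E //.
apply: (act_neq0 Vs (hs_B_gr hs gs' gs) Bn) => vs0.
by apply: Bn; rewrite vs0 B0r.
Qed.

End GramSchmidt.

(** * Matrices of endomorphisms *)

(** Transposing the positions and inverting the entries suffices, so D need not be commutative. *)
Lemma monomial_inverse (D : nzRingType) n (Phi : 'M[D]_n) (pi : 'I_n -> 'I_n)
    (y : 'I_n -> D) :
  injective pi -> (forall k l, l != pi k -> Phi k l = 0) ->
  (forall k, Phi k (pi k) * y k = 1 /\ y k * Phi k (pi k) = 1) ->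
  let Psi := \matrix_(l, k) (if l == pi k then y k else 0) in
  Psi *m Phi = 1%:M /\ Phi *m Psi = 1%:M.
Proof.
move=> pi_inj Phi0 Phiy Psi; split; apply/matrixP => i j; rewrite !mxE.
  have [k kP] : exists k, pi k = i.
    by exists (invF pi_inj i); rewrite f_invF.
  rewrite (bigD1 k) //= big1 => [|l lk]; rewrite !mxE -kP.
    rewrite eqxx addr0; case: eqVneq => [<-|kj]; first by case: (Phiy k).
    by rewrite Phi0 ?mulr0 // eq_sym.
  by rewrite (inj_eq pi_inj) eq_sym (negPf lk) mul0r.
rewrite (bigD1 (pi i)) //= big1 => [|l lk]; rewrite !mxE.
  rewrite (inj_eq pi_inj) addr0; case: eqVneq => [<-|ij]; last by rewrite mulr0.
  by case: (Phiy i).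
by rewrite Phi0 ?mul0r.
Qed.

Section MatrixRealization.
Variables (R : realType) (G : groupType).
Hypothesis GC : forall g h : G, (g * h = h * g)%g.
Variables (A : lmodType R) (mul : A -> A -> A) (gr : G -> set A).
Variable (phi : A -> A).
Hypotheses (mul_assoc : assoc_algebra mul) (gr_grading : grading mul gr).
Hypothesis phi_inv : graded_involution mul gr phi.
Variables (d : divdata R G) (hs : hermitian_space mul gr phi d).
Local Notation D := (dv_alg d).
Local Notation Dgr := (@dv_gr R G d).
Local Notation psi := (@dv_inv R G d).
Local Notation gD := (dv_grading d).
Local Notation V := (hs_V hs).
Local Notation act := (hs_act hs).
Local Notation B := (hs_B hs).
Local Notation g0 := (hs_deg hs).

Variables (n : nat) (v : 'I_n -> A) (gam : 'I_n -> G) (Phi : 'M[D]_n).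
Variable pi : 'I_n -> 'I_n.
Hypotheses (vV : forall k, V (v k)) (gv : forall k, gr (gam k) (v k))
  (PhiE : forall k l, Phi k l = B (v k) (v l))
  (v_complete : forall z, V z -> (forall k, B (v k) z = 0) -> z = 0).
Hypotheses (pi_inj : injective pi) (Phi0 : forall k l, l != pi k -> Phi k l = 0)
  (Phi_neq0 : forall k, Phi k (pi k) <> 0).

Lemma graded_inverse : exists Psi : 'M[D]_n,
  [/\ Psi *m Phi = 1%:M, Phi *m Psi = 1%:M &
      forall k j, Dgr (g0 * gam j * gam k)^-1%g (Psi k j)].
Proof.
have /choice[y yP] k : exists y, [/\ Dgr (g0 * gam k * gam (pi k))^-1%g y,
    Phi k (pi k) * y = 1 & y * Phi k (pi k) = 1].
  apply: dv_inverse; last exact: Phi_neq0.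
  by rewrite PhiE; apply: hs_B_gr.
have [|PsiPhi PhiPsi] := @monomial_inverse D n Phi pi y pi_inj Phi0.
  by move=> k; have [_] := yP k.
eexists; split; [exact: PsiPhi|exact: PhiPsi|].
move=> k j; rewrite mxE; case: eqP => [->|_]; last exact: (gr0 gD).
by case: (yP j).
Qed.

Variable Psi : 'M[D]_n.
Hypotheses (PsiPhi : Psi *m Phi = 1%:M) (PhiPsi : Phi *m Psi = 1%:M)
  (gPsi : forall k j, Dgr (g0 * gam j * gam k)^-1%g (Psi k j)).

Lemma mul_act_sum r (I : Type) (s : seq I) (w : I -> A) (a : I -> D) :
  mul r (\sum_(i <- s) act (w i) (a i)) = \sum_(i <- s) act (mul r (w i)) (a i).
Proof.
rewrite (nmul_sumr mul_assoc); apply: eq_bigr => i _; exact: hs_mul_act.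
Qed.

Lemma act_sumr w (I : Type) (s : seq I) (a : I -> D) :
  act w (\sum_(i <- s) a i) = \sum_(i <- s) act w (a i).
Proof.
apply: (big_morph (act w)) => [x y|]; first exact: hs_actDr.
exact: act0r.
Qed.

Lemma V_sum (I : Type) (s : seq I) (w : I -> A) :
  (forall i, V (w i)) -> V (\sum_(i <- s) w i).
Proof.
by move=> Vw; elim/big_ind: _ => [|x y|i _]; [apply: V0|apply: VD|apply: Vw].
Qed.

(** Because Phi Psi = 1, the difference of the two sides pairs to zero with every v_l, and
    completeness makes it vanish. *)
Lemma basis_expansion z : V z ->
  z = \sum_k act (v k) (\sum_j Psi k j * B (v j) z).
Proof.
move=> Vz; apply/eqP; rewrite -subr_eq0; apply/eqP; apply: v_complete.
  by apply: VB => //; apply: V_sum => k; apply: hs_actV.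
move=> l; rewrite BBr B_sumr; apply/eqP; rewrite subr_eq0; apply/eqP.
pose b : 'cV[D]_n := \col_j B (v j) z.
transitivity ((Phi *m (Psi *m b)) l 0).
  by rewrite mulmxA PhiPsi mul1mx mxE.
rewrite mxE; apply: eq_bigr => k _; rewrite hs_B_actr PhiE mxE.
by congr (_ * _); apply: eq_bigr => j _; rewrite mxE.
Qed.

Definition gram_matrix (r : A) : 'M[D]_n := \matrix_(k, l) B (v k) (mul r (v l)).
Lemma gram_matrixE r k l : gram_matrix r k l = B (v k) (mul r (v l)).
Proof. by rewrite mxE. Qed.

(** The Gram matrix of r is Phi times the matrix of left multiplication by r on V, so Psi recovers
    the latter. *)
Definition matrix_of (r : A) : 'M[D]_n := Psi *m gram_matrix r.

Lemma matrix_ofE r l : mul r (v l) = \sum_k act (v k) (matrix_of r k l).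
Proof.
rewrite {1}(basis_expansion (hs_mulV _ (vV l))); apply: eq_bigr => k _.
by rewrite mxE; congr act; apply: eq_bigr => j _; rewrite mxE.
Qed.

Lemma gram_matrixM x y : gram_matrix (mul x y) = gram_matrix x *m matrix_of y.
Proof.
apply/matrixP => k l; rewrite gram_matrixE -(nmulA mul_assoc) matrix_ofE.
rewrite mul_act_sum B_sumr [RHS]mxE; apply: eq_bigr => j _.
by rewrite hs_B_actr gram_matrixE.
Qed.

Lemma matrix_ofM x y : matrix_of (mul x y) = matrix_of x *m matrix_of y.
Proof. by rewrite {1}/matrix_of gram_matrixM mulmxA. Qed.

Lemma matrix_of_lin a x y k l :
  matrix_of (a *: x + y) k l = a *: matrix_of x k l + matrix_of y k l.
Proof.
rewrite !mxE scaler_sumr -big_split; apply: eq_bigr => j _ /=.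
rewrite !mxE (nmulDl mul_assoc) (nscaleAl mul_assoc) hs_BDr hs_BZr.
by rewrite mulrDr scalerAr.
Qed.

(** By adjunction the Gram matrix of phi(r) has the entries B(r v_k, v_l), which expand to psi(M^T)
    Phi with M the matrix of r. *)
Lemma matrix_of_phi r :
  matrix_of (phi r) = Psi *m map_mx psi (matrix_of r)^T *m Phi.
Proof.
rewrite -mulmxA; congr (_ *m _); apply/matrixP => k l; rewrite !mxE.
have [_ _ phiK _] := phi_inv.
rewrite hs_B_adj phiK matrix_ofE B_suml; apply: eq_bigr => j _.
by rewrite hs_B_actl PhiE !mxE.
Qed.

(** If r kills the basis, then B(v_l, phi(r) z) = B(r v_l, z) = 0, so phi(r) kills V by completeness
    and vanishes by faithfulness. *)
Lemma matrix_of_inj : injective matrix_of.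
Proof.
move=> x y xy; apply/eqP; rewrite -subr_eq0; apply/eqP.
have [phiL _ phiK _] := phi_inv.
have phi00 : phi 0 = 0.
  have := phiL 1 0 0; rewrite !scale1r addr0 => e.
  by apply: (addrI (phi 0)); rewrite addr0.
have t0 l : mul (x - y) (v l) = 0.
  rewrite (nmulBl mul_assoc) !matrix_ofE xy.
  by rewrite subrr.
suff pt0 : phi (x - y) = 0 by rewrite -[LHS]phiK pt0.
apply: (hs_faithful (h0 := hs)) => z Vz; apply: v_complete; first exact: hs_mulV.
by move=> l; rewrite hs_B_adj phiK t0 B0l.
Qed.

(** The factor [Psi] turns the functionals B(v_j, -) into coordinate functionals, so this element
    acts on V with matrix M. *)
Definition of_matrix (M : 'M[D]_n) : A :=
  \sum_i \sum_j hs_rank1 hs (act (v i) ((M *m Psi) i j)) (v j).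

Lemma of_matrixK : cancel of_matrix matrix_of.
Proof.
move=> M; suff NE : gram_matrix (of_matrix M) = Phi *m M.
  by rewrite /matrix_of NE mulmxA PsiPhi mul1mx.
apply/matrixP => k l; rewrite !mxE.
transitivity (B (v k) (\sum_i act (v i) (M i l))); last first.
  by rewrite B_sumr; apply: eq_bigr => i _; rewrite hs_B_actr PhiE.
congr (B _ _); rewrite /of_matrix (nmul_suml mul_assoc); apply: eq_bigr => i _.
rewrite (nmul_suml mul_assoc) -{2}[M]mulmx1 -PsiPhi mulmxA mxE act_sumr.
by apply: eq_bigr => j _; rewrite hs_rank1E // PhiE hs_actM.
Qed.

Lemma matrix_of_bij : bijective matrix_of.
Proof.
exists of_matrix => [r|]; last exact: of_matrixK.
by apply: matrix_of_inj; rewrite of_matrixK.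
Qed.

Lemma matrix_of_gr g r k l : gr g r ->
  Dgr ((gam k)^-1 * g * gam l)%g (matrix_of r k l).
Proof.
move=> gr_r; rewrite mxE; apply: (gr_sum gD) => j _; rewrite mxE.
have := grM gD (gPsi k j) (hs_B_gr hs (gv j) (grM gr_grading gr_r (gv l))).
by congr (Dgr _ _); abelian GC.
Qed.

Lemma of_matrix_gr g (M : 'M[D]_n) :
  (forall k l, Dgr ((gam k)^-1 * g * gam l)%g (M k l)) -> gr g (of_matrix M).
Proof.
move=> gM; apply: (gr_sum gr_grading) => i _; apply: (gr_sum gr_grading) => j _.
have gMP : Dgr ((gam i)^-1 * g * (g0 * gam j)^-1)%g ((M *m Psi) i j).
  rewrite mxE; apply: (gr_sum gD) => k _.
  by have := grM gD (gM i k) (gPsi k j); congr (Dgr _ _); abelian GC.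
have := hs_rank1_gr hs (hs_act_gr hs (gv i) gMP) (gv j).
by congr (gr _ _); abelian GC.
Qed.

End MatrixRealization.

(** Serves to list the cosets outside (G/T)_{g_0} next to their duals; each induction step removes
    an element together with its dual. *)
Lemma pair_up (U : eqType) (dual : U -> U) (s : seq U) : uniq s ->
  involutive dual -> (forall x, x \in s -> dual x \in s /\ dual x != x) ->
  exists t r, [/\ perm_eq t s, size t = r.*2 & forall x0 j, (j < r)%N ->
    nth x0 t j.*2.+1 = dual (nth x0 t j.*2)].
Proof.
move=> us dK; move: us; elim: {s}(size s) {-2}s (leqnn (size s)) => [|n IHn] s.
  by rewrite leqn0 => /nilP -> _ _; exists [::], 0%N.
case: s => [|x s] sz us ds; first by exists [::], 0%N.
have [dxs dxn] := ds x (mem_head x s).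
have {}dxs : dual x \in s by move: dxs; rewrite inE (negPf dxn).
move: us => /= /andP[xs us].
have [|||t [r [tP szt tE]]] := IHn (rem (dual x) s).
- by rewrite size_rem // (leq_trans (leq_pred _)).
- exact: rem_uniq.
- move=> y; rewrite mem_rem_uniq // inE => /andP[/= ydx ys].
  have [dys dyn] := ds y (mem_behead (s := x :: s) ys); split=> //.
  rewrite mem_rem_uniq // inE /= (inj_eq (can_inj dK)).
  apply/andP; split; first by apply: contraNneq xs => <-.
  move: dys; rewrite inE => /orP[/eqP dyx|//].
  by move: ydx; rewrite -dyx dK eqxx.
exists [:: x, dual x & t], r.+1; split.
- rewrite perm_cons perm_sym (permPl (perm_to_rem dxs)) perm_cons perm_sym.
  exact: tP.
- by rewrite /= szt.
- by move=> x0 [|j] //= jr; apply: tE.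
Qed.

(** * Multiplicities, signatures and block decompositions *)

Section Blocks.
Variables (R : realType) (G : groupType).
Hypothesis GC : forall g h : G, (g * h = h * g)%g.
Variables (A : lmodType R) (mul : A -> A -> A) (gr : G -> set A).
Variable (phi : A -> A).
Hypotheses (mul_assoc : assoc_algebra mul) (gr_grading : grading mul gr).
Hypothesis phi_inv : graded_involution mul gr phi.
Variables (d : divdata R G) (hs : hermitian_space mul gr phi d) (c : choices d).
Local Notation D := (dv_alg d).
Local Notation T := (dv_supp d).
Local Notation Dgr := (@dv_gr R G d).
Local Notation delta := (dv_delta d).
Local Notation kind := (dv_kind d).
Local Notation X := (ch_X c).
Local Notation xi := (ch_xi c).
Local Notation eta := (@Defs.eta R G d c).
Local Notation V := (hs_V hs).
Local Notation B := (hs_B hs).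
Local Notation g0 := (hs_deg hs).
Local Notation fixed := (fixed_cosets (d := d) g0).
Local Notation tau := (tau c g0).
Local Notation sigd := (has_signature c g0).
Local Notation skew_coset := (skew_coset hs c).
Local Notation valid := (valid hs c).
Local Notation "L `@ i" := (nth (piece0 A d) L i) (at level 3).

(** Vectors over x and y can pair nontrivially only if the degree of their pairing lies in T; for
    given x this leaves the single coset g_0^-1 x^-1. *)
Definition paired x y : Prop := T (g0 * xi x * xi y)%g.

Lemma paired_sym x y : paired x y -> paired y x.
Proof.
rewrite /paired => xy; suff -> : (g0 * xi y * xi x = g0 * xi x * xi y)%g by [].
by abelian GC.
Qed.

Lemma paired_uniq x y z : paired x y -> paired x z -> y = z.
Proof.
move=> xy xz; rewrite -(ch_xiK c y) -(ch_xiK c z); apply/(quot_piP GC).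
have -> : ((xi y)^-1 * xi z = g0 * xi x * xi z * (g0 * xi x * xi y)^-1)%g.
  by abelian GC.
by apply: dv_suppM => //; apply: dv_suppV.
Qed.

Lemma pairedP x y : paired x y <-> quot_pi T (xi x * xi y)%g = quot_pi T g0^-1%g.
Proof.
split=> [xy|/esym/(quot_piP GC)]; last first.
  by congr T; rewrite invgK mulgA.
by apply/esym/(quot_piP GC); rewrite invgK mulgA.
Qed.

Lemma paired_fixed x : fixed x <-> paired x x.
Proof. by rewrite (fixedP GC hs c) /paired /Defs.tau mulgA. Qed.

Lemma paired_exists g : exists x, paired (quot_pi T g) x /\
  x = quot_pi T (g0^-1 * g^-1)%g.
Proof.
eexists; split; last reflexivity.
have /(quot_piP GC) e1 := esym (ch_xiK c (quot_pi T g)).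
have /(quot_piP GC) e2 := esym (ch_xiK c (quot_pi T (g0^-1 * g^-1)%g)).
rewrite /paired; set y := xi (quot_pi T g) in e1 *.
set z := xi (quot_pi T (g0^-1 * g^-1)%g) in e2 *.
have -> : (g0 * y * z = (g^-1 * y) * ((g0^-1 * g^-1)^-1 * z))%g by abelian GC.
exact: dv_suppM.
Qed.

Lemma pair_has p : valid p -> p_has p false -> p_has p true -> pair_valid hs c p.
Proof.
case=> _ [//|[s [[hs0 hsN] _ _ _ _]]] h0 h1.
by move: hsN; case: (s); rewrite /= ?h0 ?h1.
Qed.

Lemma single_has p s : valid p -> p_has p s -> ~~ p_has p (~~ s) ->
  [/\ fixed (p_x p s), ~ skew_coset (p_x p s), s -> sigd (p_x p s) &
  B (p_v p s) (p_v p s) = X (tau (p_x p s)) * diag_value hs c (p_x p s) s].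
Proof.
case=> _ [[[h0 h1] _ _ _ _]|[s' [[hs0 hsN] fx nsk sx Bs]]] hs1 hsN'.
  by move: hsN'; case: (s); rewrite /= ?h0 ?h1.
suff -> : s = s' by [].
by move: hs1 hsN; case: (s) (s') => [] [] //= ->.
Qed.

Lemma pair_paired p : pair_valid hs c p -> forall s, paired (p_x p s) (p_x p (~~ s)).
Proof. by case=> _ Tp _ _ _ [] //=; apply: paired_sym. Qed.

Lemma pair_fixed p s : pair_valid hs c p -> fixed (p_x p s) ->
  (forall t, p_x p t = p_x p s) /\ skew_coset (p_x p s).
Proof.
move=> pv /paired_fixed px; have xE : p_x p (~~ s) = p_x p s.
  by apply: (paired_uniq _ px); apply: pair_paired.
have allE t : p_x p t = p_x p s by move: xE; case: (s) (t) => [] [].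
split=> //; case: pv => _ _ _ _; rewrite !allE; exact.
Qed.

(** * Enumeration of the basis vectors over each coset *)

Section Family.
Variable L : seq (piece A d).
Hypothesis oL : orthogonal_family hs c L.

Definition side (s : bool) (x : quot T) : seq nat :=
  [seq i <- iota 0 (size L) | p_has L`@i s && (p_x L`@i s == x)].

Definition kappa_of (x : quot T) : nat :=
  (size (side false x) + size (side true x))%N.

(** Listing the [false] side first makes the Gram matrix come out as diag(I_p, -I_q) or as the
    standard symplectic matrix without further permutation. *)
Definition entry (x : quot T) (a : nat) : nat * bool :=
  let k := size (side false x) in
  if (a < k)%N then (nth 0%N (side false x) a, false)
  else (nth 0%N (side true x) (a - k), true).

Definition vec (x : quot T) (a : nat) : A :=
  p_v L`@((entry x a).1) (entry x a).2.

Lemma mem_side s x i : (i \in side s x) =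
  [&& (i < size L)%N, p_has L`@i s & p_x L`@i s == x].
Proof. by rewrite mem_filter mem_iota /= add0n andbC. Qed.

Lemma side_uniq s x : uniq (side s x).
Proof. exact/filter_uniq/iota_uniq. Qed.

Lemma entryP x a : (a < kappa_of x)%N ->
  [/\ ((entry x a).1 < size L)%N, p_has L`@((entry x a).1) (entry x a).2 &
      p_x L`@((entry x a).1) (entry x a).2 = x].
Proof.
rewrite /kappa_of /entry; case: (ltnP a (size _)) => [lt _|ge lt] /=.
  by have := mem_nth 0%N lt; rewrite mem_side => /and3P[? ? /eqP].
have lt' : (a - size (side false x) < size (side true x))%N by rewrite ltn_subLR.
by have := mem_nth 0%N lt'; rewrite mem_side => /and3P[? ? /eqP].
Qed.

Lemma entry_side x a : (entry x a).2 = (size (side false x) <= a)%N.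
Proof. by rewrite /entry; case: ltnP. Qed.

Lemma entry_inj x y a b : (a < kappa_of x)%N -> (b < kappa_of y)%N ->
  entry x a = entry y b -> x = y /\ a = b.
Proof.
move=> ltx lty exy; have [_ _ xE] := entryP ltx; have [_ _ yE] := entryP lty.
have xy : x = y by rewrite -xE exy yE.
split=> //; rewrite -{}xy in lty exy *; have := congr1 (fun e => e.2) exy.
rewrite !entry_side; move: exy; rewrite /entry; move: ltx lty; rewrite /kappa_of.
set k := size (side false x).
case: (ltnP a k) => [lak|gak] ltx; case: (ltnP b k) => [lbk|gbk] lty // [] + _.
  by move/eqP; rewrite nth_uniq ?side_uniq // => /eqP.
move/eqP; rewrite nth_uniq ?side_uniq ?ltn_subLR // => /eqP ab.
by rewrite -(subnK gak) ab subnK.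
Qed.

Lemma entry_surj i s : (i < size L)%N -> p_has L`@i s ->
  exists2 a, (a < kappa_of (p_x L`@i s))%N & entry (p_x L`@i s) a = (i, s).
Proof.
move=> iL; case: s => hi; set x := p_x _ _.
  have ix : i \in side true x by rewrite mem_side iL hi eqxx.
  exists (size (side false x) + index i (side true x))%N.
    by rewrite /kappa_of ltn_add2l index_mem.
  by rewrite /entry ltnNge leq_addr /= addKn nth_index.
have ix : i \in side false x by rewrite mem_side iL hi eqxx.
exists (index i (side false x)).
  by rewrite /kappa_of ltn_addr // index_mem.
by rewrite /entry index_mem ix nth_index.
Qed.

Lemma vec_V x a : (a < kappa_of x)%N -> V (vec x a) /\ gr (xi x) (vec x a).
Proof.
move=> ltx; have [iL hi xE] := entryP ltx.
by have := piece_has_deg (oL.1 _ iL) hi; rewrite xE.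
Qed.

Lemma vec_unpaired x y a b : (a < kappa_of x)%N -> (b < kappa_of y)%N ->
  ~ paired x y -> B (vec x a) (vec y b) = 0.
Proof.
move=> ltx lty nxy; have [_ gx] := vec_V ltx; have [_ gy] := vec_V lty.
exact: (dv_gr_neq0 (hs_B_gr hs gx gy)).
Qed.

Lemma fixed_entry x a : fixed x -> (a < kappa_of x)%N ->
  let: (i, s) := entry x a in
  if p_has L`@i (~~ s) then
    [/\ pair_valid hs c L`@i, forall t, p_x L`@i t = x & skew_coset x]
  else [/\ ~ skew_coset x, s -> sigd x &
    B (vec x a) (vec x a) = X (tau x) * diag_value hs c x s].
Proof.
move=> fx ltx; have [] := entryP ltx; rewrite /vec.
case: (entry x a) => i s /= iL hi xE; have pv := oL.1 i iL.
case: ifP => hN; last first.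
  by have [] := single_has pv hi (negbT hN); rewrite xE.
have pp : pair_valid hs c L`@i.
  by apply: pair_has => //; move: hi hN; case: (s).
by have [] := pair_fixed (s := s) pp; rewrite xE.
Qed.

Lemma nskew_gram x a b : fixed x -> ~ skew_coset x -> (a < kappa_of x)%N ->
  (b < kappa_of x)%N -> B (vec x a) (vec x b) =
  if a == b then X (tau x) * diag_value hs c x (size (side false x) <= a)%N else 0.
Proof.
move=> fx nsk lta ltb; have := fixed_entry fx lta.
have [iL hi _] := entryP lta; have [jL hj _] := entryP ltb.
have := entry_side x a.
case E : (entry x a) iL hi => [i s] /= iL hi <-.
case: ifP => [_ [_ _ /nsk//]|hN [_ _ BE]].
case: eqVneq => [<-|/eqP ab]; first exact: BE.
rewrite /vec E; apply: oL.2 => // ij.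
move: hj; rewrite -ij => hj; apply: ab.
suff : entry x a = entry x b by case/entry_inj.
rewrite E [RHS]surjective_pairing -ij; congr (_, _).
by move: hi hN hj; case: (s); case: (_.2) => //= _ -> .
Qed.

(** Over a skew coset every piece is a pair with both vectors there. The two sides are thus the same
    list of indices, and partners are one side length apart. *)
Lemma skew_gram x a b : fixed x -> skew_coset x -> (a < kappa_of x)%N ->
  (b < kappa_of x)%N -> size (side false x) = size (side true x) /\
  B (vec x a) (vec x b) =
    if (b == a + size (side false x))%N then X (tau x)
    else if (a == b + size (side false x))%N then - X (tau x) else 0.
Proof.
move=> fx sk lta ltb.
have sides : side false x = side true x.
  apply: eq_in_filter => i; rewrite mem_iota /= add0n => iL; have pv := oL.1 i iL.
  have paired_has s : p_has L`@i s -> p_x L`@i s = x ->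
      p_has L`@i (~~ s) && (p_x L`@i (~~ s) == x).
    move=> hi xE; have [hN|hN] := boolP (p_has L`@i (~~ s)); last first.
      by have [_ + _ _] := single_has pv hi hN; rewrite xE.
    have pp : pair_valid hs c L`@i.
      by apply: pair_has => //; move: hi hN; case: (s).
    by have [] := pair_fixed (s := s) pp; rewrite xE // => ->; rewrite eqxx.
  apply/andP/andP => -[hi /eqP xE].
    by have /andP[] := paired_has _ hi xE.
  by have /andP[] := paired_has _ hi xE.
have sz : size (side false x) = size (side true x) by rewrite sides.
split=> //; set k := size (side false x).
have := fixed_entry fx lta.
have [iL hi _] := entryP lta; have [jL hj _] := entryP ltb.
rewrite /vec; case E : (entry x a) iL hi => [i s] /= iL hi.
case E' : (entry x b) jL hj => [j t] /= jL hj.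
case: ifP => [hN [pp xE _]|_ [/(_ sk)//]].
have [_ _ B01 Bss _] := pp.
have dE : pair_deg hs c L`@i = tau x.
  by rewrite /pair_deg !xE /Defs.tau mulgA.
rewrite dE in B01.
have B10 : B (p_v L`@i true) (p_v L`@i false) = - X (tau x).
  have Tx : T (tau x) by apply/(fixedP GC hs c).
  rewrite B_swap B01 psi_X // scalerA.
  have -> : eta (tau x) = - delta.
    apply: eta_delta => et; case: sk => _ nsx nH nC.
    case kC : (kindC kind); first by move: nC; rewrite kC et eqxx.
    by apply: nsx; split=> //; rewrite kC.
  by rewrite mulrN delta_sqr scaleN1r.
have [ij|/eqP ij] := eqVneq i j; last first.
  rewrite (oL.2 i j s t) //; case: eqP => [bE|_].
    exfalso; apply: ij; move: E E'; rewrite /entry bE -/k -sides.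
    have lak : (a < k)%N.
      by move: ltb; rewrite bE /kappa_of -sz -/k ltn_add2r.
    by rewrite lak ltnNge leq_addl /= addnK => -[<- _] [<- _].
  case: eqP => // aE.
  exfalso; apply: ij; move: E E'; rewrite /entry aE -/k -sides.
  have lbk : (b < k)%N.
    by move: lta; rewrite aE /kappa_of -sz -/k ltn_add2r.
  by rewrite lbk ltnNge leq_addl /= addnK => -[<- _] [<- _].
rewrite -{j jL}ij in E' hj *.
have [st|st] := eqVneq s t.
  rewrite -st Bss; have ab : a = b.
    by have [] : x = x /\ a = b by apply: entry_inj => //; rewrite E E' st.
  have k0 : (0 < k)%N.
    have : (0 < kappa_of x)%N by apply: leq_ltn_trans lta.
    by rewrite /kappa_of -sz -/k; case: k.
  have bk : (b == b + k)%N = false.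
    by rewrite -[X in X == _]addn0 eqn_add2l eq_sym; apply/negbTE; rewrite -lt0n.
  by rewrite ab bk.
have := entry_side x a; have := entry_side x b; rewrite E E' /= -/k.
have szk : size (side true x) = k by rewrite -sz.
case: (s) (t) st E E' => [] [] //= _; rewrite /entry -/k -sides.
  case: (ltnP a k) => // ka; case: (ltnP b k) => // kb [iE] [/esym iE'] _ _.
  have /eqP := etrans iE iE'; rewrite nth_uniq ?side_uniq //; last first.
    by move: lta ltb; rewrite ltn_subLR // /kappa_of szk.
  move=> /eqP <-; rewrite subnK // eqxx B10 ltn_eqF //.
  by apply: leq_ltn_trans (leq_subr k a) _; rewrite -[X in (X < _)%N]addn0
    ltn_add2l (leq_ltn_trans _ kb).
case: (ltnP a k) => // ka; case: (ltnP b k) => // kb [iE] [/esym iE'] _ _.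
have /eqP := etrans iE iE'; rewrite nth_uniq ?side_uniq //; last first.
  by move: lta ltb; rewrite ltn_subLR // /kappa_of szk.
by move=> /eqP ->; rewrite subnK // eqxx B01.
Qed.

(** As x is not fixed, a piece with a vector over x is a pair, and its other vector lies over the
    only coset paired with x. *)
Lemma side_paired s x y : paired x y -> x <> y -> side s x = side (~~ s) y.
Proof.
have aux t u v i : paired u v -> u <> v -> (i < size L)%N -> p_has L`@i t ->
    p_x L`@i t = u -> p_has L`@i (~~ t) && (p_x L`@i (~~ t) == v).
  move=> uv nuv iL hi uE; have pv := oL.1 i iL.
  have [hN|hN] := boolP (p_has L`@i (~~ t)); last first.
    have [/paired_fixed + _ _ _] := single_has pv hi hN; rewrite uE => uu.
    by case: nuv; apply: paired_uniq uv.
  have pp : pair_valid hs c L`@i.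
    by apply: pair_has => //; move: hi hN; case: (t).
  have := pair_paired pp t; rewrite uE => /(paired_uniq uv) ->.
  by rewrite eqxx.
move=> xy nxy; apply: eq_in_filter => i; rewrite mem_iota /= add0n => iL.
apply/andP/andP => -[hi /eqP xE].
  by have /andP[] := aux s x y i xy nxy iL hi xE.
have /andP[] := aux (~~ s) y x i (paired_sym xy) (nesym nxy) iL hi xE.
by rewrite negbK.
Qed.

Lemma kappa_paired x y : paired x y -> kappa_of x = kappa_of y.
Proof.
move=> xy; have [->//|/eqP nxy] := eqVneq x y.
by rewrite /kappa_of !(side_paired _ xy nxy) addnC.
Qed.

Lemma kappa_skew x : fixed x -> skew_coset x ->
  kappa_of x = (size (side false x)).*2.
Proof.
move=> fx sk; case: (posnP (kappa_of x)) => [k0|kgt].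
  by move: k0; rewrite /kappa_of; case: (size (side false x)).
have [sz _] := skew_gram fx sk kgt kgt.
by rewrite /kappa_of -sz addnn.
Qed.

(** Ensures that the block above the diagonal is X_t I rather than its multiple by delta eta(t); o
    marks the coset listed second in its pair. *)
Definition oriented (o : quot T -> bool) : Prop := forall i, (i < size L)%N ->
  p_has L`@i false -> p_has L`@i true -> p_x L`@i false <> p_x L`@i true ->
  ~~ o (p_x L`@i false) /\ o (p_x L`@i true).

Lemma oriented_side o x y : oriented o -> paired x y -> x <> y -> ~~ o x ->
  side true x = [::].
Proof.
move=> oo xy nxy ox; apply/eqP; rewrite -[_ == _]negbK; apply/negP => nil.
have /hasP[i ix _] : has predT (side true x) by rewrite has_predT lt0n size_eq0.
have := ix; rewrite (side_paired true xy nxy) /= mem_side => /and3P[_ h0 /eqP xE].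
move: ix; rewrite mem_side => /and3P[iL h1 /eqP yE].
have [] := oo i iL h0 h1; first by rewrite xE yE => /nesym.
by rewrite yE (negPf ox).
Qed.

Lemma oriented_gram o x y a b : oriented o -> paired x y -> x <> y -> ~~ o x ->
  (a < kappa_of x)%N -> (b < kappa_of y)%N ->
  B (vec x a) (vec y b) = if a == b then X (g0 * xi x * xi y)%g else 0.
Proof.
move=> oo xy nxy ox lta ltb; have s0 := oriented_side oo xy nxy ox.
have s1 := side_paired false xy nxy; have s2 := side_paired true xy nxy.
rewrite /= s0 in s1 s2.
move: lta ltb; rewrite /kappa_of -s2 s0 -s1 /= addn0 add0n => lta ltb.
rewrite /vec /entry -s2 -s1 lta /= subn0.
have := mem_nth 0%N lta; have := mem_nth 0%N ltb.
set i := nth 0%N _ a; set j := nth 0%N _ b.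
move=> jx ix; have := ix; rewrite mem_side => /and3P[iL h0 /eqP x0].
move: jx; rewrite s1 /= mem_side => /and3P[jL j1 /eqP y1].
have := ix; rewrite s1 /= mem_side => /and3P[_ h1 /eqP y0].
have [ab|/eqP ab] := eqVneq a b; last first.
  apply: oL.2 => // ij; apply: ab; apply/eqP.
  by rewrite -(nth_uniq 0%N lta ltb) ?side_uniq //; apply/eqP.
have [_ _ B01 _ _] := pair_has (oL.1 i iL) h0 h1.
have -> : j = i by rewrite /i /j ab.
by rewrite B01 /pair_deg x0 y0.
Qed.

End Family.

(* If B(v, w) = X_t then B(w, v) = delta eta(t) X_t, so the pair (v, w) may be
   replaced by (w, delta eta(t) v). *)
Definition swap_piece (p : piece A d) : piece A d :=
  Piece (fun s => p_x p (~~ s))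
    (fun s => if s then (delta * eta (pair_deg hs c p)) *: p_v p false
              else p_v p true)
    (fun s => p_has p (~~ s)).

Definition orient (o : quot T -> bool) (p : piece A d) : piece A d :=
  if [&& p_has p false, p_has p true, p_x p false != p_x p true &
      o (p_x p false)] then swap_piece p else p.

Lemma swap_deg p : pair_deg hs c (swap_piece p) = pair_deg hs c p.
Proof. by rewrite /pair_deg /=; abelian GC. Qed.

Lemma swap_valid p : valid p -> p_has p false -> p_has p true ->
  valid (swap_piece p).
Proof.
move=> pv h0 h1; have [_ Tp B01 Bss xsk] := pair_has pv h0 h1; split.
  move=> s _; have [V0' g0'] := piece_has_deg pv h0.
  have [V1' g1'] := piece_has_deg pv h1.
  by case: s; split=> //=; [apply: VZ|apply: (grZ gr_grading)].
left; split=> //; rewrite ?swap_deg //.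
- rewrite /= hs_BZr B_swap B01 psi_X // !scalerA.
  rewrite [X in X *: _](_ : _ = (delta * delta) *
    (eta (pair_deg hs c p) * eta (pair_deg hs c p))); last by ring.
  by rewrite delta_sqr eta_sqr mulr1 scale1r.
- by case; rewrite /= ?hs_BZl ?hs_BZr Bss ?scaler0.
- by move=> /= xE; rewrite xE; apply: xsk; rewrite xE.
Qed.

(** * Reorienting hyperbolic pairs *)

Section Orient.
Variables (L : seq (piece A d)) (o : quot T -> bool).
Hypothesis oL : orthogonal_family hs c L.
Let L' := [seq orient o p | p <- L].

Lemma nth_orient i : (i < size L)%N -> L'`@i = orient o L`@i.
Proof. by move=> iL; apply: nth_map. Qed.

Lemma orient_cases p : orient o p = p \/
  [/\ orient o p = swap_piece p, p_has p false, p_has p true &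
      p_x p false <> p_x p true /\ o (p_x p false)].
Proof.
rewrite /orient; case: ifP => [/and4P[h0 h1 /eqP nx ox]|]; last by left.
by right.
Qed.

Lemma orient_has p s : p_has (orient o p) s = p_has p s.
Proof. by have [->//|[-> h0 h1 _]] := orient_cases p; case: s; rewrite /= ?h0 ?h1. Qed.

Lemma orient_vec p s : exists t (k : R),
  [/\ p_has p s -> p_has p t, p_v (orient o p) s = k *: p_v p t &
   p_x (orient o p) s = p_x p t].
Proof.
have [->|[-> h0 h1 _]] := orient_cases p.
  by exists s, 1; rewrite scale1r.
exists (~~ s); case: s => /=; last by exists 1; rewrite scale1r.
by eexists; split=> //.
Qed.

Lemma orient_vec_inv p s : exists t (k : R),
  [/\ p_has p s -> p_has p t & p_v p s = k *: p_v (orient o p) t].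
Proof.
have [->|[-> h0 h1 _]] := orient_cases p.
  by exists s, 1; rewrite scale1r.
exists (~~ s); case: s => /=; first by exists 1; rewrite scale1r.
exists (delta * eta (pair_deg hs c p)); split=> //; rewrite scalerA.
rewrite [X in X *: _](_ : _ = (delta * delta) *
  (eta (pair_deg hs c p) * eta (pair_deg hs c p))); last by ring.
by rewrite delta_sqr eta_sqr mulr1 scale1r.
Qed.

Lemma orient_orthogonal : orthogonal_family hs c L'.
Proof.
split=> [i|i j s s']; rewrite !size_map => iL.
  rewrite nth_orient //; have pv := oL.1 i iL.
  by have [->//|[-> h0 h1 _]] := orient_cases L`@i; apply: swap_valid.
move=> jL ij; rewrite !nth_orient // !orient_has => hi hj.
have [t [k [/(_ hi) ht -> _]]] := orient_vec L`@i s.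
have [t' [k' [/(_ hj) ht' -> _]]] := orient_vec L`@j s'.
by rewrite hs_BZl hs_BZr (oL.2 i j t t') // !scaler0.
Qed.

Lemma orient_complete : complete_family hs L -> complete_family hs L'.
Proof.
move=> cL z Vz Lz; apply: cL => // i s iL hi.
have [t [k [/(_ hi) ht ->]]] := orient_vec_inv L`@i s.
rewrite hs_BZl; have := Lz i t; rewrite size_map nth_orient // orient_has.
by move=> -> //; rewrite scaler0.
Qed.

Lemma side_size (M : seq (piece A d)) s x : size (side M s x) =
  (\sum_(i <- iota 0 (size M)) (p_has M`@i s && (p_x M`@i s == x)))%N.
Proof.
by rewrite size_filter -sum1_count big_mkcond /=; apply: eq_bigr => i _; case: ifP.
Qed.

Lemma kappa_orient x : kappa_of L' x = kappa_of L x.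
Proof.
rewrite /kappa_of !side_size -!big_split size_map; apply: eq_big_seq => i.
rewrite mem_iota /= add0n => iL; rewrite nth_orient //.
have [->//|[-> h0 h1 _]] := orient_cases L`@i.
by rewrite /= addnC.
Qed.

(** A swapped piece joins two distinct cosets, neither of them fixed; so the sides over fixed
    cosets, and with them sigma, do not depend on the orientation. *)
Lemma side_orient s x : fixed x -> size (side L' s x) = size (side L s x).
Proof.
move=> fx; rewrite !side_size size_map; apply: eq_big_seq => i.
rewrite mem_iota /= add0n => iL; rewrite nth_orient //.
have [->//|[-> h0 h1 [nx _]]] := orient_cases L`@i.
have nfx t : p_x L`@i t <> x.
  move=> xE; have pp := pair_has (oL.1 i iL) h0 h1; apply: nx.
  by have [] := pair_fixed (s := t) pp; rewrite xE // => e _; rewrite !e.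
by rewrite /= !(introF eqP (nfx _)) !andbF.
Qed.

Lemma orient_oriented : (forall i, (i < size L)%N -> p_has L`@i false ->
    p_has L`@i true -> p_x L`@i false <> p_x L`@i true ->
    o (p_x L`@i true) = ~~ o (p_x L`@i false)) -> oriented L' o.
Proof.
move=> oP i; rewrite size_map => iL; rewrite nth_orient // !orient_has => h0 h1.
rewrite /orient h0 h1; case: eqP => [->|nx]; first by case: (o _).
case: ifP => /= ox _; first by rewrite oP // ox.
by rewrite oP // ox.
Qed.

End Orient.

Definition sigma_of (L : seq (piece A d)) (x : quot T) : int :=
  if `[< sigd x >] then (size (side L false x))%:Z - (size (side L true x))%:Z
  else 0.

Lemma blk_p_of (L : seq (piece A d)) x : sigd x ->
  blk_p (kappa_of L) (sigma_of L) x = size (side L false x).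
Proof.
move=> sx; rewrite /blk_p /sigma_of asboolT // /kappa_of PoszD.
by rewrite addrACA subrr addr0 -PoszD addnn doubleK.
Qed.

Lemma signature_of L : orthogonal_family hs c L ->
  signature_function c g0 (kappa_of L) (sigma_of L).
Proof.
move=> oL x; split.
- rewrite /sigma_of /kappa_of; case: ifP => // _.
  rewrite -lez_nat abszE; apply: le_trans (ler_normB _ _) _.
  by rewrite !ger0_norm // PoszD.
- move=> sx; rewrite /sigma_of asboolT // /kappa_of; apply/eqP.
  rewrite eqz_mod_dvd PoszD opprD addrACA subrr add0r -opprD -PoszD addnn.
  by rewrite dvdzE abszN /= -mul2n dvdn_mulr.
- by move=> nsx; rewrite /sigma_of asboolF.
Qed.

(** The parity conditions concern exactly the skew cosets, over which kappa is twice the length of a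
    side. *)
Lemma multiplicity_of L : orthogonal_family hs c L ->
  multiplicity_function c g0 (kappa_of L).
Proof.
move=> oL; split.
- apply: (@sub_finite_set _ _ [set` [seq p_x L`@i false | i <- iota 0 (size L)] ++
    [seq p_x L`@i true | i <- iota 0 (size L)]]); last exact: finite_seq.
  move=> x /= /eqP; rewrite /kappa_of addn_eq0 negb_and mem_cat.
  have aux s : size (side L s x) != 0%N ->
      x \in [seq p_x L`@i s | i <- iota 0 (size L)].
    rewrite -lt0n -has_predT => /hasP[i + _]; rewrite mem_side.
    case/and3P=> iL _ /eqP <-; apply/mapP; exists i => //.
    by rewrite mem_iota.
  by case/orP=> /aux ->; rewrite ?orbT.
- move=> g; have [y [gy <-]] := paired_exists g.
  exact/esym/(kappa_paired oL gy).
- move=> kR x fx et; rewrite kappa_skew ?odd_double //; split=> //.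
  + by move=> [_]; rewrite (_ : kindC kind = false) ?(negbTE (introN eqP (eta_ndelta et)))
      => [/(eta_ndelta et)|] //; case: kind kR.
  + by case: kind kR.
  + by case: kind kR.
- move=> kC x fx nK et; rewrite kappa_skew ?odd_double //; split=> //.
  + by rewrite /Defs.has_signature kC => -[].
  + by case: kind kC.
  + by rewrite kC; apply/eqP/eta_ndelta.
Qed.

(** * The Gram matrix for a given ordering of the support *)

Section Ordering.
Variables (L : seq (piece A d)) (xs : seq (quot T)) (m : nat).
Hypotheses (oL : orthogonal_family hs c L) (cL : complete_family hs L).
Hypothesis xsP : support_ordering c g0 (kappa_of L) xs m.
Local Notation x_ i := (blk_x xs i).

Lemma ordering_inj i j : (i < size xs)%N -> (j < size xs)%N -> x_ i = x_ j -> i = j.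
Proof.
by case: xsP => us _ _ _ iL jL /eqP; rewrite nth_uniq // => /eqP.
Qed.

Lemma ordering_fixed i : (i < m)%N -> fixed (x_ i).
Proof. by case: xsP => _ _ + _; apply. Qed.

Lemma ordering_pair i : (i < size xs)%N -> (m <= i)%N -> ~~ odd (i - m) ->
  (i.+1 < size xs)%N /\ paired (x_ i) (x_ i.+1).
Proof.
case: xsP => _ _ _ [r sz rP] iL mi ev.
have [j iE] : exists j, i = (m + j.*2)%N.
  by exists (i - m)./2; rewrite halfK (negPf ev) subn0 subnKC.
have jr : (j < r)%N by rewrite -ltn_double -(ltn_add2l m) -iE -sz.
rewrite iE; split; last exact/pairedP/rP.
rewrite sz -addnS ltn_add2l -[X in (X <= _)%N]/(j.+1.*2).
by rewrite leq_double.
Qed.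

Lemma ordering_pred i : (m <= i)%N -> odd (i - m) ->
  exists j, [/\ i = j.+1, (m <= j)%N & ~~ odd (j - m)].
Proof.
case: i => [|j]; first by rewrite sub0n.
rewrite leq_eqVlt ltnS => /orP[/eqP ->|mj]; first by rewrite subnn.
by rewrite subSn //= => ev; exists j.
Qed.

(** Marks the second coset of each pair; truncated subtraction leaves the first m positions
    unmarked. *)
Let o x := odd (index x xs - m).
Let L' := [seq orient o p | p <- L].

Lemma ordering_o i : (i < size xs)%N -> o (x_ i) = odd (i - m).
Proof. by case: xsP => us _ _ _ iL; rewrite /o index_uniq. Qed.

Let oL' : orthogonal_family hs c L' := orient_orthogonal o oL.
Let kL' x : kappa_of L' x = kappa_of L x := kappa_orient L o x.

Lemma S_fixedE x (a b : 'I_(kappa_of L x)) : fixed x ->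
  X (tau x) * S_fixed c g0 (kappa_of L) (sigma_of L) x a b = B (vec L' x a) (vec L' x b).
Proof.
move=> fx; have lta : (a < kappa_of L' x)%N by rewrite kL'.
have ltb : (b < kappa_of L' x)%N by rewrite kL'.
have [sk|nsk] := pselect (skew_coset x).
  have [_ ->] := skew_gram oL' fx sk lta ltb.
  have half : (kappa_of L x)./2 = size (side L' false x).
    by rewrite -kL' (kappa_skew oL' fx sk) doubleK.
  case: (sk) => _ nsx nH nC.
  rewrite /S_fixed asboolF // (negPf nH) (negPf nC) mxE half.
  by case: ifP => _; [rewrite mulr1|case: ifP; rewrite ?mulrN1 ?mulr0].
rewrite (nskew_gram oL' fx nsk lta ltb) /S_fixed /diag_value.
have szF := side_orient o oL false fx.
case: asboolP => [sx|nsx].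
  rewrite mxE mxE blk_p_of // szF -(inj_eq val_inj) /=.
  case: (a == b :> nat); rewrite ?mulr1n ?mulr0n ?mulr0 //.
  by rewrite ltnNge; case: (_ <= _)%N.
have [kH|nH] := ifP.
  by rewrite mxE -(inj_eq val_inj); case: (_ == _); rewrite ?mulr1n ?mulr0n ?mulr0.
have -> : kindC kind && (eta (tau x) == delta).
  apply/negPn/negP => nC; apply: nsk; split=> //; last by rewrite nH.
by rewrite mxE -(inj_eq val_inj); case: (_ == _); rewrite ?mulr1n ?mulr0n ?mulr0.
Qed.

Lemma kappa_mem x : (x \in xs) = (kappa_of L x != 0)%N.
Proof. by case: xsP. Qed.

Lemma side_mem s x i : i \in side L s x -> x \in xs.
Proof.
rewrite kappa_mem -lt0n /kappa_of => ix.
have : (0 < size (side L s x))%N by case: (side L s x) ix.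
by case: s ix => _ lt; rewrite addn_gt0 lt ?orbT.
Qed.

Lemma ordering_oriented : oriented L' o.
Proof.
apply: orient_oriented => i iL h0 h1 nx.
have pp := pair_has (oL.1 i iL) h0 h1.
have xmem s : p_x L`@i s \in xs.
  have hs' : p_has L`@i s by case: s.
  by apply: (@side_mem s _ i); rewrite mem_side iL hs' eqxx.
have p01 : paired (p_x L`@i false) (p_x L`@i true) := pair_paired pp false.
have [j jL xj] : exists2 j, (j < size xs)%N & p_x L`@i false = x_ j.
  exists (index (p_x L`@i false) xs); first by rewrite index_mem.
  by rewrite /blk_x nth_index.
rewrite xj in p01 nx *.
have mj : (m <= j)%N.
  rewrite leqNgt; apply/negP => /ordering_fixed/paired_fixed pjj.
  by apply: nx; apply: paired_uniq pjj p01.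
have [od|ev] := boolP (odd (j - m)).
  have [k [jE mk evk]] := ordering_pred mj od; rewrite jE in jL p01 *.
  have [_ pk] := ordering_pair (ltnW jL) mk evk.
  rewrite -(paired_uniq (paired_sym pk) p01) !ordering_o // ?(ltnW jL) //.
  by rewrite subSn //= negbK.
have [jL' pj] := ordering_pair jL mj ev.
by rewrite -(paired_uniq pj p01) !ordering_o // subSn.
Qed.

Lemma Phi_blockE i j (a : 'I_(blk_k (kappa_of L) xs i))
    (b : 'I_(blk_k (kappa_of L) xs j)) : (i < size xs)%N -> (j < size xs)%N ->
  Phi_block c g0 (kappa_of L) (sigma_of L) xs m i j a b =
  B (vec L' (x_ i) a) (vec L' (x_ j) b).
Proof.
move=> iL jL; have oo := ordering_oriented.
have lta : (a < kappa_of L' (x_ i))%N by rewrite kL'.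
have ltb : (b < kappa_of L' (x_ j))%N by rewrite kL'.
(* For equal sizes [conform_mx] only relabels the columns and keeps their numerical index. *)
have conf k l (A1 : 'M[D]_k) (A0 : 'M[D]_(k, l)) (e : k = l) (u : 'I_k) (v : 'I_l) :
    conform_mx A0 A1 u v = A1 u (cast_ord (esym e) v).
  by case: _ / e in A0 v *; rewrite conform_mx_id cast_ord_id.
have step k : (k.+1 < size xs)%N -> x_ k <> x_ k.+1.
  move=> kL /(ordering_inj (ltnW kL) kL)/eqP.
  by rewrite ltn_eqF.
rewrite /Phi_block; case: ifP => [/andP[/eqP ij im]|/negbT n1].
  by subst j; rewrite conform_mx_id mxE S_fixedE //; apply: ordering_fixed.
case: ifP => [/and3P[mi ev /eqP jE]|/negbT n2].
  subst j; have [_ p] := ordering_pair iL mi ev.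
  have e : blk_k (kappa_of L) xs i = blk_k (kappa_of L) xs i.+1.
    exact: (kappa_paired oL p).
  rewrite (conf _ _ _ _ e) mxE -(inj_eq val_inj) /=.
  rewrite (oriented_gram oL' oo p (step i jL) _ lta ltb) ?ordering_o //.
  by case: (_ == _); rewrite ?mulr1n ?mulr0n.
case: ifP => [/and3P[mj ev /eqP iE]|/negbT n3].
  subst i; have [_ p] := ordering_pair jL mj ev.
  have e : blk_k (kappa_of L) xs j.+1 = blk_k (kappa_of L) xs j.
    exact/esym/(kappa_paired oL p).
  rewrite (conf _ _ _ _ e) mxE -(inj_eq val_inj) /= B_swap.
  rewrite (oriented_gram oL' oo p (step j iL) _ ltb lta) ?ordering_o // eq_sym.
  case: (_ == _); rewrite ?mulr1n ?mulr0n ?psi0 ?scaler0 //.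
  by rewrite psi_X // scalerA.
(* A fixed coset is paired only with itself and any other one only with its neighbour in the list;
   these positions were treated above, so here the cosets are not paired. *)
rewrite mxE; apply/esym; apply: contrapT => nB.
have p : paired (x_ i) (x_ j).
  by apply: contrapT => np; apply: nB; apply: vec_unpaired.
have [mi|im] := leqP m i; last first.
  have /paired_fixed pii := ordering_fixed im.
  have ij := ordering_inj iL jL (paired_uniq pii p).
  by move: n1; rewrite ij eqxx -{1}ij im.
have [od|ev] := boolP (odd (i - m)).
  have [k [iE mk evk]] := ordering_pred mi od; rewrite iE in iL p n3.
  have [_ pk] := ordering_pair (ltnW iL) mk evk.
  have kj := ordering_inj (ltnW iL) jL (paired_uniq (paired_sym pk) p).
  by move: n3; rewrite -kj mk evk eqxx.
have [iL' pi] := ordering_pair iL mi ev.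
have ij := ordering_inj iL' jL (paired_uniq pi p).
by move: n2; rewrite mi ev -ij eqxx.
Qed.

Import tagnat.
Let bk := fun i : 'I_(size xs) => blk_k (kappa_of L) xs i.
Let n := blk_dim (kappa_of L) xs.
Let ent (k : 'I_n) := entry L' (x_ (@sig1 _ bk k)) (@sig2 _ bk k).
Let w (k : 'I_n) : A := vec L' (x_ (@sig1 _ bk k)) (@sig2 _ bk k).
Let gam (k : 'I_n) : G := xi (x_ (@sig1 _ bk k)).
Let lt_sig2 (k : 'I_n) : (@sig2 _ bk k < kappa_of L' (x_ (@sig1 _ bk k)))%N.
Proof. by rewrite kL'. Qed.

Lemma ent_inj : injective ent.
Proof.
move=> k l /(entry_inj (lt_sig2 k) (lt_sig2 l))[xE aE].
have sE : @sig1 _ bk k = @sig1 _ bk l.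
  exact/val_inj/(ordering_inj (ltn_ord _) (ltn_ord _) xE).
by apply: val_inj; rewrite [LHS](@rect _ bk k) [RHS](@rect _ bk l) aE sE.
Qed.

Lemma ent_surj i s : (i < size L')%N -> p_has L'`@i s -> exists k, ent k = (i, s).
Proof.
move=> iL hi; have [a lta aE] := entry_surj iL hi.
set x := p_x L'`@i s in lta aE *.
have xxs : x \in xs by rewrite kappa_mem -kL' -lt0n (leq_ltn_trans _ lta).
have jL : (index x xs < size xs)%N by rewrite index_mem.
have xE : x_ (index x xs) = x by rewrite /blk_x nth_index.
have lta' : (a < bk (Ordinal jL))%N by rewrite /bk /blk_k xE -kL'.
exists (@Rank _ bk (Ordinal jL) (Ordinal lta')).
by rewrite /ent Rank2K /= Rank1K /= xE.
Qed.

Lemma entE k : [/\ ((ent k).1 < size L')%N, p_has L'`@((ent k).1) (ent k).2 &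
  w k = p_v L'`@((ent k).1) (ent k).2].
Proof. by have [iL hi _] := entryP (lt_sig2 k). Qed.

(** The partner is the other vector of the hyperbolic pair, or the vector itself on an anisotropic
    line; this is why Phi is monomial. *)
Lemma partner k : exists l, B (w k) (w l) <> 0 /\
  forall l', B (w k) (w l') <> 0 -> l' = l.
Proof.
have [iL hi wE] := entE k; set i := (ent k).1 in iL hi wE.
set s := (ent k).2 in hi wE; have pv := oL'.1 i iL.
have near l : B (w k) (w l) <> 0 -> (ent l).1 = i.
  have [jL hj lE] := entE l; rewrite wE lE => nB; apply: contrapT => ji.
  by apply: nB; apply: oL'.2 => // /esym.
have [hN|hN] := boolP (p_has L'`@i (~~ s)).
  have [l lE] := ent_surj iL hN.
  have pp : pair_valid hs c L'`@i.
    by apply: pair_has => //; move: hi hN; case: (s).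
  have [_ Tp B01 Bss _] := pp; have X0 := X_neq0 (c := c) Tp.
  exists l; split=> [|l' nB].
    have [_ _ ->] := entE l; rewrite lE wE /=.
    case: (s); rewrite /= ?B01 //; move/B_orth; rewrite B01; exact: X0.
  have e1 := near l' nB.
  apply: ent_inj; rewrite lE [LHS]surjective_pairing e1; congr (_, _).
  have [_ _ lE'] := entE l'; move: nB; rewrite wE lE' e1.
  by case: (s); case: ((ent l').2) => //; rewrite Bss.
exists k; split=> [|l' nB].
  have [fx nsk sx BE] := single_has pv hi hN; rewrite wE BE.
  have Tx := (fixedP GC hs c _).1 fx.
  have [gd d0] := diag_value_gr hs c (p_x L'`@i s) s.
  by case/(dv_domain (X_gr c Tx) gd) => [/(X_neq0 Tx)|].
have e1 := near l' nB.
apply: ent_inj; rewrite [LHS]surjective_pairing [RHS]surjective_pairing e1.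
congr (_, _); have [_ + _] := entE l'; rewrite e1 -/s.
by move: hi hN; case: (s); case: ((ent l').2) => //= _ /negPf ->.
Qed.

Lemma realization : exists2 Psi, is_Phi_inverse c g0 (sigma_of L) m Psi &
  graded_inv_isomorphic mul gr phi
    (matalg_mul (dv_alg d) (blk_dim (kappa_of L) xs))
    (matalg_gr c (kappa_of L) xs)
    (matalg_inv c g0 (sigma_of L) m Psi).
Proof.
pose P : 'M[D]_n := Phi c g0 (kappa_of L) (sigma_of L) xs m.
have PE k l : P k l = B (w k) (w l).
  by rewrite /P /Phi mxE Phi_blockE.
have wV k : V (w k) by have [] := vec_V oL' (lt_sig2 k).
have gw k : gr (gam k) (w k) by have [] := vec_V oL' (lt_sig2 k).
have wc z : V z -> (forall k, B (w k) z = 0) -> z = 0.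
  move=> Vz wz; apply: (orient_complete (o := o) cL) => // i s iL hi.
  have [k kE] := ent_surj iL hi; have [_ _ wE] := entE k.
  by have := wz k; rewrite wE kE.
have /choice[pi piP] := partner.
(* Orthogonality is symmetric, so pi is an involution. *)
have pi_inj : injective pi.
  move=> k k' kk; have [nB _] := piP k; have [nB' _] := piP k'.
  have [_ u] := piP (pi k).
  have -> : k = pi (pi k) by apply: u => /B_orth.
  by apply/esym/u => /B_orth; rewrite kk.
have P0 k l : l != pi k -> P k l = 0.
  move=> nl; rewrite PE; apply: contrapT => nB.
  by have [_ /(_ l nB)/eqP] := piP k; rewrite (negPf nl).
have Pn0 k : P k (pi k) <> 0 by rewrite PE; case: (piP k).
have [Psi [PsiP PPsi gPsi]] := graded_inverse gw PE pi_inj P0 Pn0.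
exists Psi; first by split.
pose f : A -> matalg D n := matrix_of hs w Psi.
have flin : linear f.
  move=> a x y; apply/matrixP => k l.
  transitivity (a *: f x k l + f y k l); first exact: matrix_of_lin.
  by rewrite [RHS]mxE; congr (_ + _); rewrite [RHS]mxE.
pose fL : {linear A -> matalg D n} :=
  HB.pack f (GRing.isLinear.Build R A (matalg D n) *:%R f flin).
exists fL; split.
- exact: (matrix_of_bij mul_assoc phi_inv wV PE wc PsiP PPsi).
- by move=> x y; apply: (matrix_ofM mul_assoc wV PE wc PPsi).
- move=> g; apply/seteqP; split=> [_ [r gr_r <-]|M gM].
    move=> i j a b t gE; rewrite /mat_block mxE.
    have := matrix_of_gr GC gr_grading gw gPsi (@Rank _ bk i a) (@Rank _ bk j b) gr_r.
    rewrite /gam !Rank1K; congr (Dgr _ _); rewrite -gE /blk_g.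
    by abelian GC.
  exists (of_matrix hs w Psi M); last exact: (of_matrixK mul_assoc wV PE PsiP).
  apply: (of_matrix_gr GC gr_grading gw gPsi) => k l.
  have := gM _ _ (@sig2 _ bk k) (@sig2 _ bk l) ((gam k)^-1 * g * gam l)%g.
  rewrite /mat_block mxE !sig2K; apply; rewrite /blk_g /gam.
  by abelian GC.
- by move=> r; apply: (matrix_of_phi phi_inv wV PE wc PPsi).
Qed.

End Ordering.

(** The fixed cosets come first. On the others x |-> g_0^-1 x^-1 is an involution without fixed
    points that preserves the support of kappa. *)
Lemma ordering_exists L : orthogonal_family hs c L ->
  exists xs m, support_ordering c g0 (kappa_of L) xs m.
Proof.
move=> oL; have [/finite_seqP[s sE] _ _ _] := multiplicity_of oL.
have sP x : (x \in undup s) = (kappa_of L x != 0%N).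
  rewrite mem_undup; have : [set` s] x <-> kappa_of L x <> 0%N by rewrite -sE.
  by move=> /= e; apply/idP/idP => [/e/eqP //|/eqP/e.2].
have /choice[dual dualP] x : exists y, paired x y.
  have [y [xy _]] := paired_exists (xi x).
  by exists y; rewrite ch_xiK in xy.
have dualK : involutive dual.
  by move=> x; apply: (paired_uniq (dualP (dual x))); apply: paired_sym.
pose nf := [seq x <- undup s | ~~ `[< fixed x >]].
have [||x|t [r [tP szt tE]]] := @pair_up _ dual nf.
- exact/filter_uniq/undup_uniq.
- exact: dualK.
- rewrite !mem_filter !sP => /andP[/asboolPn nfx kx].
  rewrite -(kappa_paired oL (dualP x)) kx andbT; split.
    apply/asboolPn => /paired_fixed pd; apply: nfx; apply/paired_fixed.
    have := paired_uniq pd (paired_sym (dualP x)) => dx.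
    by have := dualP x; rewrite dx.
  apply/eqP => dx; apply: nfx; apply/paired_fixed.
  by have := dualP x; rewrite dx.
pose f := [seq x <- undup s | `[< fixed x >]].
have ft : perm_eq (f ++ t) (undup s).
  by rewrite (perm_catl _ tP) perm_filterC.
exists (f ++ t), (size f); split.
- by rewrite (perm_uniq ft) undup_uniq.
- by move=> x; rewrite (perm_mem ft) sP.
- move=> i ilt; rewrite nth_cat ilt.
  have := mem_nth (quot_pi T 1%g) ilt; rewrite {1}/f mem_filter.
  by case/andP => /asboolP.
- exists r => [|j jr]; first by rewrite size_cat szt.
  apply/pairedP; rewrite -addnS !nth_cat !ltnNge !leq_addr /= !addKn tE //.
Qed.

End Blocks.

Theorem theorem18 (R : realType) (G : groupType)
    (G_abelian : forall g h : G, (g * h = h * g)%g)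
    (A : lmodType R) (mul : A -> A -> A) (gr : G -> set A) (phi : A -> A)
    (A_assoc : assoc_algebra mul)
    (A_graded : grading mul gr)
    (A_simple : graded_simple mul gr)
    (A_dcc : dcc_graded_left_ideals mul gr)
    (A_fin : finite_dim (gr 1%g))
    (phi_inv : graded_involution mul gr phi)
    (phi_central : central_with_involution mul gr phi) :
  exists d : divdata R G,
    inhabited (choices d) /\
    forall c : choices d,
    exists (g0 : G) (kappa : quot (dv_supp d) -> nat)
           (sigma : quot (dv_supp d) -> int),
      [/\ multiplicity_function c g0 kappa,
          signature_function c g0 kappa sigma,
          exists xs m, support_ordering c g0 kappa xs m
        & forall xs m, support_ordering c g0 kappa xs m ->
          exists2 Psi, is_Phi_inverse c g0 sigma m Psi &
            graded_inv_isomorphic mul gr phi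
              (matalg_mul (dv_alg d) (blk_dim kappa xs))
              (matalg_gr c kappa xs)
              (matalg_inv c g0 sigma m Psi)].
Proof.
have [d [hs]] := hermitian_space_exists G_abelian A_assoc A_graded A_simple
  A_dcc A_fin phi_inv phi_central.
exists d; split; first exact: choices_inhabited.
(* L is found before any ordering is given, so one kappa and one sigma serve all orderings; only the
   orientation of its pairs is adapted to each. *)
move=> c; have [L [oL cL]] := orthogonal_basis G_abelian A_assoc A_graded A_dcc hs c.
exists (hs_deg hs), (kappa_of L), (sigma_of hs c L); split.
- exact: multiplicity_of.
- exact: signature_of.
- exact: ordering_exists.
- by move=> xs m xsP; apply: realization.
Qed.
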